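(* An ultraproduct of full matrix algebras with respect to a nonprincipal ultrafilter $\mathcal U$ on $\mathbb N$, $\prod_{\mathcal U}M_n(\mathbb C)$, is not elementarily equivalent to a nuclear C*-algebra.
   Context: $\prod_{\mathcal U}M_n(\mathbb C)$ is the norm (C*-algebraic) ultraproduct: the quotient of the C*-algebra $\prod_nM_n(\mathbb C)$ of norm-bounded sequences by the ideal $\{(a_n):\lim_{n\to\mathcal U}\|a_n\|=0\}$. C*-algebras $A$ and $B$ are elementarily equivalent if $\varphi^A=\varphi^B$ for every sentence $\varphi$ of continuous logic in the language of C*-algebras. In this language a C*-algebra $A$ is a metric structure whose sorts are the balls $\{a:\|a\|\le n\}$, $n\in\mathbb N$, with metric $\|x-y\|$, and functions the restrictions of $+,\cdot,{}^*$, scalar multiplications, the constants $0$ and (if unital) $1$, and inclusions between balls; sentences are formulas without free variables, formulas being built from distances between *-polynomial terms by applying continuous functions $\mathbb R^n\to\mathbb R$ and $\sup_x,\inf_x$ over the sorts. *)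

(* Defs.v *)
From HB Require Import structures.
From mathcomp Require Import all_boot all_order all_algebra.
From mathcomp Require Import complex.
From mathcomp Require Import boolp classical_sets functions filter reals.
From mathcomp Require Import topology normedtype sequences.
From mathcomp Require Import lra.

Set Implicit Arguments.
Unset Strict Implicit.
Unset Printing Implicit Defensive.

Import Order.TTheory GRing.Theory Num.Theory numFieldNormedType.Exports.

Local Open Scope classical_set_scope.
Local Open Scope complex_scope.
Local Open Scope ring_scope.

(* The norm of a normed module over R[i] takes its values in R[i]; [rnorm] is
   the same norm as an element of R. *)
Definition rnorm (R : realType) (V : normedZmodType R[i]) (x : V) : R :=
  complex.Re `|x|.

Lemma ltC0r (R : realType) (e : R) : (0 < e%:C :> R[i]) = (0 < e).
Proof. exact: ltcR. Qed.

Section RNorm.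
Variables (R : realType) (V : normedZmodType R[i]).
Implicit Types x y : V.

Lemma posCE (e : R[i]) : 0 <= e -> e = (complex.Re e)%:C.
Proof. by move=> e0; rewrite RRe_real// ger0_real. Qed.

Lemma rnormE x : `|x| = (rnorm x)%:C.
Proof. exact: posCE. Qed.

Lemma rnorm_ge0 x : 0 <= rnorm x.
Proof. by rewrite -ler0c -rnormE. Qed.

Lemma rnormD x y : rnorm (x + y) <= rnorm x + rnorm y.
Proof. by rewrite -lecR rmorphD /= -!rnormE ler_normD. Qed.

Lemma rnorm0 : rnorm (0 : V) = 0.
Proof. by rewrite /rnorm normr0. Qed.

Lemma rnormN x : rnorm (- x) = rnorm x.
Proof. by rewrite /rnorm normrN. Qed.

Lemma rnorm_distC x y : rnorm (x - y) = rnorm (y - x).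
Proof. by rewrite /rnorm distrC. Qed.

Lemma rnorm_distD y x z : rnorm (x - z) <= rnorm (x - y) + rnorm (y - z).
Proof. by have := rnormD (x - y) (y - z); rewrite addrA subrK. Qed.

Lemma rnorm0_eq0 x : rnorm x = 0 -> x = 0.
Proof. by move=> x0; apply/eqP; rewrite -normr_eq0 rnormE x0. Qed.

End RNorm.

Lemma rnormZ (R : realType) (V : normedModType R[i]) (a : R[i]) (x : V) :
  rnorm (a *: x) = rnorm a * rnorm x.
Proof. by apply: (@complexI R); rewrite rmorphM /= -!rnormE normrZ. Qed.

Lemma rnormM (R : realType) (a b : R[i]) : rnorm (a * b) = rnorm a * rnorm b.
Proof. by apply: (@complexI R); rewrite rmorphM /= -!rnormE normrM. Qed.

Lemma rnormC (R : realType) (a : R) : rnorm (a%:C : R[i]) = `|a|.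
Proof.
apply: (@complexI R); rewrite -rnormE normc_def /= expr0n addr0.
by rewrite sqrtr_sqr.
Qed.

Lemma rnorm_conj (R : realType) (a : R[i]) : rnorm (a^*%R) = rnorm a.
Proof. by rewrite /rnorm norm_conjC. Qed.

Section FastCauchy.
Variable R : realType.

Lemma small_geom (K e : R) : 0 < e -> exists n, K * 2 ^- n < e.
Proof.
move=> e0; exists (Num.Def.archi_bound (`|K| / e)).
set i := Num.Def.archi_bound _.
have : `|K| / e < 2 ^+ i by apply: upper_nthrootP.
rewrite ltr_pdivrMr// ltr_pdivrMr ?exprn_gt0// mulrC; apply: le_lt_trans.
exact: ler_norm.
Qed.

Definition fast (V : normedZmodType R[i]) (x : nat -> V) (K : R) :=
  forall n, rnorm (x n.+1 - x n) <= K * 2 ^- n.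

Definition fast_complete (V : normedZmodType R[i]) :=
  forall (x : nat -> V) (K : R), fast x K ->
  exists (l : V) (K' : R), forall n, rnorm (x n - l) <= K' * 2 ^- n.

Lemma fast_gap (V : normedZmodType R[i]) (x : nat -> V) (K : R) :
  fast x K -> forall n m, (n <= m)%N -> rnorm (x m - x n) <= (2 * K) * 2 ^- n.
Proof.
move=> xK n m /subnK <-; rewrite addnC.
have K0 : 0 <= K by have := le_trans (rnorm_ge0 _) (xK 0%N); rewrite expr0 invr1 mulr1.
set k := (m - n)%N.
suff : rnorm (x (n + k)%N - x n) <= (2 * K) * (2 ^- n - 2 ^- (n + k)).
  move=> h; apply: (le_trans h); rewrite ler_wpM2l ?mulr_ge0//.
  by rewrite gerBl invr_ge0 exprn_ge0.
elim: k => [|k ih]; first by rewrite addn0 !subrr mulr0 rnorm0.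
apply: (le_trans (rnorm_distD (x (n + k)%N) _ _)).
apply: (le_trans (lerD _ ih)); first by rewrite addnS; exact: xK.
rewrite addnS [in leRHS]exprS invfM; set u := 2 ^- (n + k); set v := 2 ^- n.
lra.
Qed.

Lemma complete_fast (V : completeNormedModType R[i]) (x : nat -> V) (K : R) :
  fast x K -> exists l, forall n, rnorm (x n - l) <= (2 * K) * 2 ^- n.
Proof.
move=> xK; have gap := fast_gap xK.
have cx : cvg (x @ \oo).
  apply/cauchy_cvgP/cauchy_exP => e e0.
  have e0' : 0 < complex.Re e by rewrite -ltcR -posCE// ltW.
  have [N NK] := small_geom (2 * K) e0'.
  exists (x N); exists N => // n /= Nn.
  rewrite -ball_normE /= (posCE (ltW e0)) rnormE ltcR rnorm_distC.
  exact: le_lt_trans (gap _ _ Nn) NK.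
exists (lim (x @ \oo)) => n; apply/ler_addgt0Pr => e e0.
have [N _ Ne] : \forall m \near \oo, `|lim (x @ \oo) - x m| < e%:C.
  by move/cvgrPdist_lt : cx; apply; rewrite ltC0r.
have := Ne (maxn N n) (leq_maxl _ _); rewrite /= rnormE ltcR => h.
apply: (le_trans (rnorm_distD (x (maxn N n)) _ _)).
rewrite lerD//; first by rewrite rnorm_distC gap// leq_maxr.
by rewrite rnorm_distC ltW.
Qed.

Lemma fast_completeP (V : normedModType R[i]) : fast_complete V ->
  forall F : set_system V, ProperFilter F -> cauchy F -> cvg F.
Proof.
move=> fc F FF /cauchyP cF.
have /choice[x xF] n : exists x : V, F (ball x (2 ^- n)%:C).
  by apply: cF; rewrite ltC0r invr_gt0 exprn_gt0.
have [|l [K' lK]] := fc x 2.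
  move=> n.
  have [z []] := filter_ex (filterI (xF n) (xF n.+1)).
  rewrite -!ball_normE /= !rnormE !ltcR => h1 h2.
  apply: (le_trans (rnorm_distD z _ _)).
  rewrite [rnorm (z - _)]rnorm_distC (le_trans (lerD (ltW h2) (ltW h1)))//.
  rewrite exprS invfM; have : 0 < (2:R) ^- n by rewrite invr_gt0 exprn_gt0.
  lra.
apply/cvg_ex; exists l; apply/cvgrPdist_lt => e e0.
have e0' : 0 < complex.Re e by rewrite -ltcR -posCE// ltW.
have [N NK] := small_geom (K' + 1) e0'.
apply: filterS (xF N) => y; rewrite -ball_normE /= (posCE (ltW e0)).
rewrite !rnormE !ltcR => h; apply: le_lt_trans NK.
apply: (le_trans (rnorm_distD (x N) _ _)).
by rewrite mulrDl mul1r lerD ?(ltW h)// rnorm_distC.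
Qed.

Lemma fast_complete_C : fast_complete R[i].
Proof.
have realfast (u : nat -> R) K : (forall n, `|u n.+1 - u n| <= K * 2 ^- n) ->
    exists l, forall n, `|u n - l| <= (2 * K) * 2 ^- n.
  move=> uK.
  have gap : forall n m, (n <= m)%N -> `|u m - u n| <= (2 * K) * 2 ^- n.
    have uK' : @fast R[i] (fun n => (u n)%:C) K.
      by move=> n; rewrite -(rmorphB (real_complex R)) rnormC.
    move=> n m nm; have := fast_gap uK' nm.
    by rewrite -(rmorphB (real_complex R)) rnormC.
  pose E := range (fun n => u n - (2 * K) * 2 ^- n).
  have ub m : ubound E (u m + (2 * K) * 2 ^- m).
    move=> _ [n _ <-].
    case: (leqP n m) => nm.
      have := gap _ _ nm; have := gap _ _ (leqnn m); rewrite subrr normr0 ler_norml.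
      by lra.
    have := gap _ _ (ltnW nm); have := gap _ _ (leqnn n).
    rewrite subrr normr0 ler_norml; lra.
  have E0 : E !=set0 by exists (u 0%N - (2 * K) * 2 ^- 0); exists 0%N.
  exists (sup E) => n; rewrite ler_norml.
  have h1 : sup E <= u n + (2 * K) * 2 ^- n by apply: ge_sup.
  have h2 : u n - (2 * K) * 2 ^- n <= sup E.
    by apply: ub_le_sup; [exists (u 0%N + (2 * K) * 2 ^- 0); exact: ub|exists n].
  lra.
have ReD (z : R[i]) : `|complex.Re z| <= rnorm z.
  by rewrite -lecR -rnormE normc_ge_Re.
have ImD (z : R[i]) : `|complex.Im z| <= rnorm z.
  rewrite -lecR -rnormE normc_def lecR -sqrtr_sqr ler_sqrt ?lerDr ?sqr_ge0//.
  by rewrite addr_ge0// sqr_ge0.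
have rnormRI (z : R[i]) : rnorm z <= `|complex.Re z| + `|complex.Im z|.
  rewrite -lecR -rnormE normc_def lecR -[leRHS]ger0_norm ?addr_ge0//.
  rewrite -sqrtr_sqr ler_sqrt ?sqr_ge0// -[complex.Re z ^+ 2]real_normK ?num_real//.
  rewrite -[complex.Im z ^+ 2]real_normK ?num_real// sqrrD.
  by rewrite lerD2r lerDl mulrn_wge0// mulr_ge0.
move=> x K xK.
have [|a aP] := realfast (fun n => complex.Re (x n)) K.
  by move=> n; apply: le_trans (xK n) => /=; rewrite -raddfB; exact: ReD.
have [|b bP] := realfast (fun n => complex.Im (x n)) K.
  by move=> n; apply: le_trans (xK n) => /=; rewrite -raddfB; exact: ImD.
exists (a +i* b), (2 * K + 2 * K) => n; rewrite mulrDl.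
apply: (le_trans (rnormRI _)).
by rewrite !raddfB /= lerD.
Qed.

End FastCauchy.

(* C*-algebras, not assumed to be unital. *)
HB.mixin Record isCStarAlgebra (R : realType) A
    & CompleteNormedModule R[i] A := {
  cmul : A -> A -> A;
  adj : A -> A;
  cmulA : associative cmul;
  cmulDl : left_distributive cmul +%R;
  cmulDr : right_distributive cmul +%R;
  cmulZl : forall (c : R[i]) (x y : A), cmul (c *: x) y = c *: cmul x y;
  cmulZr : forall (c : R[i]) (x y : A), cmul x (c *: y) = c *: cmul x y;
  adjK : involutive adj;
  adjD : {morph adj : x y / x + y};
  adjZ : forall (c : R[i]) (x : A), adj (c *: x) = c^*%R *: adj x;
  adjM : forall x y : A, adj (cmul x y) = cmul (adj y) (adj x);
  cnormM : forall x y : A, `|cmul x y| <= `|x| * `|y|;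
  cstar_identity : forall x : A, `|cmul (adj x) x| = `|x| ^+ 2
}.

#[short(type="cstarAlgType")]
HB.structure Definition CStarAlgebra (R : realType) :=
  {A of isCStarAlgebra R A & CompleteNormedModule R[i] A}.

Section EuclideanNorm.
Variable R : realType.
Implicit Type n : nat.

Definition l2norm n (x : 'cV[R[i]]_n) : R :=
  Num.sqrt (\sum_i rnorm (x i 0) ^+ 2).

Definition hdot n (x y : 'cV[R[i]]_n) : R[i] := \sum_i x i 0 * (y i 0)^*%R.

Lemma hdotE n (x y : 'cV[R[i]]_n) : hdot x y = dotmx x^T y^T.
Proof. by rewrite dotmxE mxE; apply: eq_bigr => i _; rewrite !mxE. Qed.

Lemma l2_ge0 n (x : 'cV[R[i]]_n) : 0 <= l2norm x.
Proof. exact: sqrtr_ge0. Qed.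

Lemma l2sq n (x : 'cV[R[i]]_n) : l2norm x ^+ 2 = \sum_i rnorm (x i 0) ^+ 2.
Proof. by rewrite sqr_sqrtr// sumr_ge0// => i _; rewrite sqr_ge0. Qed.

Lemma hdotxx n (x : 'cV[R[i]]_n) : hdot x x = (l2norm x ^+ 2)%:C.
Proof.
rewrite l2sq rmorph_sum; apply: eq_bigr => i _.
by rewrite -normCK rnormE rmorphXn.
Qed.

Lemma sqrtC_hdot n (x : 'cV[R[i]]_n) : sqrtC (dotmx x^T x^T) = (l2norm x)%:C.
Proof. by rewrite -hdotE hdotxx rmorphXn /= sqrCK// ler0c l2_ge0. Qed.

Lemma hdot_CS n (x y : 'cV[R[i]]_n) : rnorm (hdot x y) <= l2norm x * l2norm y.
Proof.
rewrite -lecR -rnormE rmorphM /= -!sqrtC_hdot hdotE.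
by have [] := CauchySchwarz_sqrt (@dotmx _ n) x^T y^T.
Qed.

Lemma l2D n (x y : 'cV[R[i]]_n) : l2norm (x + y) <= l2norm x + l2norm y.
Proof.
rewrite -lecR rmorphD /= -!sqrtC_hdot linearD /=.
by have [] := triangle_lerif (@dotmx _ n) x^T y^T.
Qed.

Lemma l2Z n (a : R[i]) (x : 'cV[R[i]]_n) : l2norm (a *: x) = rnorm a * l2norm x.
Proof.
rewrite /l2norm -[rnorm a in RHS]ger0_norm ?rnorm_ge0// -sqrtr_sqr.
rewrite -sqrtrM ?sqr_ge0// mulr_sumr; congr Num.sqrt.
by apply: eq_bigr => i _; rewrite mxE rnormM exprMn.
Qed.

Lemma l2_0 n : l2norm (0 : 'cV[R[i]]_n) = 0.
Proof. by rewrite -(scale0r 0) l2Z rnorm0 mul0r. Qed.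

Lemma l2_entry n (x : 'cV[R[i]]_n) i : rnorm (x i 0) <= l2norm x.
Proof.
rewrite -[leLHS]ger0_norm ?rnorm_ge0// -sqrtr_sqr ler_sqrt ?sumr_ge0//.
  by rewrite (bigD1 i)//= lerDl sumr_ge0// => j _; rewrite sqr_ge0.
by move=> j _; rewrite sqr_ge0.
Qed.

Lemma l2_eq0 n (x : 'cV[R[i]]_n) : l2norm x = 0 -> x = 0.
Proof.
move=> x0; apply/colP => i; rewrite mxE; apply: rnorm0_eq0.
by apply/eqP; rewrite eq_le rnorm_ge0 -x0 l2_entry.
Qed.

Lemma l2_delta n (i : 'I_n) : l2norm (delta_mx i 0 : 'cV[R[i]]_n) = 1.
Proof.
rewrite /l2norm (bigD1 i)//= big1 ?addr0 => [|j ji].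
  by rewrite mxE !eqxx /= /rnorm normr1 expr1n sqrtr1.
by rewrite mxE (negbTE ji) /= rnorm0 expr0n.
Qed.

Lemma l2_sum n (x : 'cV[R[i]]_n) : l2norm x <= \sum_i rnorm (x i 0).
Proof.
have xE : x = \sum_i x i 0 *: delta_mx i 0.
  by rewrite [LHS]matrix_sum_delta; apply: eq_bigr => i _; rewrite big_ord1.
rewrite [in leLHS]xE.
apply: (big_ind2 (fun v r => l2norm v <= r)) => [|u a v b ua vb|i _].
- by rewrite l2_0.
- exact: le_trans (l2D _ _) (lerD ua vb).
- by rewrite l2Z l2_delta mulr1.
Qed.

End EuclideanNorm.

(* The C*-algebra M_n(C): the operator norm comes from the action of matrices
   on column vectors. *)
Definition matalg (R : realType) (n : nat) : Type := 'M[R[i]]_n.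

Section MatrixAlgebra.
Variables (R : realType) (n : nat).
Local Notation M := 'M[R[i]]_n.
Implicit Types A B : M.

HB.instance Definition _ := GRing.Lmodule.copy (matalg R n) M.

Definition opnorm A : R :=
  sup [set l2norm (A *m x) | x in [set x : 'cV[R[i]]_n | l2norm x <= 1]].

Definition mxadj A : M := map_mx Num.conj A^T.

Local Notation opset A :=
  [set l2norm (A *m x) | x in [set x : 'cV[R[i]]_n | l2norm x <= 1]].

Lemma opset0 A : opset A !=set0.
Proof. by exists 0, 0 => /=; rewrite ?mulmx0 l2_0. Qed.

Lemma opset_ub A : ubound (opset A) (\sum_i \sum_j rnorm (A i j)).
Proof.
move=> _ [x /= x1 <-]; apply: le_trans (l2_sum _) _; apply: ler_sum => i _.
rewrite mxE.
apply: (big_ind2 (fun v r => rnorm v <= r)) => [|u a v b ua vb|j _].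
- by rewrite rnorm0.
- exact: le_trans (rnormD _ _) (lerD ua vb).
- by rewrite rnormM ler_piMr ?rnorm_ge0// (le_trans _ x1)// l2_entry.
Qed.

Lemma opnorm_ub A : opnorm A <= \sum_i \sum_j rnorm (A i j).
Proof. by apply: ge_sup; [exact: opset0|exact: opset_ub]. Qed.

Lemma opnorm_ge0 A : 0 <= opnorm A.
Proof.
apply: ub_le_sup; first by exists (\sum_i \sum_j rnorm (A i j)); exact: opset_ub.
by exists 0 => /=; rewrite ?mulmx0 l2_0.
Qed.

Lemma opnormP A (x : 'cV[R[i]]_n) : l2norm (A *m x) <= opnorm A * l2norm x.
Proof.
have [/l2_eq0 ->|x0] := eqVneq (l2norm x) 0; first by rewrite mulmx0 l2_0 mulr0.
have xp : 0 < l2norm x by rewrite lt_def x0 l2_ge0.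
rewrite -ler_pdivrMr// mulrC.
have e : rnorm ((l2norm x)^-1%:C : R[i]) = (l2norm x)^-1.
  by rewrite rnormC ger0_norm// invr_ge0 l2_ge0.
rewrite -e -l2Z scalemxAr; apply: ub_le_sup.
  by exists (\sum_i \sum_j rnorm (A i j)); exact: opset_ub.
by exists ((l2norm x)^-1%:C *: x) => //=; rewrite l2Z e mulVf.
Qed.

Lemma opnorm_le A (c : R) : 0 <= c ->
  (forall x, l2norm (A *m x) <= c * l2norm x) -> opnorm A <= c.
Proof.
move=> c0 h; apply: ge_sup; first exact: opset0.
by move=> _ [x /= x1 <-]; apply: le_trans (h x) _; rewrite ler_piMr.
Qed.

Lemma opnorm_entry A i j : rnorm (A i j) <= opnorm A.
Proof.
have := opnormP A (delta_mx j 0); rewrite l2_delta mulr1; apply: le_trans.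
have -> : A i j = (A *m (delta_mx j 0 : 'cV_n)) i 0 by rewrite -colE mxE.
exact: l2_entry.
Qed.

Lemma opnormD A B : opnorm (A + B) <= opnorm A + opnorm B.
Proof.
apply: opnorm_le => [|x]; first by rewrite addr_ge0 ?opnorm_ge0.
by rewrite mulmxDl mulrDl (le_trans (l2D _ _))// lerD// opnormP.
Qed.

Lemma opnormM A B : opnorm (A *m B) <= opnorm A * opnorm B.
Proof.
apply: opnorm_le => [|x]; first by rewrite mulr_ge0 ?opnorm_ge0.
rewrite -mulmxA -mulrA (le_trans (opnormP _ _))//.
by rewrite ler_wpM2l ?opnorm_ge0// opnormP.
Qed.

Lemma opnormZ_le (a : R[i]) A : opnorm (a *: A) <= rnorm a * opnorm A.
Proof.
apply: opnorm_le => [|x]; first by rewrite mulr_ge0 ?opnorm_ge0 ?rnorm_ge0.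
by rewrite -scalemxAl l2Z -mulrA ler_wpM2l ?rnorm_ge0// opnormP.
Qed.

Lemma opnormZ (a : R[i]) A : opnorm (a *: A) = rnorm a * opnorm A.
Proof.
apply/eqP; rewrite eq_le opnormZ_le /=.
have [->|a0] := eqVneq a 0; first by rewrite rnorm0 mul0r opnorm_ge0.
have := opnormZ_le a^-1 (a *: A); rewrite scalerA mulVf// scale1r => h.
apply: le_trans (ler_wpM2l (rnorm_ge0 a) h) _.
by rewrite mulrA -rnormM mulfV// {1}/rnorm normr1 mul1r.
Qed.

Lemma opnorm_eq0 A : opnorm A = 0 -> A = 0.
Proof.
move=> A0; apply/matrixP => i j; rewrite mxE; apply: rnorm0_eq0.
by apply/eqP; rewrite eq_le rnorm_ge0 -A0 opnorm_entry.
Qed.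

Lemma hdot_adj A (x y : 'cV[R[i]]_n) : hdot (A *m x) y = hdot x (mxadj A *m y).
Proof.
rewrite !hdotE !dotmxE trmx_mul -mulmxA !trmx_mul map_mxM /=.
congr ((_ *m (_ *m _)) 0 0).
by apply/matrixP => i j; rewrite !mxE conjCK.
Qed.

Lemma mxadjK : involutive mxadj.
Proof. by move=> A; apply/matrixP => i j; rewrite !mxE conjCK. Qed.

Lemma mxadjM A B : mxadj (A *m B) = mxadj B *m mxadj A.
Proof. by rewrite /mxadj trmx_mul map_mxM. Qed.

Lemma mxadjD : {morph mxadj : A B / A + B}.
Proof. by move=> A B; apply/matrixP => i j; rewrite !mxE rmorphD. Qed.

Lemma mxadjZ (a : R[i]) A : mxadj (a *: A) = a^*%R *: mxadj A.
Proof. by apply/matrixP => i j; rewrite !mxE rmorphM. Qed.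

Lemma opnorm_sq_le A : opnorm A ^+ 2 <= opnorm (mxadj A *m A).
Proof.
set c := opnorm (mxadj A *m A).
have c0 : 0 <= c by exact: opnorm_ge0.
rewrite -[leRHS]sqr_sqrtr// ler_sqr ?nnegrE ?sqrtr_ge0 ?opnorm_ge0//.
apply: opnorm_le => [|x]; first exact: sqrtr_ge0.
rewrite -ler_sqr ?nnegrE ?mulr_ge0 ?sqrtr_ge0 ?l2_ge0//.
have h : l2norm (A *m x) ^+ 2 = rnorm (hdot x (mxadj A *m A *m x)).
  by rewrite -mulmxA -hdot_adj hdotxx rnormC ger0_norm// sqr_ge0.
rewrite h (le_trans (hdot_CS _ _))// exprMn sqr_sqrtr//.
by rewrite expr2 mulrCA ler_wpM2l ?l2_ge0// opnormP.
Qed.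

Lemma opnorm_adj_le A : opnorm A <= opnorm (mxadj A).
Proof.
have [->|A0] := eqVneq (opnorm A) 0; first exact: opnorm_ge0.
have Ap : 0 < opnorm A by rewrite lt_def A0 opnorm_ge0.
rewrite -(ler_pM2r Ap) -expr2.
exact: le_trans (opnorm_sq_le A) (opnormM _ _).
Qed.

Lemma opnorm_adj A : opnorm (mxadj A) = opnorm A.
Proof.
apply/eqP; rewrite eq_le opnorm_adj_le andbT.
by have := opnorm_adj_le (mxadj A); rewrite mxadjK.
Qed.

Lemma opnorm_cstar A : opnorm (mxadj A *m A) = opnorm A ^+ 2.
Proof.
apply/eqP; rewrite eq_le opnorm_sq_le andbT expr2.
by rewrite -[X in X * _]opnorm_adj opnormM.
Qed.

Let opnormCD (A B : matalg R n) :
  (opnorm (A + B))%:C <= (opnorm A)%:C + (opnorm B)%:C.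
Proof. by rewrite -rmorphD lecR opnormD. Qed.

Let opnormCZ (a : R[i]) (A : matalg R n) :
  (opnorm (a *: A))%:C = `|a| * (opnorm A)%:C.
Proof. by rewrite [X in X%:C]opnormZ rmorphM rnormE. Qed.

Let opnormC_eq0 (A : matalg R n) : (opnorm A)%:C = 0 -> A = 0.
Proof. by move=> /(@complexI R); exact: opnorm_eq0. Qed.

HB.instance Definition _ := Lmodule_isNormed.Build R[i] (matalg R n)
  opnormCD opnormCZ opnormC_eq0.

Lemma matalg_normE (A : matalg R n) : rnorm A = opnorm A.
Proof. by []. Qed.

Lemma matalg_fast_complete : fast_complete (matalg R n).
Proof.
move=> x K xK.
have /choice[l /choice[K' lK]] (ij : 'I_n * 'I_n) : exists l K', forall k,
    rnorm (x k ij.1 ij.2 - l) <= K' * 2 ^- k.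
  apply: (@fast_complete_C R (fun k => x k ij.1 ij.2) K) => k.
  apply: le_trans (xK k); rewrite matalg_normE.
  by have := opnorm_entry (x k.+1 - x k) ij.1 ij.2; rewrite !mxE.
exists (\matrix_(i, j) l (i, j)), (\sum_i \sum_j K' (i, j)) => k.
rewrite matalg_normE (le_trans (opnorm_ub _))// mulr_suml.
apply: ler_sum => i _; rewrite mulr_suml; apply: ler_sum => j _.
by rewrite !mxE; exact: (lK (i, j)).
Qed.

HB.instance Definition _ := Uniform_isComplete.Build (matalg R n)
  (fast_completeP matalg_fast_complete).

Let mulA : associative (fun A B : matalg R n => A *m B : matalg R n).
Proof. exact: mulmxA. Qed.
Let mulDl : left_distributive (fun A B : matalg R n => A *m B : matalg R n) +%R.
Proof. by move=> A B C; exact: mulmxDl. Qed.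
Let mulDr : right_distributive (fun A B : matalg R n => A *m B : matalg R n) +%R.
Proof. by move=> A B C; exact: mulmxDr. Qed.
Let mulZl (c : R[i]) (A B : matalg R n) :
  ((c *: A : matalg R n) *m B : matalg R n) = c *: (A *m B : matalg R n).
Proof. exact/esym/(scalemxAl c A B). Qed.
Let mulZr (c : R[i]) (A B : matalg R n) :
  (A *m (c *: B : matalg R n) : matalg R n) = c *: (A *m B : matalg R n).
Proof. exact/esym/(scalemxAr c A B). Qed.
Let normM (A B : matalg R n) : `|A *m B : matalg R n| <= `|A| * `|B|.
Proof. by rewrite !rnormE -rmorphM lecR; exact: opnormM. Qed.
Let norm_cstar (A : matalg R n) :
  `|mxadj A *m A : matalg R n| = `|A| ^+ 2.
Proof. by rewrite !rnormE -rmorphXn; congr (_%:C); exact: opnorm_cstar. Qed.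

HB.instance Definition _ := isCStarAlgebra.Build R (matalg R n)
  mulA mulDl mulDr mulZl mulZr mxadjK mxadjD mxadjZ mxadjM normM norm_cstar.

End MatrixAlgebra.


Lemma rnorm_cmul (R : realType) (B : cstarAlgType R) (x y : B) :
  rnorm (cmul x y) <= rnorm x * rnorm y.
Proof. by rewrite -lecR rmorphM /= -!rnormE cnormM. Qed.

Lemma rnorm_cstar (R : realType) (B : cstarAlgType R) (x : B) :
  rnorm (cmul (adj x) x) = rnorm x ^+ 2.
Proof.
by apply: (@complexI R); rewrite rmorphXn /= -!rnormE cstar_identity.
Qed.

Lemma rnorm_adj (R : realType) (B : cstarAlgType R) (x : B) : rnorm (adj x) = rnorm x.
Proof.
have le (y : B) : rnorm y <= rnorm (adj y).
  have [->|y0] := eqVneq (rnorm y) 0; first exact: rnorm_ge0.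
  have yp : 0 < rnorm y by rewrite lt_def y0 rnorm_ge0.
  rewrite -(ler_pM2r yp) -expr2 -lecR rmorphXn rmorphM /= -!rnormE.
  by rewrite -cstar_identity cnormM.
by apply/eqP; rewrite eq_le le andbT; have := le (adj x); rewrite adjK.
Qed.

(* The product of a sequence of C*-algebras: bounded sequences with the
   supremum norm. *)
Section Product.
Variables (R : realType) (A : nat -> cstarAlgType R).

Definition bounded_seq (a : forall n, A n) : Prop :=
  exists M : R, forall n, rnorm (a n) <= M.

Record cprod : Type := CProd {
  cprod_val :> forall n, A n;
  cprod_bounded : bounded_seq cprod_val
}.

HB.instance Definition _ := gen_eqMixin cprod.
HB.instance Definition _ := gen_choiceMixin cprod.

Lemma cprodP (a b : cprod) : (forall n, a n = b n) -> a = b.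
Proof.
case: a b => [a Ha] [b Hb] /= ab.
have {}ab : a = b by exact: functional_extensionality_dep.
by subst b; congr CProd; exact: Prop_irrelevance.
Qed.

Fact bounded0 : bounded_seq (fun=> 0).
Proof. by exists 0 => n; rewrite rnorm0. Qed.
Fact boundedN (a : cprod) : bounded_seq (fun n => - a n).
Proof. by case: a => a [M aM]; exists M => n; rewrite rnormN. Qed.
Fact boundedD (a b : cprod) : bounded_seq (fun n => a n + b n).
Proof.
case: a b => [a [M aM]] [b [N bN]]; exists (M + N) => n.
by rewrite (le_trans (rnormD _ _))// lerD.
Qed.
Fact boundedZ (c : R[i]) (a : cprod) : bounded_seq (fun n => c *: a n).
Proof.
case: a => a [M aM]; exists (rnorm c * M) => n.
by rewrite rnormZ ler_wpM2l ?rnorm_ge0 ?aM.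
Qed.
Fact boundedM (a b : cprod) : bounded_seq (fun n => cmul (a n) (b n)).
Proof.
case: a b => [a [M aM]] [b [N bN]]; exists (M * N) => n /=.
by rewrite (le_trans (rnorm_cmul _ _))// ler_pM ?rnorm_ge0.
Qed.

Fact bounded_adj (a : cprod) : bounded_seq (fun n => adj (a n)).
Proof. by case: a => a [M aM]; exists M => n; rewrite rnorm_adj. Qed.

Definition cprod_add a b := CProd (boundedD a b).
Definition cprod_mul a b := CProd (boundedM a b).
Definition cprod_opp a := CProd (boundedN a).
Definition cprod_scale c a := CProd (boundedZ c a).
Definition cprod_adj a := CProd (bounded_adj a).

Let addA : associative cprod_add.
Proof. by move=> a b c; apply: cprodP => n; rewrite /= addrA. Qed.
Let addC : commutative cprod_add.
Proof. by move=> a b; apply: cprodP => n; rewrite /= addrC. Qed.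
Let add0 : left_id (CProd bounded0) cprod_add.
Proof. by move=> a; apply: cprodP => n; rewrite /= add0r. Qed.
Let addN : left_inverse (CProd bounded0) cprod_opp cprod_add.
Proof. by move=> a; apply: cprodP => n; rewrite /= addNr. Qed.

HB.instance Definition _ := GRing.isZmodule.Build cprod addA addC add0 addN.

Let scaleA (c d : R[i]) (a : cprod) :
  cprod_scale c (cprod_scale d a) = cprod_scale (c * d) a.
Proof. by apply: cprodP => n; rewrite /= scalerA. Qed.
Let scale1 : left_id 1 cprod_scale.
Proof. by move=> a; apply: cprodP => n; rewrite /= scale1r. Qed.
Let scaleDr : right_distributive cprod_scale +%R.
Proof. by move=> c a b; apply: cprodP => n; rewrite /= scalerDr. Qed.
Let scaleDl (a : cprod) : {morph cprod_scale^~ a : c d / c + d}.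
Proof. by move=> c d; apply: cprodP => n; rewrite /= scalerDl. Qed.

HB.instance Definition _ :=
  GRing.Zmodule_isLmodule.Build R[i] cprod scaleA scale1 scaleDr scaleDl.

Definition supnorm (a : cprod) : R := sup (range (fun n => rnorm (a n))).

Lemma supnorm_ub (a : cprod) n : rnorm (a n) <= supnorm a.
Proof.
apply: ub_le_sup; last by exists n.
by have [M aM] := cprod_bounded a; exists M => _ [m _ <-].
Qed.

Lemma supnorm_le (a : cprod) (c : R) :
  (forall n, rnorm (a n) <= c) -> supnorm a <= c.
Proof.
move=> h; apply: ge_sup; first by exists (rnorm (a 0%N)), 0%N.
by move=> _ [n _ <-].
Qed.

Lemma supnorm_ge0 (a : cprod) : 0 <= supnorm a.
Proof. exact: le_trans (rnorm_ge0 _) (supnorm_ub a 0%N). Qed.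

Lemma supnormZ_le (c : R[i]) (a : cprod) :
  supnorm (c *: a) <= rnorm c * supnorm a.
Proof.
apply: supnorm_le => n.
by rewrite [leLHS]rnormZ ler_wpM2l ?rnorm_ge0// supnorm_ub.
Qed.

Let normCD (a b : cprod) : (supnorm (a + b))%:C <= (supnorm a)%:C + (supnorm b)%:C.
Proof.
rewrite -rmorphD lecR; apply: supnorm_le => n.
by rewrite (le_trans (rnormD _ _))// lerD// supnorm_ub.
Qed.

Let normCZ (c : R[i]) (a : cprod) : (supnorm (c *: a))%:C = `|c| * (supnorm a)%:C.
Proof.
rewrite [`|c|]rnormE -rmorphM; congr (_%:C); apply/eqP.
rewrite eq_le supnormZ_le /=.
have [->|c0] := eqVneq c 0; first by rewrite rnorm0 mul0r supnorm_ge0.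
have := supnormZ_le c^-1 (c *: a); rewrite scalerA mulVf// scale1r => h.
apply: le_trans (ler_wpM2l (rnorm_ge0 c) h) _.
by rewrite mulrA -rnormM mulfV// {1}/rnorm normr1 mul1r.
Qed.

Let normC_eq0 (a : cprod) : (supnorm a)%:C = 0 -> a = 0.
Proof.
move=> /(@complexI R) a0; apply: cprodP => n; apply: rnorm0_eq0.
by apply/eqP; rewrite eq_le rnorm_ge0 -[0]a0 supnorm_ub.
Qed.

HB.instance Definition _ := Lmodule_isNormed.Build R[i] cprod
  normCD normCZ normC_eq0.

Lemma cprod_normE (a : cprod) : rnorm a = supnorm a.
Proof. by []. Qed.

Lemma cprod_fast_complete : fast_complete cprod.
Proof.
move=> x K xK.
have fx n : fast (fun k => x k n) K.
  move=> k; apply: le_trans (xK k).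
  exact: (supnorm_ub (x k.+1 - x k) n).
have lP n : {l : A n | forall k, rnorm (x k n - l) <= (2 * K) * 2 ^- k}.
  exact/cid/complete_fast/fx.
pose l n := sval (lP n).
have lb : bounded_seq l.
  exists (supnorm (x 0%N) + 2 * K) => n.
  have := svalP (lP n) 0%N; rewrite expr0 invr1 mulr1 => h.
  rewrite -[l n](subrK (x 0%N n)) addrC (le_trans (rnormD _ _))//.
  by rewrite lerD ?supnorm_ub// rnorm_distC.
exists (CProd lb), (2 * K) => k; rewrite cprod_normE.
by apply: supnorm_le => n; exact: (svalP (lP n) k).
Qed.

HB.instance Definition _ := Uniform_isComplete.Build cprod
  (fast_completeP cprod_fast_complete).

Let mulA : associative cprod_mul.
Proof. by move=> a b c; apply: cprodP => n; rewrite /= cmulA. Qed.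
Let mulDl : left_distributive cprod_mul +%R.
Proof. by move=> a b c; apply: cprodP => n; rewrite /= cmulDl. Qed.
Let mulDr : right_distributive cprod_mul +%R.
Proof. by move=> a b c; apply: cprodP => n; rewrite /= cmulDr. Qed.
Let mulZl (c : R[i]) (a b : cprod) : cprod_mul (c *: a) b = c *: cprod_mul a b.
Proof. by apply: cprodP => n; rewrite /= cmulZl. Qed.
Let mulZr (c : R[i]) (a b : cprod) : cprod_mul a (c *: b) = c *: cprod_mul a b.
Proof. by apply: cprodP => n; rewrite /= cmulZr. Qed.
Let adjK' : involutive cprod_adj.
Proof. by move=> a; apply: cprodP => n; rewrite /= adjK. Qed.
Let adjD' : {morph cprod_adj : a b / a + b}.
Proof. by move=> a b; apply: cprodP => n; rewrite /= adjD. Qed.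
Let adjZ' (c : R[i]) (a : cprod) : cprod_adj (c *: a) = c^*%R *: cprod_adj a.
Proof. by apply: cprodP => n; rewrite /= adjZ. Qed.
Let adjM' (a b : cprod) :
  cprod_adj (cprod_mul a b) = cprod_mul (cprod_adj b) (cprod_adj a).
Proof. by apply: cprodP => n; rewrite /= adjM. Qed.

Let normM (a b : cprod) : `|cprod_mul a b| <= `|a| * `|b|.
Proof.
rewrite !rnormE -rmorphM lecR !cprod_normE; apply: supnorm_le => n /=.
apply: le_trans (rnorm_cmul _ _) _.
by rewrite ler_pM ?rnorm_ge0 ?supnorm_ub.
Qed.

Let norm_cstar (a : cprod) : `|cprod_mul (cprod_adj a) a| = `|a| ^+ 2.
Proof.
rewrite !rnormE -rmorphXn; congr (_%:C); rewrite !cprod_normE.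
apply/eqP; rewrite eq_le; apply/andP; split.
  apply: supnorm_le => n; rewrite /= rnorm_cstar.
  by rewrite ler_sqr ?nnegrE ?rnorm_ge0 ?supnorm_ge0 ?supnorm_ub.
set s := supnorm (cprod_mul _ _).
have s0 : 0 <= s by exact: supnorm_ge0.
rewrite -[leRHS]sqr_sqrtr// ler_sqr ?nnegrE ?sqrtr_ge0 ?supnorm_ge0//.
apply: supnorm_le => n.
rewrite -ler_sqr ?nnegrE ?sqrtr_ge0 ?rnorm_ge0// sqr_sqrtr//.
rewrite -rnorm_cstar; exact: (supnorm_ub (cprod_mul (cprod_adj a) a) n).
Qed.

HB.instance Definition _ := isCStarAlgebra.Build R cprod
  mulA mulDl mulDr mulZl mulZr adjK' adjD' adjZ' adjM' normM norm_cstar.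

End Product.

(* The ultraproduct: the quotient of the product by the ideal of the sequences
   whose norms tend to 0 along the ultrafilter, with the quotient norm. *)
Section Ultraproduct.
Variables (R : realType) (U : set_system nat) (UU : UltraFilter U).
Variable A : nat -> cstarAlgType R.
Local Notation P := (cprod A).

Definition null_ideal : {pred P} :=
  fun a => `[< (fun n => rnorm (a n)) @ U --> (0 : R) >].

Lemma null_idealP (a : P) :
  reflect (forall e : R, 0 < e -> \forall n \near U, rnorm (a n) < e)
    (a \in null_ideal).
Proof.
rewrite -topredE /=; apply: (iffP (asboolP _)) => [/cvgrPdist_lt h e e0|h].
  have := h e e0; apply: filterS => n.
  by rewrite sub0r normrN ger0_norm ?rnorm_ge0.
apply/cvgrPdist_lt => e /h; apply: filterS => n.
by rewrite sub0r normrN ger0_norm ?rnorm_ge0.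
Qed.

Let null_ideal_closed : zmod_closed null_ideal.
Proof.
split=> [|a b /null_idealP ha /null_idealP hb]; apply/null_idealP => e e0.
  by apply: filterE => n; rewrite rnorm0.
have e20 : 0 < e / 2 by rewrite divr_gt0.
apply: filterS2 (ha _ e20) (hb _ e20) => n h1 h2.
by rewrite (le_lt_trans (rnormD _ _))// rnormN [ltRHS]splitr ltrD.
Qed.

HB.instance Definition _ := GRing.isZmodClosed.Build P null_ideal
  null_ideal_closed.

Definition ultraproduct : Type := Quotient.quot null_ideal.

HB.instance Definition _ := GRing.Zmodule.on ultraproduct.

Definition ucls (a : P) : ultraproduct := \pi_(Quotient.quot null_ideal)%qT a.
Definition urepr (x : ultraproduct) : P := repr (x : Quotient.quot null_ideal).

Lemma ureprK x : ucls (urepr x) = x.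
Proof. exact: reprK. Qed.

Lemma ucls_eq a b : ucls a = ucls b <-> a - b \in null_ideal.
Proof. by rewrite Quotient.idealrBE; split=> /eqP. Qed.

Lemma uclsD a b : ucls (a + b) = ucls a + ucls b.
Proof. exact: raddfD. Qed.

Lemma null_idealZ c a : a \in null_ideal -> c *: a \in null_ideal.
Proof.
move=> /null_idealP ha; apply/null_idealP => e e0.
have c0 : 0 < rnorm c + 1 by rewrite ltr_wpDl ?rnorm_ge0.
have := ha (e / (rnorm c + 1)) (divr_gt0 e0 c0); apply: filterS => n.
rewrite ltr_pdivlMr// mulrC => h; rewrite [ltLHS]rnormZ; apply: le_lt_trans h.
by rewrite ler_wpM2r ?rnorm_ge0// lerDl.
Qed.

Lemma null_idealMl a b : b \in null_ideal -> cmul a b \in null_ideal.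
Proof.
move=> /null_idealP hb; apply/null_idealP => e e0.
have c0 : 0 < supnorm a + 1 by rewrite ltr_wpDl ?supnorm_ge0.
have := hb (e / (supnorm a + 1)) (divr_gt0 e0 c0); apply: filterS => n.
rewrite ltr_pdivlMr// mulrC => h; apply: le_lt_trans h.
rewrite (le_trans (rnorm_cmul _ _))// ler_wpM2r ?rnorm_ge0//.
by rewrite (le_trans (supnorm_ub _ _))// lerDl.
Qed.

Lemma null_ideal_adj a : a \in null_ideal -> adj a \in null_ideal.
Proof.
move=> /null_idealP hb; apply/null_idealP => e /hb; apply: filterS => n.
by rewrite rnorm_adj.
Qed.

Lemma null_idealMr a b : a \in null_ideal -> cmul a b \in null_ideal.
Proof.
by move=> h; rewrite -[cmul a b]adjK adjM null_ideal_adj// null_idealMl// null_ideal_adj.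
Qed.

Definition uscale (c : R[i]) (x : ultraproduct) := ucls (c *: urepr x).
Definition umul (x y : ultraproduct) := ucls (cmul (urepr x) (urepr y)).
Definition uadj (x : ultraproduct) := ucls (adj (urepr x)).

Lemma urepr_ucls a : urepr (ucls a) - a \in null_ideal.
Proof. by apply/ucls_eq; rewrite ureprK. Qed.

Lemma ucls_scale c a : uscale c (ucls a) = ucls (c *: a).
Proof. by apply/ucls_eq; rewrite -scalerBr null_idealZ ?urepr_ucls. Qed.

Lemma ucls_adj a : uadj (ucls a) = ucls (adj a).
Proof.
apply/ucls_eq; suff <- : adj (urepr (ucls a) - a) = adj (urepr (ucls a)) - adj a.
  by rewrite null_ideal_adj ?urepr_ucls.
by rewrite adjD -scaleN1r adjZ rmorphN rmorph1 scaleN1r.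
Qed.

Lemma ucls_mul a b : umul (ucls a) (ucls b) = ucls (cmul a b).
Proof.
apply/ucls_eq; set a' := urepr _; set b' := urepr _.
have -> : cmul a' b' - cmul a b = cmul (a' - a) b' + cmul a (b' - b).
  rewrite cmulDl cmulDr -(scaleN1r a) -(scaleN1r b) cmulZl cmulZr !scaleN1r.
  by rewrite addrA addrNK.
by apply: rpredD; [apply: null_idealMr|apply: null_idealMl]; exact: urepr_ucls.
Qed.

Let elim1 (Q : ultraproduct -> Prop) : (forall a, Q (ucls a)) -> forall x, Q x.
Proof. by move=> h x; rewrite -(ureprK x). Qed.

Let scaleA (c d : R[i]) (x : ultraproduct) :
  uscale c (uscale d x) = uscale (c * d) x.
Proof. by elim/elim1: x => a; rewrite !ucls_scale scalerA. Qed.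
Let scale1 : left_id 1 uscale.
Proof. by elim/elim1 => a; rewrite ucls_scale scale1r. Qed.
Let scaleDr : right_distributive uscale +%R.
Proof.
move=> c; elim/elim1 => a; elim/elim1 => b.
by rewrite -uclsD !ucls_scale scalerDr uclsD.
Qed.
Let scaleDl (x : ultraproduct) : {morph uscale^~ x : c d / c + d}.
Proof.
by elim/elim1: x => a c d; rewrite !ucls_scale scalerDl uclsD.
Qed.

HB.instance Definition _ := GRing.Zmodule_isLmodule.Build R[i] ultraproduct
  scaleA scale1 scaleDr scaleDl.

Definition unorm (x : ultraproduct) : R :=
  inf [set supnorm a | a in [set a : P | ucls a = x]].

Lemma unorm_lb x : has_lbound [set supnorm a | a in [set a : P | ucls a = x]].
Proof. by exists 0 => _ [a _ <-]; exact: supnorm_ge0. Qed.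

Lemma unorm_neq0 x : [set supnorm a | a in [set a : P | ucls a = x]] !=set0.
Proof. by exists (supnorm (urepr x)), (urepr x) => //=; exact: ureprK. Qed.

Lemma unorm_le (a : P) : unorm (ucls a) <= supnorm a.
Proof. by apply: ge_inf; [exact: unorm_lb|exists a]. Qed.

Lemma unorm_lift x (e : R) : 0 < e -> exists2 a, ucls a = x & supnorm a < unorm x + e.
Proof.
move=> e0.
have [_ [a ax <-] h] := inf_adherent e0 (conj (unorm_neq0 x) (unorm_lb x)).
by exists a.
Qed.

Lemma unorm_ge0 x : 0 <= unorm x.
Proof. by apply: lb_le_inf; [exact: unorm_neq0|move=> _ [a _ <-]; exact: supnorm_ge0]. Qed.

Lemma unorm_leU (a : P) (c : R) : 0 <= c ->
  (\forall n \near U, rnorm (a n) <= c) -> unorm (ucls a) <= c.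
Proof.
move=> c0 h.
pose b n := if rnorm (a n) <= c then a n else 0.
have bb : bounded_seq b.
  by exists c => n; rewrite /b; case: ifP => // _; rewrite rnorm0.
have <- : ucls (CProd bb) = ucls a.
  apply/ucls_eq/null_idealP => e e0; apply: filterS h => n /= an.
  by rewrite /b an subrr rnorm0.
apply: (le_trans (unorm_le _)); apply: supnorm_le => n /=.
by rewrite /b; case: ifP => // _; rewrite rnorm0.
Qed.

Lemma unorm_nearU (a : P) (e : R) : 0 < e ->
  \forall n \near U, rnorm (a n) < unorm (ucls a) + e.
Proof.
move=> e0; have e20 : 0 < e / 2 by rewrite divr_gt0.
have [b /esym/ucls_eq/null_idealP/(_ _ e20) ba hb] := unorm_lift (ucls a) e20.
apply: filterS ba => n h.
rewrite -[a n](subrK (b n)) (le_lt_trans (rnormD _ _))//.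
by rewrite [e]splitr addrA addrC ltrD// (le_lt_trans (supnorm_ub _ _)).
Qed.

(* The quotient norm is the limit of the norms along the ultrafilter. *)
Lemma unorm_cvg (a : P) : (fun n => rnorm (a n)) @ U --> unorm (ucls a).
Proof.
apply/cvgrPdist_lt => e e0.
have hi := unorm_nearU a e0.
suff lo : \forall n \near U, unorm (ucls a) - e < rnorm (a n).
  by apply: filterS2 hi lo => n h1 h2; rewrite ltr_norml; lra.
have [//|] := in_ultra_setVsetC [set n | unorm (ucls a) - e < rnorm (a n)] UU.
move=> h.
have h' : \forall n \near U, rnorm (a n) <= Num.max 0 (unorm (ucls a) - e).
  by apply: filterS h => n /= /negP; rewrite -leNgt le_max => ->; rewrite orbT.
have : unorm (ucls a) <= Num.max 0 (unorm (ucls a) - e).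
  by apply: unorm_leU h'; rewrite le_max lexx.
rewrite le_max => /orP[u0|]; last lra.
apply: filterE => n; apply: lt_le_trans (rnorm_ge0 _); lra.
Qed.

Let unormD x y : unorm (x + y) <= unorm x + unorm y.
Proof.
apply/ler_addgt0Pr => e e0; have e20 : 0 < e / 2 by rewrite divr_gt0.
have [a <- ha] := unorm_lift x e20; have [b <- hb] := unorm_lift y e20.
rewrite -uclsD; apply: (le_trans (unorm_le _)).
have : supnorm (a + b) <= supnorm a + supnorm b.
  by rewrite -!cprod_normE rnormD.
move: ha hb; lra.
Qed.

Let unormZ_le c x : unorm (c *: x) <= rnorm c * unorm x.
Proof.
apply/ler_addgt0Pr => e e0.
have c0 : 0 < rnorm c + 1 by rewrite ltr_wpDl ?rnorm_ge0.
have [a ax ha] := unorm_lift x (divr_gt0 e0 c0).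
rewrite -[in leLHS]ax [X in unorm X]ucls_scale; apply: (le_trans (unorm_le _)).
rewrite -cprod_normE rnormZ cprod_normE.
apply: (le_trans (ler_wpM2l (rnorm_ge0 c) (ltW ha))).
rewrite mulrDr lerD2l mulrCA ger_pMr// ler_pdivrMr// mul1r lerDl//.
Qed.

Let normCD (x y : ultraproduct) :
  (unorm (x + y))%:C <= (unorm x)%:C + (unorm y)%:C.
Proof. by rewrite -rmorphD lecR unormD. Qed.

Let normCZ (c : R[i]) (x : ultraproduct) :
  (unorm (c *: x))%:C = `|c| * (unorm x)%:C.
Proof.
rewrite [`|c|]rnormE -rmorphM; congr (_%:C); apply/eqP.
rewrite eq_le unormZ_le /=.
have [->|c0] := eqVneq c 0; first by rewrite rnorm0 mul0r unorm_ge0.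
have := unormZ_le c^-1 (c *: x); rewrite scalerA mulVf// scale1r => h.
apply: le_trans (ler_wpM2l (rnorm_ge0 c) h) _.
by rewrite mulrA -rnormM mulfV// {1}/rnorm normr1 mul1r.
Qed.

Let normC_eq0 (x : ultraproduct) : (unorm x)%:C = 0 -> x = 0.
Proof.
move=> /(@complexI R); elim/elim1: x => a a0.
have -> : 0 = ucls 0 by exact/esym/raddf0.
apply/ucls_eq; rewrite subr0; apply/null_idealP => e e0.
by have := unorm_nearU a e0; rewrite a0 add0r.
Qed.

HB.instance Definition _ := Lmodule_isNormed.Build R[i] ultraproduct
  normCD normCZ normC_eq0.

Lemma ultraproduct_normE (x : ultraproduct) : rnorm x = unorm x.
Proof. by []. Qed.

Lemma ultraproduct_fast_complete : fast_complete ultraproduct.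
Proof.
move=> x K xK.
have /choice[d dP] n : exists d : P,
    ucls d = x n.+1 - x n /\ supnorm d <= (K + 1) * 2 ^- n.
  have e0 : 0 < (2 : R) ^- n by rewrite invr_gt0 exprn_gt0.
  have [d dx h] := unorm_lift (x n.+1 - x n) e0; exists d; split => //.
  by rewrite mulrDl mul1r (le_trans (ltW h))// lerD2r; exact: xK.
pose y := fix y n := if n is m.+1 then y m + d m else urepr (x 0%N).
have yx n : ucls (y n) = x n.
  elim: n => [|n ih] /=; first exact: ureprK.
  by rewrite uclsD ih (dP n).1 addrC subrK.
have yK : fast y (K + 1).
  by move=> n; rewrite /= addrAC subrr add0r; exact: (dP n).2.
have [l lP] := complete_fast yK.
exists (ucls l), (2 * (K + 1)) => n; apply: le_trans (lP n).
rewrite -yx; have -> : ucls (y n) - ucls l = ucls (y n - l) by exact/esym/raddfB.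
exact: unorm_le.
Qed.

HB.instance Definition _ := Uniform_isComplete.Build ultraproduct
  (fast_completeP ultraproduct_fast_complete).

Let mulA : associative umul.
Proof.
elim/elim1 => a; elim/elim1 => b; elim/elim1 => c.
by rewrite !ucls_mul cmulA.
Qed.
Let mulDl : left_distributive umul +%R.
Proof.
elim/elim1 => a; elim/elim1 => b; elim/elim1 => c.
by rewrite -uclsD !ucls_mul -uclsD cmulDl.
Qed.
Let mulDr : right_distributive umul +%R.
Proof.
elim/elim1 => a; elim/elim1 => b; elim/elim1 => c.
by rewrite -uclsD !ucls_mul -uclsD cmulDr.
Qed.
Let scaleE (c : R[i]) (x : ultraproduct) : c *: x = uscale c x.
Proof. by []. Qed.
Let mulZl (c : R[i]) (x y : ultraproduct) : umul (c *: x) y = c *: umul x y.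
Proof.
elim/elim1: x => a; elim/elim1: y => b.
by rewrite !scaleE ucls_mul !ucls_scale ucls_mul cmulZl.
Qed.
Let mulZr (c : R[i]) (x y : ultraproduct) : umul x (c *: y) = c *: umul x y.
Proof.
elim/elim1: x => a; elim/elim1: y => b.
by rewrite !scaleE ucls_mul !ucls_scale ucls_mul cmulZr.
Qed.
Let adjK' : involutive uadj.
Proof. by elim/elim1 => a; rewrite !ucls_adj adjK. Qed.
Let adjD' : {morph uadj : x y / x + y}.
Proof.
elim/elim1 => a; elim/elim1 => b.
by rewrite -uclsD !ucls_adj adjD uclsD.
Qed.
Let adjZ' (c : R[i]) (x : ultraproduct) : uadj (c *: x) = c^*%R *: uadj x.
Proof.
by elim/elim1: x => a; rewrite !scaleE (ucls_adj a) !ucls_scale ucls_adj adjZ.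
Qed.
Let adjM' (x y : ultraproduct) : uadj (umul x y) = umul (uadj y) (uadj x).
Proof.
elim/elim1: x => a; elim/elim1: y => b.
by rewrite ucls_mul !ucls_adj ucls_mul adjM.
Qed.

Let normM (x y : ultraproduct) : `|umul x y| <= `|x| * `|y|.
Proof.
rewrite !rnormE -rmorphM lecR !ultraproduct_normE.
elim/elim1: x => a; elim/elim1: y => b; rewrite ucls_mul.
have h1 := @unorm_cvg (cmul a b).
have h2 : (fun n => rnorm (a n) * rnorm (b n)) @ U
    --> unorm (ucls a) * unorm (ucls b) by apply: cvgM; exact: unorm_cvg.
apply: (ler_cvg_to h1 h2); apply: filterE => n; exact: rnorm_cmul.
Qed.

Let norm_cstar (x : ultraproduct) : `|umul (uadj x) x| = `|x| ^+ 2.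
Proof.
rewrite !rnormE -rmorphXn; congr (_%:C); rewrite !ultraproduct_normE.
elim/elim1: x => a; rewrite ucls_adj ucls_mul.
have h := @unorm_cvg (cmul (adj a) a).
have h' : (fun n => rnorm (cmul (adj a) a n)) @ U --> unorm (ucls a) ^+ 2.
  have -> : (fun n => rnorm (cmul (adj a) a n)) =
      (fun n => rnorm (a n) * rnorm (a n)).
    by apply/funext => n; rewrite -expr2 -rnorm_cstar.
  by apply: cvgM; exact: unorm_cvg.
by rewrite -(cvg_lim (@Rhausdorff _) h) (cvg_lim (@Rhausdorff _) h').
Qed.

HB.instance Definition _ := isCStarAlgebra.Build R ultraproduct
  mulA mulDl mulDr mulZl mulZr adjK' adjD' adjZ' adjM' normM norm_cstar.

End Ultraproduct.

Definition is_cunit (R : realType) (A : cstarAlgType R) (e : A) : Prop :=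
  forall a : A, cmul e a = a /\ cmul a e = a.

Definition unital (R : realType) (A : cstarAlgType R) : Prop :=
  exists e : A, is_cunit e.

(* Matrices over a C*-algebra form a *-algebra, whose positive elements are
   those of the form B^* B. *)
Definition mx_positive (R : realType) (A : cstarAlgType R) (k : nat)
    (X : 'M[A]_k) : Prop :=
  exists B : 'M[A]_k, forall i j, X i j = \sum_l cmul (adj (B l i)) (B l j).

Definition completely_positive (R : realType) (A B : cstarAlgType R)
    (phi : {linear A -> B}) : Prop :=
  forall (k : nat) (X : 'M[A]_k), mx_positive X -> mx_positive (map_mx phi X).

Definition contractive (R : realType) (A B : cstarAlgType R)
    (phi : {linear A -> B}) : Prop :=
  forall a : A, `|phi a| <= `|a|.

Definition cpc (R : realType) (A B : cstarAlgType R)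
    (phi : {linear A -> B}) : Prop :=
  completely_positive phi /\ contractive phi.

(* Nuclearity as the completely positive approximation property: on every
   finite set the identity approximately factors through a matrix algebra by
   completely positive contractions. *)
Definition nuclear (R : realType) (A : cstarAlgType R) : Prop :=
  forall (F : seq A) (e : R), 0 < e ->
  exists (n : nat) (phi : {linear A -> matalg R n})
    (psi : {linear matalg R n -> A}),
    [/\ cpc phi, cpc psi & forall a, a \in F -> rnorm (psi (phi a) - a) < e].

(* Continuous logic. [cterm R u n] and [cformula R u n] are the *-polynomial
   terms and the formulas in n free variables, in de Bruijn style; the constant
   1 belongs to the language only if [u = true]. Quantifiers carry the radius
   of the ball over which they range. All sorts being subsets of the algebra,
   terms are left untyped and the inclusions between balls are omitted. The
   real-valued [sup] and [inf] in [feval] are genuine: terms and connectives are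
   bounded on balls, so formulas take bounded values there. *)
Inductive cterm (R : realType) (u : bool) (n : nat) : Type :=
| TVar of 'I_n
| TZero
| TOne of u
| TAdd of cterm R u n & cterm R u n
| TMul of cterm R u n & cterm R u n
| TAdj of cterm R u n
| TScale of R[i] & cterm R u n.

Inductive cformula (R : realType) (u : bool) : nat -> Type :=
| FDist n of cterm R u n & cterm R u n : cformula R u n
| FConn n k (f : 'rV[R]_k -> R) of continuous f & ('I_k -> cformula R u n) :
    cformula R u n
| FSup n (r : nat) of cformula R u n.+1 : cformula R u n
| FInf n (r : nat) of cformula R u n.+1 : cformula R u n.

Section Semantics.
Variables (R : realType) (u : bool) (A : cstarAlgType R).

Fixpoint teval n (v : 'I_n -> A) (t : cterm R u n) : A :=
  match t with
  | TVar i => v i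
  | TZero => 0
  | TOne _ => xget 0 [set e : A | is_cunit e]
  | TAdd s t => teval v s + teval v t
  | TMul s t => cmul (teval v s) (teval v t)
  | TAdj t => adj (teval v t)
  | TScale c t => c *: teval v t
  end.

Definition vcons n (a : A) (v : 'I_n -> A) : 'I_n.+1 -> A :=
  fun i => if unlift ord0 i is Some j then v j else a.

Definition cball (r : nat) : set A := [set a | rnorm a <= r%:R].

Fixpoint feval n (phi : cformula R u n) : ('I_n -> A) -> R :=
  match phi in cformula _ _ n return ('I_n -> A) -> R with
  | FDist _ s t => fun v => rnorm (teval v s - teval v t)
  | FConn _ k f _ psi => fun v => f (\row_i feval (psi i) v)
  | FSup _ r psi => fun v => sup [set feval psi (vcons a v) | a in cball r]
  | FInf _ r psi => fun v => inf [set feval psi (vcons a v) | a in cball r]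
  end.

Definition seval (phi : cformula R u 0) : R := feval phi (fun=> 0).

End Semantics.

(* The constant 1 is part of the common language of A and B only when both are
   unital. *)
Definition elementarily_equivalent (R : realType) (A B : cstarAlgType R) :
    Prop :=
  (forall phi : cformula R false 0, seval A phi = seval B phi) /\
  (unital A -> unital B ->
   forall phi : cformula R true 0, seval A phi = seval B phi).

(* Main.v *)
(* For a fixed k, every M_n(C) contains k unitaries u_i forming a strong quantum
   expander. Indeed the clock matrix diag(w^x), its quadratic analogue
   diag(w^(x^2)) and the discrete Fourier transform act by conjugation on the
   Fourier coefficients of a matrix, which are indexed by (Z/n)^2, through a
   phase, a shear and a quarter turn; a ping-pong argument gives a spectral gap,
   and long words in these unitaries amplify it. Consequently no projection of
   normalized rank at most 1/4 almost commutes with all the u_i. The rank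
   condition says that the projection has four orthogonal copies, so that the
   property is the positivity of a formula at u, and by Los's theorem the
   ultraproduct, hence an elementarily equivalent A, contains such a tuple.

   If A is nuclear, its tuple is approximated by psi(v_i) with v_i contractions
   in some M_d(C) and psi completely positive; psi is given by d^2 elements b_rj
   of A, psi(m) being the sum of the m_jl b_rj^* b_rl. For fixed d and v this is
   again the positivity of a sentence, which therefore holds in M_n(C) for
   some n >= 4d. There the elements b form d x n matrices X with u_i X^* close to
   X^* v_i on average. Since d <= n/4, the singular value decomposition of X
   produces corners of rank at most n/4 almost preserved by the u_i. *)

Require Import Defs.
From HB Require Import structures.
From mathcomp Require Import all_boot all_order all_algebra.
From mathcomp Require Import complex.
From mathcomp Require Import boolp classical_sets functions filter reals.
From mathcomp Require Import topology normedtype sequences trigo.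
From mathcomp Require Import lra ring zify.

Set Implicit Arguments.
Unset Strict Implicit.
Unset Printing Implicit Defensive.

Import Order.TTheory GRing.Theory Num.Theory numFieldNormedType.Exports.

Local Open Scope classical_set_scope.
Local Open Scope complex_scope.
Local Open Scope sesquilinear_scope.
Local Open Scope ring_scope.

(** * The Hilbert-Schmidt norm *)

(** The trace is not a symbol of the language, so the Hilbert-Schmidt expansion of the u_i has to be
    stated through operator norms. A lower bound for such a norm yields only one vector that leaves
    the corner. Every subcorner of a thin corner is thin, however, so such vectors can be removed
    one at a time, and this recovers a trace estimate with factor 9/10. Passing to arbitrary
    singular values weakens the factor to 199/200, and the comparison with the contractions v_i to
    399/400. Tolerances of 1/2000 still fit below that gap.

    Expansion is needed in two strengths. A lower bound uniform in n for an infimum over all w must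
    hold at tuples that only approximate four copies of a projection; this is the origin of 1/1000.
    In the final contradiction, positivity of the same formula at exact projections suffices.

    The size d and the matrices v are known only once A and its tuple are. They enter the second
    sentence as complex coefficients, and this sentence repeats the first formula under the same
    quantifiers, so that expansion and factorization concern one and the same tuple u. *)

(* Locked: comparing the sums of products behind two distinct values of [hs2]
   up to conversion is intractable. *)
HB.lock Definition hs2 (R : realType) (m n : nat) (A : 'M[R[i]]_(m, n)) : R :=
  \sum_i \sum_j rnorm (A i j) ^+ 2.
Arguments hs2 {R m n} A.

Section HilbertSchmidt.
Variable R : realType.
Local Notation C := R[i].

Lemma rnorm_sqr (z : C) : (rnorm z ^+ 2)%:C = z * z^*%R.
Proof. by rewrite rmorphXn /= -rnormE normCK. Qed.

Lemma Re_le_rnorm (z : C) : complex.Re z <= rnorm z.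
Proof.
apply: (le_trans (ler_norm _)).
by rewrite -lecR -rnormE normc_ge_Re.
Qed.

Lemma hs2_ge0 m n (A : 'M[C]_(m, n)) : 0 <= hs2 A.
Proof.
by rewrite hs2.unlock sumr_ge0// => i _; rewrite sumr_ge0// => j _; rewrite sqr_ge0.
Qed.

Lemma mulmxadjE m n (A : 'M[C]_(m, n)) i :
  (A *m A^t*) i i = (\sum_j rnorm (A i j) ^+ 2)%:C.
Proof. by rewrite rmorph_sum mxE; apply: eq_bigr => j _; rewrite !mxE; exact/esym/rnorm_sqr. Qed.

Lemma adjmulmxE m n (A : 'M[C]_(m, n)) i :
  (A^t* *m A) i i = (\sum_j rnorm (A j i) ^+ 2)%:C.
Proof. by rewrite rmorph_sum mxE; apply: eq_bigr => j _; rewrite !mxE mulrC; exact/esym/rnorm_sqr. Qed.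

Lemma hs2E m n (A : 'M[C]_(m, n)) : (hs2 A)%:C = \tr (A *m A^t*).
Proof.
by rewrite hs2.unlock rmorph_sum; apply: eq_bigr => i _; rewrite mulmxadjE.
Qed.

Lemma adjmxM m n p (A : 'M[C]_(m, n)) (B : 'M[C]_(n, p)) :
  (A *m B)^t* = B^t* *m A^t*.
Proof. by rewrite trmx_mul map_mxM. Qed.

Lemma adjmxD m n (A B : 'M[C]_(m, n)) : (A + B)^t* = A^t* + B^t*.
Proof. by rewrite linearD map_mxD. Qed.

Lemma adjmxB m n (A B : 'M[C]_(m, n)) : (A - B)^t* = A^t* - B^t*.
Proof. by rewrite linearB map_mxB. Qed.

Lemma adjmx1 n : (1%:M : 'M[C]_n)^t* = 1%:M.
Proof. by rewrite trmx1 map_mx1. Qed.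

Lemma hs2_adj m n (A : 'M[C]_(m, n)) : hs2 (A^t*) = hs2 A.
Proof. by apply: (@complexI R); rewrite !hs2E trmxCK mxtrace_mulC. Qed.

Lemma hs2_isol m n p (V : 'M[C]_(p, m)) (A : 'M[C]_(m, n)) :
  V^t* *m V = 1%:M -> hs2 (V *m A) = hs2 A.
Proof.
move=> VV; apply: (@complexI R); rewrite !hs2E adjmxM mxtrace_mulC.
by rewrite -mulmxA [V^t* *m (V *m A)]mulmxA VV mul1mx mxtrace_mulC.
Qed.

(** For a rectangular V, [V \is unitarymx] means V V^* = 1, that is, orthonormal rows. Such a V
    stands for an m-dimensional subspace, with projection V^* V, and V A V^* is the corner of A on
    it. *)
Lemma hs2_isor m n p (V : 'M[C]_(n, p)) (A : 'M[C]_(m, n)) :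
  V \is unitarymx -> hs2 (A *m V) = hs2 A.
Proof.
move=> VV; apply: (@complexI R); rewrite !hs2E adjmxM mulmxA.
by rewrite mulmxtVK.
Qed.

Lemma unitary_adjK n (V : 'M[C]_n) : V \is unitarymx -> V^t* *m V = 1%:M.
Proof. by rewrite -trmxC_unitary => /unitarymxP; rewrite trmxCK. Qed.

Lemma adj_unitaryK n (V : 'M[C]_n) : V \is unitarymx -> V *m V^t* = 1%:M.
Proof. by move/unitarymxP. Qed.

Lemma hs2_unitary_conj n (V A : 'M[C]_n) : V \is unitarymx ->
  hs2 (V *m A *m V^t*) = hs2 A.
Proof.
by move=> VV; rewrite hs2_isor ?trmxC_unitary// hs2_isol// unitary_adjK.
Qed.

Lemma l2sq_hs2 n (x : 'cV[C]_n) : l2norm x ^+ 2 = hs2 x.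
Proof. by rewrite l2sq hs2.unlock; apply: eq_bigr => i _; rewrite big_ord1. Qed.

Lemma l2_le_hs2 m n (x : 'cV[C]_n) (y : 'cV[C]_m) :
  hs2 x <= hs2 y -> l2norm x <= l2norm y.
Proof. by move=> h; rewrite -ler_sqr ?nnegrE ?l2_ge0// !l2sq_hs2. Qed.

Lemma l2_iso m n (V : 'M[C]_(n, m)) (x : 'cV[C]_m) :
  V^t* *m V = 1%:M -> l2norm (V *m x) = l2norm x.
Proof.
move=> VV; apply/eqP; rewrite -(eqrXn2 (n := 2)) ?l2_ge0// !l2sq_hs2.
by rewrite hs2_isol.
Qed.

(* Pythagoras for the projection [V^t* *m V]. *)
Lemma hs2_coiso m n p (V : 'M[C]_(m, n)) (A : 'M[C]_(n, p)) :
  V \is unitarymx -> hs2 (V *m A) <= hs2 A.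
Proof.
move=> VV; set Q := V^t* *m V.
have QQ : Q *m Q = Q by rewrite /Q mulmxA mulmxtVK.
have Qa : Q^t* = Q by rewrite /Q adjmxM trmxCK.
suff -> : hs2 A = hs2 (V *m A) + hs2 ((1%:M - Q) *m A) by rewrite lerDl hs2_ge0.
apply: (@complexI R); rewrite rmorphD /= !hs2E !adjmxM !mulmxA.
rewrite adjmxB adjmx1 Qa; set G := A *m A^t*.
rewrite -[V *m A *m _]mulmxA -[(1%:M - Q) *m A *m _]mulmxA -/G.
have -> : \tr (V *m G *m V^t*) = \tr (G *m Q).
  by rewrite -mulmxA mxtrace_mulC -mulmxA.
have -> : \tr ((1%:M - Q) *m G *m (1%:M - Q)) = \tr (G *m (1%:M - Q)).
  rewrite mxtrace_mulC mulmxA mxtrace_mulC; congr (\tr (_ *m _)).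
  by rewrite mulmxBl !mulmxBr !mul1mx mulmx1 QQ subrr subr0.
by rewrite mulmxBr mulmx1 linearB /= addrC subrK.
Qed.

Lemma l2_coiso m n (V : 'M[C]_(m, n)) (x : 'cV[C]_n) :
  V \is unitarymx -> l2norm (V *m x) <= l2norm x.
Proof. by move=> VV; apply: l2_le_hs2; exact: hs2_coiso. Qed.

Lemma opnorm_unitary n (V : 'M[C]_n) : V \is unitarymx -> opnorm V <= 1.
Proof.
by move=> VV; apply: opnorm_le => // x; rewrite mul1r l2_iso// unitary_adjK.
Qed.

Lemma col_sqr_le_opnorm n (A : 'M[C]_n) a : \sum_b rnorm (A b a) ^+ 2 <= opnorm A ^+ 2.
Proof.
have -> : \sum_b rnorm (A b a) ^+ 2 = l2norm (A *m (delta_mx a 0 : 'cV_n)) ^+ 2.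
  by rewrite l2sq; apply: eq_bigr => b _; rewrite -colE mxE.
rewrite ler_sqr ?nnegrE ?l2_ge0 ?opnorm_ge0// (le_trans (opnormP _ _))//.
by rewrite l2_delta mulr1.
Qed.

Lemma row_sqr_le_opnorm n (A : 'M[C]_n) a : \sum_b rnorm (A a b) ^+ 2 <= opnorm A ^+ 2.
Proof.
rewrite -(opnorm_adj A); apply: le_trans (col_sqr_le_opnorm (mxadj A) a).
by rewrite le_eqVlt; apply/orP; left; apply/eqP/eq_bigr => b _; rewrite !mxE rnorm_conj.
Qed.

Lemma opnorm_compress m n (V : 'M[C]_(m, n)) (A : 'M[C]_n) :
  V \is unitarymx -> opnorm (V *m A *m V^t*) <= opnorm A.
Proof.
move=> VV; apply: opnorm_le => [|x]; first exact: opnorm_ge0.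
rewrite -!mulmxA (le_trans (l2_coiso _ VV))// (le_trans (opnormP _ _))//.
by rewrite l2_iso// trmxCK; exact/unitarymxP.
Qed.

Lemma hermitian_diag n (A : 'M[C]_n) : A^t* = A ->
  exists (P : 'M[C]_n) (d : 'I_n -> C), P \is unitarymx /\
    P *m A *m P^t* = diag_mx (\row_a d a).
Proof.
move=> Ah; have /orthomx_spectralP AE : A \is normalmx by apply/normalmxP; rewrite Ah.
set P := spectralmx A in AE; have PP : P \is unitarymx by exact: spectral_unitarymx.
exists P, (fun a => spectral_diag A 0 a); split => //.
have -> : \row_a spectral_diag A 0 a = spectral_diag A by apply/rowP => a; rewrite mxE.
by rewrite {1}AE invmx_unitary// !mulmxA mulmxtVK// (adj_unitaryK PP) mul1mx.
Qed.

End HilbertSchmidt.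

(** * Ping-pong on the discrete torus *)

Section PingPong.
Variables (R : realType) (n : nat).
Local Notation N := n.+1.
Local Notation pt := ('I_N * 'I_N)%type.

Definition shear (x : pt) : pt := (x.1, x.2 + x.1 + x.1).
Definition shearV (x : pt) : pt := (x.1, x.2 - x.1 - x.1).
Definition quarter (x : pt) : pt := (- x.2, x.1).
Definition quarterV (x : pt) : pt := (x.2, - x.1).

Lemma shearK : cancel shear shearV.
Proof. by case=> a b; rewrite /shear /shearV /= !addrK. Qed.
Lemma shearVK : cancel shearV shear.
Proof. by case=> a b; rewrite /shear /shearV /= !subrK. Qed.
Lemma quarterK : cancel quarter quarterV.
Proof. by case=> a b; rewrite /quarter /quarterV /= opprK. Qed.
Lemma quarterVK : cancel quarterV quarter.
Proof. by case=> a b; rewrite /quarter /quarterV /= opprK. Qed.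

(* distance to 0 in the cyclic group *)
Definition cabs (a : 'I_N) : nat := minn a (N - a).

(** Describes arithmetic modulo N by linear alternatives over nat, which reduces the inclusions
    between cones to linear arithmetic. *)
Lemma addI_spec (a b : 'I_N) : let c := nat_of_ord (a + b)%R in
  (c < N)%N /\ (c = (a + b)%N \/ (c + N)%N = (a + b)%N).
Proof.
rewrite /=; split; first by rewrite ltn_mod.
case: (ltnP (a + b) N) => h; first by left; rewrite modn_small.
right; have e : (a + b)%N = ((a + b - N) + N)%N by rewrite subnK.
rewrite {1}e modnDr modn_small ?subnK//.
have := ltn_ord a; have := ltn_ord b; lia.
Qed.

Lemma oppI_spec (a : 'I_N) : let c := nat_of_ord (- a)%R in
  (a = 0%N :> nat /\ c = 0%N) \/ (c + a = N)%N.
Proof.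
rewrite /=; case: (eqVneq (nat_of_ord a) 0%N) => [->|h].
  by left; rewrite subn0 modnn.
by right; rewrite modn_small ?subnK; have := ltn_ord a; lia.
Qed.

Lemma subI_spec (a b : 'I_N) : let c := nat_of_ord (a - b)%R in
  (c < N)%N /\ ((c + b)%N = a \/ (c + b)%N = (a + N)%N).
Proof.
have [h1 h2] := addI_spec a (- b); have h3 := oppI_spec b; split=> //.
have := ltn_ord a; have := ltn_ord b.
case: h3 => [[h4 h5]|h4]; case: h2; lia.
Qed.

Definition cone1 (x : pt) := (8 * cabs x.1 < N)%N && (cabs x.2 < cabs x.1)%N.
Definition cone2 (x : pt) := (8 * cabs x.2 < N)%N && (cabs x.1 < cabs x.2)%N.
Definition far1 (x : pt) := (N <= 8 * cabs x.1)%N.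
Definition far2 (x : pt) := (N <= 8 * cabs x.2)%N.
Definition diagonal (x : pt) := [&& nat_of_ord x.2 == nat_of_ord x.1, nat_of_ord x.1 != 0%N & (8 * cabs x.1 < N)%N].
Definition antidiagonal (x : pt) := [&& nat_of_ord x.2 == nat_of_ord (- x.1), nat_of_ord x.1 != 0%N & (8 * cabs x.1 < N)%N].

(** Write x = (a, b). If b - 2a or b + 2a is shorter than a, then b is longer than a. Both cannot be
    shorter, since they differ by 4a. The bound |a| < N/8 keeps 4a from wrapping around the cyclic
    group. *)
Lemma cone1_shear (x : pt) :
  [/\ cone1 (shearV x) -> [|| cone2 x, far1 x | far2 x],
      cone1 (shear x) -> [|| cone2 x, far1 x | far2 x]
    & ~~ (cone1 (shearV x) && cone1 (shear x))].
Proof.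
case: x => a b; rewrite /cone1 /cone2 /far1 /far2 /shear /shearV /fst /snd /cabs.
have := ltn_ord a; have := ltn_ord b.
have := addI_spec (b + a) a; have := addI_spec b a.
have := subI_spec (b - a) a; have := subI_spec b a.
move: (nat_of_ord a) (nat_of_ord b) (nat_of_ord (b + a)) (nat_of_ord (b + a + a))
  (nat_of_ord (b - a)) (nat_of_ord (b - a - a)) => a' b' c3 c4 c1 c2.
move=> /= [h1 h2] [h3 h4] [h5 h6] [h7 h8] h9 h10.
split; lia.
Qed.

(** Here b - 2a = a, so b = 3a is longer than a and does not wrap. The antidiagonal case is the
    mirror image, with b = -3a. *)
Lemma diagonal_shearV (x : pt) : diagonal (shearV x) -> [|| cone2 x, far1 x | far2 x].
Proof.
case: x => a b; rewrite /diagonal /cone2 /far1 /far2 /shearV /fst /snd /cabs.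
have := ltn_ord a; have := ltn_ord b.
have := subI_spec (b - a) a; have := subI_spec b a.
move: (nat_of_ord a) (nat_of_ord b) (nat_of_ord (b - a)) (nat_of_ord (b - a - a)).
move=> a' b' c1 c2 /= [h1 h2] [h3 h4] h9 h10; lia.
Qed.

Lemma antidiagonal_shear (x : pt) : antidiagonal (shear x) -> [|| cone2 x, far1 x | far2 x].
Proof.
case: x => a b; rewrite /antidiagonal /cone2 /far1 /far2 /shear /fst /snd /cabs.
have := ltn_ord a; have := ltn_ord b.
have := addI_spec (b + a) a; have := addI_spec b a; have := oppI_spec a.
move: (nat_of_ord a) (nat_of_ord b) (nat_of_ord (b + a)) (nat_of_ord (b + a + a)).
move: (nat_of_ord (- a)) => c0.
move=> a' b' c1 c2 /= h0 [h1 h2] [h3 h4] h9 h10; lia.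
Qed.

Lemma cone_cover (x : pt) : (nat_of_ord x.1 != 0%N) || (nat_of_ord x.2 != 0%N) ->
  [|| far1 x, far2 x, cone1 x, cone2 x, diagonal x | antidiagonal x].
Proof.
case: x => a b; rewrite /antidiagonal /diagonal /cone1 /cone2 /far1 /far2 /fst /snd /cabs.
have := ltn_ord a; have := ltn_ord b; have := oppI_spec a.
move: (nat_of_ord (- a)) => c0.
move: (nat_of_ord a) (nat_of_ord b) => a' b' /= h0 h9 h10; lia.
Qed.

Lemma cone1_quarterV (x : pt) : cone1 (quarterV x) = cone2 x.
Proof.
case: x => a b; rewrite /cone1 /cone2 /quarterV /fst /snd /cabs.
have := ltn_ord a; have := ltn_ord b; have := oppI_spec a.
move: (nat_of_ord (- a)) => c0.
move: (nat_of_ord a) (nat_of_ord b) => a' b' /= h0 h9 h10; lia.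
Qed.

Section Mass.
Variable mu : pt -> R.
Hypothesis mu0 : forall x, 0 <= mu x.
Let m (B : pred pt) := \sum_(x | B x) mu x.

Let m_sub (B1 B2 : pred pt) : (forall x, B1 x -> B2 x) -> m B1 <= m B2.
Proof.
move=> B12; rewrite /m big_mkcond [leRHS]big_mkcond; apply: ler_sum => x _.
by case: (boolP (B1 x)) => [/B12 ->|] //; case: ifP.
Qed.

Let m_or (B1 B2 : pred pt) : m (fun x => B1 x || B2 x) <= m B1 + m B2.
Proof.
rewrite /m big_mkcond [X in _ <= X + _]big_mkcond [X in _ <= _ + X]big_mkcond.
rewrite -big_split; apply: ler_sum => x _ /=; have := mu0 x.
by case: (B1 x); case: (B2 x) => /=; lra.
Qed.

Let m_disj (B1 B2 : pred pt) : (forall x, ~~ (B1 x && B2 x)) ->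
  m B1 + m B2 = m (fun x => B1 x || B2 x).
Proof.
move=> dB; rewrite /m big_mkcond [X in _ + X = _]big_mkcond [RHS]big_mkcond.
rewrite -big_split; apply: eq_bigr => x _ /=; have := dB x.
by case: (B1 x); case: (B2 x) => //= _; lra.
Qed.

(** Let O, m1, m2 be the masses of [far1], [cone1], [cone2]. The quarter turn gives [far2] mass at
    most O + e, and m2 <= m1 + e. The two disjoint sheared copies of [cone1] lie in the union [Bd]
    of [cone2], [far1] and [far2], so 2 m1 - 2e <= m2 + 2O + e. Hence m1 <= 2O + 4e, m2 <= 2O + 5e,
    and each of the two diagonals has mass at most 4O + 7e. The total is 14O + 24e. *)
Lemma pingpong (e : R) :
  (forall B : pred pt, `|\sum_(x | B (shearV x)) mu x - \sum_(x | B x) mu x| <= e) ->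
  (forall B : pred pt, `|\sum_(x | B (quarterV x)) mu x - \sum_(x | B x) mu x| <= e) ->
  \sum_(x | (nat_of_ord x.1 != 0%N) || (nat_of_ord x.2 != 0%N)) mu x
    <= 24 * e + 14 * \sum_(x | far1 x) mu x.
Proof.
move=> hs hr.
have hs1 B : m (fun x => B (shearV x)) <= m B + e /\ m B <= m (fun x => B (shearV x)) + e.
  by have := hs B; rewrite -!/(m _) ler_norml => /andP[]; split; lra.
have hs2 B : m B <= m (fun x => B (shear x)) + e.
  have [+ _] := hs1 (fun x => B (shear x)); congr (_ <= _).
  by apply: eq_bigl => x; rewrite shearVK.
have hr1 B : m (fun x => B (quarterV x)) <= m B + e /\ m B <= m (fun x => B (quarterV x)) + e.
  by have := hr B; rewrite -!/(m _) ler_norml => /andP[]; split; lra.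
rewrite -/(m far1); set O := m far1.
have hB : m far2 <= O + e.
  have [h _] := hr1 far1; apply: le_trans h; apply: m_sub => x.
  by rewrite /far1 /far2 /quarterV.
pose Bd := fun x : pt => [|| cone2 x, far1 x | far2 x].
have hBd : m Bd <= m cone2 + (2 * O + e).
  apply: (le_trans (m_or _ _)); rewrite lerD2l.
  by apply: (le_trans (m_or _ _)); rewrite -/O; lra.
have hE2 : m cone2 <= m cone1 + e.
  have [h _] := hr1 cone1; apply: le_trans h; apply: m_sub => x.
  by rewrite cone1_quarterV.
have hE1 : 2 * m cone1 - 2 * e <= m Bd.
  have [_ h1] := hs1 cone1; have h2 := hs2 cone1.
  have := @m_disj (fun x => cone1 (shearV x)) (fun x => cone1 (shear x)).
  have d x : ~~ (cone1 (shearV x) && cone1 (shear x)) by have [] := cone1_shear x.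
  move=> /(_ d) dE; apply: (@le_trans _ _ (m (fun x => cone1 (shearV x) || cone1 (shear x)))).
    by rewrite -dE; lra.
  by apply: m_sub => x /orP[]; have [h3 h4 _] := cone1_shear x; [exact: h3|exact: h4].
have hP : m diagonal <= m Bd + e.
  have [_ h] := hs1 diagonal; apply: (le_trans h); rewrite lerD2r.
  by apply: m_sub; exact: diagonal_shearV.
have hM : m antidiagonal <= m Bd + e.
  apply: (le_trans (hs2 _)); rewrite lerD2r.
  by apply: m_sub; exact: antidiagonal_shear.
have : \sum_(x : pt | (nat_of_ord x.1 != 0%N) || (nat_of_ord x.2 != 0%N)) mu x <=
    O + (m far2 + (m cone1 + (m cone2 + (m diagonal + m antidiagonal)))).
  apply: (le_trans (@m_sub _ (fun x => [|| far1 x, far2 x, cone1 x, cone2 x, diagonal x | antidiagonal x]) _)).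
    exact: cone_cover.
  do 5 (apply: (le_trans (m_or _ _)); rewrite lerD2l).
  exact: lexx.
lra.
Qed.

End Mass.
End PingPong.

(** * Quantum expanders *)

Section RootOfUnity.
Variables (R : realType).

Lemma rnorm_sqrE (z : R[i]) :
  rnorm z ^+ 2 = complex.Re z ^+ 2 + complex.Im z ^+ 2.
Proof.
have -> : rnorm z = Num.sqrt (complex.Re z ^+ 2 + complex.Im z ^+ 2).
  by apply: (@complexI R); rewrite -rnormE normc_def.
by rewrite sqr_sqrtr// addr_ge0// sqr_ge0.
Qed.

Lemma cis_exp (t : R) k : (cos t +i* sin t) ^+ k = cos (t *+ k) +i* sin (t *+ k).
Proof.
elim: k => [|k ih]; first by rewrite expr0 mulr0n cos0 sin0.
rewrite exprS ih mulrS cosD sinD; apply/eqP; rewrite eq_complex /=.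
by apply/andP; split; apply/eqP; ring.
Qed.

(** For w = exp(2 pi i / N), the square of |w^k - 1| is 4 sin^2(pi k / N). On the given range of k
    this is at least 4 sin^2(pi / 8), and cos(pi / 4) <= 3/4 already makes it at least 1/2. *)
Lemma root_of_unity_spread n : exists w : R[i],
  [/\ w ^+ n.+1 = 1, rnorm w = 1, (forall k, (0 < k < n.+1)%N -> w ^+ k != 1)
    & forall k, (n.+1 <= 8 * k)%N -> (8 * k <= 7 * n.+1)%N ->
      1 / 2 <= rnorm (w ^+ k - 1) ^+ 2].
Proof.
pose t : R := (pi *+ 2) / n.+1%:R.
have n0 : 0 < n.+1%:R :> R by rewrite ltr0n.
have p0 : 0 < pi :> R := pi_gt0 R.
exists (cos t +i* sin t).
have d k : rnorm ((cos t +i* sin t) ^+ k - 1) ^+ 2 = 4 - 4 * cos (pi * k%:R / n.+1%:R) ^+ 2.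
  rewrite cis_exp rnorm_sqrE /=.
  have -> : t *+ k = (pi * k%:R / n.+1%:R) *+ 2.
    rewrite -[t *+ k]mulr_natr -[RHS]mulr_natr /t -(mulr_natr pi 2).
    by move: (n.+1%:R : R) n0 => c c0; field; rewrite gt_eqF.
  set y := pi * _ / _; rewrite cos_mulr2n sin_mulr2n.
  rewrite oppr0 addr0 -[(cos y * sin y) *+ 2]mulr_natl -[cos y ^+ 2 *+ 2]mulr_natl.
  by rewrite !exprMn sin2cos2; ring.
split.
- have tN : t *+ n.+1 = pi *+ 2 by rewrite -[LHS]mulr_natr /t divfK// gt_eqF.
  by rewrite cis_exp tN cos2pi sin2pi.
- apply/eqP; rewrite -(eqrXn2 (n := 2))// ?rnorm_ge0// rnorm_sqrE /=.
  by rewrite cos2Dsin2 expr1n.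
- move=> k /andP[k0 kn]; apply/eqP => e.
  have := d k; rewrite e subrr rnorm0 expr0n /= => /esym/eqP.
  set y := pi * _ / _.
  have y0 : 0 < y by rewrite divr_gt0// mulr_gt0// ltr0n.
  have ypi : y < pi by rewrite ltr_pdivrMr// ltr_pM2l// ltr_nat.
  have := sin_gt0_pi (introT andP (conj y0 ypi)).
  have s2 := sin2cos2 y => sp /eqP h3.
  have /eqP : sin y ^+ 2 = 0 by lra.
  by rewrite sqrf_eq0 gt_eqF.
- move=> k h1 h2; rewrite d; set y := pi * _ / _.
  have y1 : pi / 8 <= y.
    rewrite /y ler_pdivlMr// mulrAC -mulrA ler_pM2l// ler_pdivrMr// mulrC.
    by rewrite -(natrM R 8) mulnC ler_nat; lia.
  have y2 : y <= pi - pi / 8.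
    rewrite /y ler_pdivrMr//.
    have -> : (pi - pi / 8) * n.+1%:R = pi * (7 * n.+1%:R / 8) :> R by field.
    by rewrite ler_pM2l// ler_pdivlMr// -!natrM ler_nat; lia.
  have yin : y \in `[0, pi]%R by rewrite in_itv /=; apply/andP; split; lra.
  have i8 : (pi / 8 : R) \in `[0, pi]%R by rewrite in_itv /=; apply/andP; split; lra.
  have i78 : (pi - pi / 8 : R) \in `[0, pi]%R by rewrite in_itv /=; apply/andP; split; lra.
  have c1 : cos y <= cos (pi / 8).
    by move: y1; rewrite !le_eqVlt => /orP[/eqP->|]; rewrite ?eqxx// ltr_cos// => ->; rewrite orbT.
  have c2 : - cos (pi / 8) <= cos y.
    rewrite -cosN -cosDpi; have -> : - (pi / 8) + pi = pi - pi / 8 :> R by ring.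
    by move: y2; rewrite !le_eqVlt => /orP[/eqP->|]; rewrite ?eqxx// ltr_cos// => ->; rewrite orbT.
  have e2 : cos (pi / 4) = 2 * cos (pi / 8) ^+ 2 - 1 :> R.
    have -> : pi / 4 = (pi / 8) *+ 2 :> R by rewrite -[RHS]mulr_natr; field.
    by rewrite cos_mulr2n mulr_natl.
  have e4 : 0 = 2 * cos (pi / 4) ^+ 2 - 1 :> R.
    rewrite -cos_pihalf; have -> : pi / 2 = (pi / 4) *+ 2 :> R by rewrite -[RHS]mulr_natr; field.
    by rewrite cos_mulr2n mulr_natl.
  have q : cos (pi / 4) <= 3 / 4 :> R.
    rewrite leNgt; apply/negP => h.
    have : (3 / 4 : R) ^+ 2 < cos (pi / 4) ^+ 2 by rewrite ltr_sqr ?nnegrE; lra.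
    lra.
  have : cos y ^+ 2 <= cos (pi / 8) ^+ 2.
    have ac : `|cos y| <= cos (pi / 8) by rewrite ler_norml c2 c1.
    by rewrite -[leLHS]real_normK ?num_real// ler_sqr ?nnegrE//; lra.
  lra.
Qed.

End RootOfUnity.

(** * Fourier coefficients of matrices over the discrete torus *)

Section Weyl.
Variables (R : realType) (n : nat) (w : R[i]).
Local Notation C := R[i].
Local Notation N := n.+1.
Hypothesis wN : w ^+ N = 1.
Hypothesis w1 : rnorm w = 1.
Hypothesis wk : forall k, (0 < k < N)%N -> w ^+ k != 1.

Lemma w_conj k : w ^+ k * (w ^+ k)^*%R = 1.
Proof.
have ww : w * w^*%R = 1 by have := rnorm_sqr w; rewrite w1 expr1n.
by rewrite rmorphXn /= -exprMn ww expr1n.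
Qed.

Lemma rnorm_wX k : rnorm (w ^+ k) = 1.
Proof. by elim: k => [|k ih]; rewrite ?expr0 ?exprS ?rnormM ?ih ?w1 ?mul1r// /rnorm normr1. Qed.

(** The sum x + a is taken modulo N, which powers of w do not see. *)
Lemma w_add (x a : 'I_N) k : w ^+ (k * (x + a)%R) = w ^+ (k * x) * w ^+ (k * a).
Proof.
rewrite /= exprM expr_mod; first by rewrite exprD -!exprM.
by rewrite -exprM mulnC exprM wN expr1n.
Qed.

Lemma w_ortho (x y : 'I_N) :
  \sum_(b < N) w ^+ (x * b) * (w ^+ (y * b))^*%R = if x == y then N%:R else 0.
Proof.
have -> : \sum_(b < N) w ^+ (x * b) * (w ^+ (y * b))^*%R =
    \sum_(b < N) (w ^+ x * (w ^+ y)^*%R) ^+ b.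
  by apply: eq_bigr => b _; rewrite !exprM rmorphXn /= exprMn.
set z := w ^+ x * _.
case: eqP => [e|xy].
  rewrite /z e w_conj (eq_bigr (fun=> 1)) => [|b _]; last by rewrite expr1n.
  by rewrite sumr_const card_ord.
have zN : z ^+ N = 1.
  by rewrite exprMn -rmorphXn /= -!exprM ![(_ * N)%N]mulnC !exprM wN !expr1n rmorph1 mulr1.
have z1 : z != 1.
  apply/negP => /eqP zz; have e : w ^+ x = w ^+ y.
    by rewrite -[RHS]mul1r -zz /z -mulrA [_^*%R * _]mulrC w_conj mulr1.
  have [lt|lt|/val_inj//] := ltngtP x y.
    have := wk (k := (y - x)%N); rewrite subn_gt0 lt (leq_ltn_trans (leq_subr _ _))//.
    move=> /(_ isT)/eqP; apply; rewrite -[LHS]mulr1 -(w_conj x) mulrA -exprD.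
    by rewrite subnK ?(ltnW lt)// -e w_conj.
  have := wk (k := (x - y)%N); rewrite subn_gt0 lt (leq_ltn_trans (leq_subr _ _))//.
  move=> /(_ isT)/eqP; apply; rewrite -[LHS]mulr1 -(w_conj y) mulrA -exprD.
  by rewrite subnK ?(ltnW lt)// e w_conj.
apply/eqP; have /eqP := subrX1 z N; rewrite zN subrr eq_sym mulf_eq0 subr_eq0.
by rewrite (negbTE z1).
Qed.

(** Up to normalization, the coefficient of p along the Weyl unitary with shift x.1 and a frequency
    given by x.2: a discrete Fourier transform on each cyclic diagonal. *)
Definition fourier (p : 'M[C]_N) (x : 'I_N * 'I_N) : C :=
  \sum_(y : 'I_N) p (y + x.1) y * w ^+ (x.2 * y).

Lemma parseval (p : 'M[C]_N) :
  \sum_x rnorm (fourier p x) ^+ 2 = N%:R * hs2 p.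
Proof.
rewrite -(pair_bigA _ (fun a b => rnorm (fourier p (a, b)) ^+ 2)) /=.
have -> : hs2 p = \sum_(a : 'I_N) \sum_(x : 'I_N) rnorm (p (x + a) x) ^+ 2.
  rewrite hs2.unlock exchange_big [RHS]exchange_big /=; apply: eq_bigr => y _.
  by rewrite (reindex_inj (addrI y)).
rewrite mulr_sumr; apply: eq_bigr => a _.
apply: (@complexI R); rewrite rmorph_sum /= rmorphM /= rmorph_sum /= rmorph_nat.
have -> : \sum_(b : 'I_N) (rnorm (fourier p (a, b)) ^+ 2)%:C =
   \sum_(b : 'I_N) \sum_(x : 'I_N) \sum_(y : 'I_N) (p (x + a) x * (p (y + a) y)^*%R) * (w ^+ (x * b) * (w ^+ (y * b))^*%R).
  apply: eq_bigr => b _; rewrite rnorm_sqr /fourier rmorph_sum /= mulr_suml.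
  apply: eq_bigr => x _; rewrite mulr_sumr; apply: eq_bigr => y _.
  by rewrite rmorphM /= ![(b * _)%N]mulnC; ring.
rewrite exchange_big mulr_sumr /=; apply: eq_bigr => x _.
rewrite exchange_big (bigD1 x) //= -mulr_sumr w_ortho eqxx big1 ?addr0 => [|y yx].
  by rewrite mulrC rnorm_sqr.
by rewrite -mulr_sumr w_ortho eq_sym (negbTE yx) mulr0.
Qed.

Definition Um : 'M[C]_N := diag_mx (\row_x w ^+ x).
Definition Dm : 'M[C]_N := diag_mx (\row_x w ^+ (x * x)).
Definition Fm : 'M[C]_N := \matrix_(x, y) ((Num.sqrt N%:R)^-1%:C * w ^+ (x * y)).

Lemma diag_conjE (d : 'I_N -> C) (p : 'M[C]_N) x y :
  (diag_mx (\row_a d a) *m p *m (diag_mx (\row_a d a))^t*) x y =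
  d x * p x y * (d y)^*%R.
Proof.
rewrite tr_diag_mx map_diag_mx mul_mx_diag mul_diag_mx.
by rewrite !mxE.
Qed.

Lemma fourier_U p x : fourier (Um *m p *m Um^t*) x = w ^+ x.1 * fourier p x.
Proof.
rewrite /fourier mulr_sumr; apply: eq_bigr => y _; rewrite diag_conjE.
have := w_add y x.1 1; rewrite !mul1n => ->.
rewrite -[RHS]mul1r -(w_conj y); ring.
Qed.

(** On the diagonal with offset a, the entry at y is multiplied by w to the power (y + a)^2 - y^2 =
    2ay + a^2. The term 2ay raises the frequency by 2a, and a^2 gives the phase. *)
Lemma fourier_D p x : fourier (Dm *m p *m Dm^t*) x = w ^+ (x.1 * x.1) * fourier p (shear x).
Proof.
rewrite /fourier mulr_sumr; apply: eq_bigr => y _; rewrite diag_conjE /=.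
rewrite w_add [((y + x.1)%R * y)%N]mulnC [((y + x.1)%R * x.1)%N]mulnC !w_add.
rewrite ![((x.2 + _ + _)%R * y)%N]mulnC !w_add.
rewrite -[RHS]mul1r -(w_conj (y * y)) ![(x.1 * y)%N]mulnC [(x.2 * y)%N]mulnC; ring.
Qed.

(** Summing over the position on the diagonal first, orthogonality of characters leaves only y = z -
    b. Offset and frequency thereby exchange roles, and rewriting z - b in terms of z produces the
    phase. *)
Lemma fourier_F p x :
  fourier (Fm *m p *m Fm^t*) x = (w ^+ (val x.1 * val x.2))^*%R * fourier p (quarter x).
Proof.
have NE : ((Num.sqrt N%:R)^-1%:C * (Num.sqrt N%:R)^-1%:C : C) * N%:R = 1.
  rewrite -rmorphM /= -invfM -expr2 sqr_sqrtr ?ler0n// fmorphV rmorph_nat mulVf//.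
  by rewrite pnatr_eq0.
case: x => a b; rewrite /fourier /=.
pose s : C := (Num.sqrt N%:R)^-1%:C.
have -> : \sum_(x : 'I_N) (Fm *m p *m Fm^t*) (x + a) x * w ^+ (b * x) =
  \sum_(x : 'I_N) \sum_(z : 'I_N) \sum_(y : 'I_N) s * s * (w ^+ (a * y) * p y z) *
    (w ^+ ((y + b)%R * x) * (w ^+ (z * x))^*%R).
  apply: eq_bigr => x _; rewrite mxE mulr_suml; apply: eq_bigr => z _.
  rewrite mxE !mulr_suml; apply: eq_bigr => y _; rewrite !mxE -/s.
  have sc : s^*%R = s by apply/CrealP; rewrite ger0_real// ler0c invr_ge0 sqrtr_ge0.
  rewrite rmorphM /= sc [((x + a)%R * y)%N]mulnC w_add.
  rewrite [((y + b)%R * x)%N]mulnC w_add [(x * z)%N]mulnC [(y * a)%N]mulnC.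
  by rewrite [(y * x)%N]mulnC [(b * x)%N]mulnC; ring.
rewrite exchange_big /=.
have -> : \sum_(z : 'I_N) \sum_(x : 'I_N) \sum_(y : 'I_N) s * s * (w ^+ (a * y) * p y z) *
    (w ^+ ((y + b)%R * x) * (w ^+ (z * x))^*%R) =
    \sum_(z : 'I_N) w ^+ (a * (z - b)%R) * p (z - b) z.
  apply: eq_bigr => z _; rewrite exchange_big (bigD1 (z - b)) //; cbv beta; rewrite -[X in X + _ = _]mulr_sumr.
  rewrite w_ortho subrK eqxx mulrAC NE mul1r big1 ?addr0// => y yz.
  rewrite -mulr_sumr w_ortho; case: eqP => [e|_]; last by rewrite mulr0.
  by rewrite -e addrK eqxx in yz.
rewrite mulr_sumr; apply: eq_bigr => z _.
have -> : w ^+ (a * z) = w ^+ (a * (z - b)%R) * w ^+ (a * b) by rewrite -w_add subrK.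
rewrite -[LHS]mul1r -(w_conj (a * b)); ring.
Qed.

Lemma diag_w_unitary (d : 'I_N -> nat) : diag_mx (\row_x w ^+ d x) \is unitarymx.
Proof.
apply/unitarymxP/matrixP => x y; rewrite tr_diag_mx map_diag_mx mul_mx_diag !mxE.
by case: eqP => [->|_]; rewrite ?mulr1n ?mulr0n ?mul0r// w_conj.
Qed.

Lemma Um_unitary : Um \is unitarymx. Proof. exact: diag_w_unitary. Qed.
Lemma Dm_unitary : Dm \is unitarymx. Proof. exact: diag_w_unitary. Qed.
Lemma Fm_unitary : Fm \is unitarymx.
Proof.
apply/unitarymxP/matrixP => x y; rewrite !mxE.
have sc : ((Num.sqrt N%:R)^-1%:C : C)^*%R = (Num.sqrt N%:R)^-1%:C.
  by apply/CrealP; rewrite ger0_real// ler0c invr_ge0 sqrtr_ge0.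
under eq_bigr => z _ do rewrite !mxE rmorphM /= sc mulrACA.
rewrite -mulr_sumr w_ortho; case: eqP => [_|_]; last by rewrite mulr0.
rewrite -rmorphM /= -invfM -expr2 sqr_sqrtr ?ler0n// fmorphV rmorph_nat mulVf//.
by rewrite pnatr_eq0.
Qed.

End Weyl.

(** * The spectral gap *)

Section Gap.
Variables (R : realType) (n : nat).
Local Notation C := R[i].
Local Notation N := n.+1.

(** With all six pairwise squared distances on the left this would be an identity; the three among
    a, b, c are dropped. *)
Lemma hs2_sum4 m k (p a b c : 'M[C]_(m, k)) :
  hs2 (p + (a + (b + c))) + (hs2 (p - a) + (hs2 (p - b) + hs2 (p - c))) <=
    4 * (hs2 p + (hs2 a + (hs2 b + hs2 c))).
Proof.
rewrite hs2.unlock -!big_split /= mulr_sumr; apply: ler_sum => i _.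
rewrite -!big_split /= mulr_sumr; apply: ler_sum => j _; rewrite !mxE !rnorm_sqrE !raddfD /=.
move: (p i j) (a i j) (b i j) (c i j) => [p1 p2] [a1 a2] [b1 b2] [c1 c2] /=.
rewrite -subr_ge0 [X in 0 <= X](_ : _ =
  (a1 - b1) ^+ 2 + (a1 - c1) ^+ 2 + (b1 - c1) ^+ 2 +
  ((a2 - b2) ^+ 2 + (a2 - c2) ^+ 2 + (b2 - c2) ^+ 2)); last by ring.
by rewrite !addr_ge0 ?sqr_ge0.
Qed.

Lemma sqr_dist_le (K x y d : R) : 0 < K -> 0 <= x -> 0 <= y -> `|x - y| <= d ->
  `|x ^+ 2 - y ^+ 2| <= K / 2 * d ^+ 2 + K^-1 * (x ^+ 2 + y ^+ 2).
Proof.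
move=> K0 x0 y0 xyd.
rewrite subr_sqr normrM [`|x + y|]ger0_norm ?addr_ge0//.
apply: (@le_trans _ _ (d * (x + y))); first by rewrite ler_wpM2r ?addr_ge0.
have h1 : x ^+ 2 + y ^+ 2 >= (x + y) ^+ 2 / 2 by have := sqr_ge0 (x - y); rewrite sqrrB sqrrD; lra.
apply: (@le_trans _ _ (K / 2 * d ^+ 2 + K^-1 * ((x + y) ^+ 2 / 2))); last first.
  by rewrite lerD2l ler_wpM2l// invr_ge0 ltW.
rewrite -subr_ge0.
have -> : K / 2 * d ^+ 2 + K^-1 * ((x + y) ^+ 2 / 2) - d * (x + y) =
    K / 2 * (d - (x + y) / K) ^+ 2 by field; rewrite gt_eqF.
by rewrite mulr_ge0 ?sqr_ge0// divr_ge0// ltW.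
Qed.

Lemma rnorm_dist (z z' : C) : `|rnorm z - rnorm z'| <= rnorm (z - z').
Proof.
have h1 := rnormD (z - z') z'; have h2 := rnormD (z' - z) z.
rewrite subrK in h1; rewrite subrK rnorm_distC in h2.
by rewrite ler_norml; apply/andP; split; lra.
Qed.

Lemma fourierB (w : C) (p q : 'M[C]_N) x :
  fourier w (p - q) x = fourier w p x - fourier w q x.
Proof.
by rewrite /fourier -sumrB; apply: eq_bigr => y _; rewrite !mxE mulrBl.
Qed.

(* The gap only uses how conjugation acts on the Fourier transform; [a], [b]
   and [c] stand for the conjugates of [p]. *)
Lemma fourier_gap (w : C) (p a b c : 'M[C]_N) :
  w ^+ N = 1 -> rnorm w = 1 -> (forall k, (0 < k < N)%N -> w ^+ k != 1) ->
  (forall k, (N <= 8 * k)%N -> (8 * k <= 7 * N)%N -> 1 / 2 <= rnorm (w ^+ k - 1) ^+ 2) ->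
  (forall x, fourier w a x = w ^+ x.1 * fourier w p x) ->
  (forall x, rnorm (fourier w b x) = rnorm (fourier w p (shear x))) ->
  (forall x, rnorm (fourier w c x) = rnorm (fourier w p (quarter x))) ->
  \tr p = 0 ->
  hs2 p <= 2304 * (hs2 (p - a) +
    (hs2 (p - b) + hs2 (p - c))).
Proof.
move=> wN w1 wk w8 fa fb fc tr0.
have [dU hU] : exists x, x = hs2 (p - a) by eexists.
have [dD hD] : exists x, x = hs2 (p - b) by eexists.
have [dF hF] : exists x, x = hs2 (p - c) by eexists.
suff : hs2 p <= 2304 * (dU + (dD + dF)) by rewrite hU hD hF.
have dU0 : 0 <= dU by rewrite hU hs2_ge0.
have dD0 : 0 <= dD by rewrite hD hs2_ge0.
have dF0 : 0 <= dF by rewrite hF hs2_ge0.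
pose f := fourier w p; pose mu x := rnorm (f x) ^+ 2.
pose S := \sum_x mu x.
have SE : S = N%:R * hs2 p by exact: parseval.
have f0 : mu (0, 0) = 0.
  rewrite /mu /f /fourier /= (eq_bigr (fun y => p y y)) => [|y _].
    by rewrite -[\sum_y _]/(\tr p) tr0 rnorm0 expr0n.
  by rewrite mul0n mulr1 addr0.
have mu0 x : 0 <= mu x by exact: sqr_ge0.
have N0 : 0 < N%:R :> R by rewrite ltr0n.
(* This is [sqr_dist_le] with K = 96, summed by Parseval: K/2 = 48 and 2S/96 = S/48. The ping-pong
   bound then contains 24 S/48 = S/2, which the left side absorbs, and the constant becomes 2 * 24 *
   48 = 2304. *)
pose e := 48 * (N%:R * (dD + dF)) + S / 48.
have main (q : 'M[C]_N) (s : 'I_N * 'I_N -> 'I_N * 'I_N) (sV : 'I_N * 'I_N -> 'I_N * 'I_N) :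
    cancel s sV -> cancel sV s ->
    (forall x, rnorm (fourier w q x) = rnorm (f (s x))) ->
    hs2 (p - q) <= dD + dF ->
    forall B : pred ('I_N * 'I_N), `|\sum_(x | B (sV x)) mu x - \sum_(x | B x) mu x| <= e.
  move=> sK sVK fq dq B.
  have -> : \sum_(x | B (sV x)) mu x = \sum_(x | B x) mu (s x).
    rewrite (reindex s) /=; last by exists sV => x _; [exact: sK|exact: sVK].
    by apply: eq_bigl => x; rewrite sK.
  rewrite -sumrB; apply: (le_trans (ler_norm_sum _ _ _)).
  apply: (@le_trans _ _ (\sum_x `|mu (s x) - mu x|)).
    by rewrite big_mkcond; apply: ler_sum => x _; case: ifP.
  apply: (@le_trans _ _ (\sum_x (96 / 2 * rnorm (fourier w (p - q) x) ^+ 2 +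
      96^-1 * (mu (s x) + mu x)))).
    apply: ler_sum => x _; apply: sqr_dist_le; rewrite ?rnorm_ge0//.
    by rewrite -fq fourierB rnorm_distC; exact: rnorm_dist.
  rewrite big_split /= -!mulr_sumr parseval// big_split /=.
  have -> : \sum_x mu (s x) = S.
    by rewrite /S [RHS](reindex s)//=; exists sV => x _; [exact: sK|exact: sVK].
  rewrite -/S /e.
  have : N%:R * hs2 (p - q) <= N%:R * (dD + dF) by rewrite ler_wpM2l// ltW.
  lra.
have := @pingpong R n mu mu0 e.
have db : hs2 (p - b) <= dD + dF by rewrite -hD lerDl.
have dc : hs2 (p - c) <= dD + dF by rewrite -hF lerDr.
move=> /(_ (main b _ _ (@shearK n) (@shearVK n) fb db)).
move=> /(_ (main c _ _ (@quarterK n) (@quarterVK n) fc dc)) pp.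
have SS : S = \sum_(x : 'I_N * 'I_N | (nat_of_ord x.1 != 0%N) || (nat_of_ord x.2 != 0%N)) mu x.
  rewrite /S (bigD1 (0, 0))//= f0 add0r; apply: eq_bigl => -[x y] /=.
  by rewrite xpair_eqE negb_and.
(* On [far1] the phase w^a stays away from 1, so the clock matrix alone controls this mass. *)
have O : \sum_(x | far1 x) mu x <= 2 * (N%:R * dU).
  rewrite hU -(parseval wN w1 wk) mulr_sumr big_mkcond; apply: ler_sum => x _.
  case: ifP => ox; last by rewrite mulr_ge0// sqr_ge0.
  rewrite fourierB fa -[X in X - _]mul1r -mulrBl rnormM exprMn -/f rnorm_distC.
  have [h1 h2] : (N <= 8 * x.1)%N /\ (8 * x.1 <= 7 * N)%N.
    by move: ox (ltn_ord x.1); rewrite /far1 /cabs; move: (nat_of_ord x.1) => k; lia.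
  have h := w8 _ h1 h2; rewrite -/(mu x).
  by have := ler_wpM2r (mu0 x) h; lra.
rewrite -(ler_pM2l N0) -SE mulrCA.
rewrite -SS /e in pp.
have : 0 <= N%:R * dU by rewrite mulr_ge0// ltW.
have : 0 <= N%:R * (dD + dF) by rewrite mulr_ge0 ?addr_ge0// ltW.
rewrite [N%:R * (dU + _)]mulrDr; lra.
Qed.

Lemma quantum_gap (w : C) (p : 'M[C]_N) :
  w ^+ N = 1 -> rnorm w = 1 -> (forall k, (0 < k < N)%N -> w ^+ k != 1) ->
  (forall k, (N <= 8 * k)%N -> (8 * k <= 7 * N)%N -> 1 / 2 <= rnorm (w ^+ k - 1) ^+ 2) ->
  \tr p = 0 ->
  hs2 p <= 2304 * (hs2 (p - Um n w *m p *m (Um n w)^t*) +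
    (hs2 (p - Dm n w *m p *m (Dm n w)^t*) + hs2 (p - Fm n w *m p *m (Fm n w)^t*))).
Proof.
move=> wN w1 wk w8; apply: (fourier_gap wN w1 wk w8) => [x|x|x].
- exact: (fourier_U wN w1).
- by rewrite (fourier_D wN w1) rnormM (rnorm_wX w1) mul1r.
- by rewrite (fourier_F wN w1 wk) rnormM rnorm_conj (rnorm_wX w1) mul1r.
Qed.

(* Conjugation by 1 keeps the four unitaries apart from a common value. *)
Lemma quantum_expander_gap : exists u : 'I_4 -> 'M[C]_N,
  (forall i, u i \is unitarymx) /\
  forall p : 'M[C]_N, \tr p = 0 ->
    hs2 (\sum_i u i *m p *m (u i)^t*) <= (16 - 2304^-1) * hs2 p.
Proof.
have [w [wN w1 wk w8]] := root_of_unity_spread R n.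
pose u (i : 'I_4) := nth 1%:M [:: 1%:M; Um n w; Dm n w; Fm n w] i.
exists u; split.
  move=> i; rewrite /u; case: i => [[|[|[|[|//]]]] _] /=.
  - by apply/unitarymxP; rewrite adjmx1 mulmx1.
  - exact: Um_unitary.
  - exact: Dm_unitary.
  - exact: Fm_unitary.
move=> p tr0; have gap := quantum_gap wN w1 wk w8 tr0.
rewrite !big_ord_recl big_ord0 addr0 /u /= adjmx1 mul1mx mulmx1.
have hu (v : 'M[C]_N) : v \is unitarymx -> hs2 (v *m p *m v^t*) = hs2 p by exact: hs2_unitary_conj.
have hU := hu _ (Um_unitary n w1); have hD := hu _ (Dm_unitary n w1).
have hF := hu _ (Fm_unitary wN w1 wk).
move: hU hD hF gap.
set a := Um n w *m p *m _; set b := Dm n w *m p *m _; set c := Fm n w *m p *m _.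
(* All four terms have the norm of p, so the displacements, at least 1/2304 of [hs2 p] in total, are
   lost from the maximal value 16 [hs2 p]. *)
have ident := hs2_sum4 p a b c.
by clearbody a b c => hU hD hF gap; move: ident; rewrite hU hD hF; lra.
Qed.

End Gap.

(** * Amplification of the gap *)

Section StrongExpander.
Variable R : realType.
Local Notation C := R[i].

Lemma trace_AMGM m n (A B : 'M[C]_(m, n)) (t : R) : 0 < t ->
  2 * complex.Re (\tr (A *m B^t*)) <= t * hs2 A + t^-1 * hs2 B.
Proof.
move=> t0; rewrite hs2.unlock /mxtrace raddf_sum !mulr_sumr -big_split; apply: ler_sum => i _ /=.
rewrite mxE raddf_sum !mulr_sumr -big_split; apply: ler_sum => j _ /=.
rewrite !mxE; apply: (@le_trans _ _ (2 * (rnorm (A i j) * rnorm (B i j)))).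
  rewrite ler_pM2l// -(rnorm_conj (B i j)) -rnormM; exact: Re_le_rnorm.
rewrite -subr_ge0.
have -> : t * rnorm (A i j) ^+ 2 + t^-1 * rnorm (B i j) ^+ 2 - 2 * (rnorm (A i j) * rnorm (B i j))
   = t * (rnorm (A i j) - t^-1 * rnorm (B i j)) ^+ 2 by field; rewrite gt_eqF.
by rewrite mulr_ge0 ?sqr_ge0// ltW.
Qed.

(** Conjugating by all words of length L and summing iterates the four-term operator L times; this
    operator preserves trace zero, so the gap is raised to the power L. The index type I is chosen
    before n, which makes the number of unitaries independent of the matrix size. *)
Lemma expander_words L : exists I : finType, (0 < #|I|)%N /\ forall n,
  exists u : I -> 'M[C]_n.+1, (forall i, u i \is unitarymx) /\
  forall p : 'M[C]_n.+1, \tr p = 0 ->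
    hs2 (\sum_i u i *m p *m (u i)^t*) <= #|I|%:R ^+ 2 * (1 - (16 * 2304)^-1) ^+ L * hs2 p.
Proof.
elim: L => [|L [I [I0 ih]]].
  exists unit; rewrite card_unit; split=> // n; exists (fun=> 1%:M); split=> [i|p _].
    by apply/unitarymxP; rewrite adjmx1 mulmx1.
  rewrite (bigD1 tt)//= big1 ?addr0; last by case.
  by rewrite adjmx1 mul1mx mulmx1 expr1n expr0 !mul1r.
exists (I * 'I_4)%type; rewrite card_prod card_ord muln_gt0 I0; split=> // n.
have [u [uU uG]] := ih n; have [g [gU gG]] := quantum_expander_gap R n.
exists (fun x => g x.2 *m u x.1); split=> [x|p tr0]; first exact: mul_unitarymx.
set T := \sum_i u i *m p *m (u i)^t*.
have -> : \sum_x g x.2 *m u x.1 *m p *m (g x.2 *m u x.1)^t* = \sum_j g j *m T *m (g j)^t*.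
  rewrite -(pair_bigA _ (fun i j => g j *m u i *m p *m (g j *m u i)^t*)) exchange_big /=.
  apply: eq_bigr => j _; rewrite mulmx_sumr mulmx_suml; apply: eq_bigr => i _.
  by rewrite adjmxM !mulmxA.
have T0 : \tr T = 0.
  rewrite raddf_sum big1 // => i _; rewrite /= mxtrace_mulC mulmxA unitary_adjK//.
  by rewrite mul1mx.
apply: (le_trans (gG _ T0)).
apply: (le_trans (ler_wpM2l _ (uG _ tr0))); first by lra.
rewrite [(1 - _) ^+ L.+1]exprS natrM le_eqVlt; apply/orP; left; apply/eqP.
by move: (_ ^+ L) => lL; field.
Qed.

Lemma strong_expander : exists k : nat, (0 < k)%N /\ forall n,
  exists u : 'I_k -> 'M[C]_n.+1, (forall i, u i \is unitarymx) /\
  forall m (V : 'M[C]_(m, n.+1)), V \is unitarymx ->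
    \sum_i hs2 (V *m u i *m V^t*) <= k%:R * (1 / 8 + m%:R / n.+1%:R) * m%:R.
Proof.
have [L hL] : exists L : nat, (1 - (16 * 2304)^-1 : R) ^+ L <= 64^-1.
  have : (fun L => (1 - (16 * 2304)^-1 : R) ^+ L) @ \oo --> (0 : R).
    by apply: cvg_expr; rewrite ger0_norm; lra.
  move=> /cvgrPdist_lt /(_ 64^-1); case=> [|L _ hL]; first by lra.
  exists L; have := hL L (leqnn L) => /=.
  by rewrite sub0r normrN => /ltW; apply: le_trans; exact: ler_norm.
have [I [I0 hI]] := expander_words L.
exists #|I|; split=> // n; have [u [uU uG]] := hI n.
exists (fun i => u (enum_val i)); split=> [i|m V VU]; first exact: uU.
set k := #|I|; set N : R := n.+1%:R; have N0 : 0 < N by rewrite ltr0n.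
have k0 : 0 < k%:R :> R by rewrite ltr0n.
rewrite -(big_enum_val (A := I) (fun i => hs2 (V *m u i *m V^t*))) /=.
have [c cE] : exists c : R, c = m%:R / N by eexists.
pose p := V^t* *m V.
pose p0 := p - (c%:C)%:M.
have pp : p *m p = p by rewrite /p mulmxA mulmxtVK.
have pa : p^t* = p by rewrite /p adjmxM trmxCK.
have ptr : \tr p = m%:R by rewrite /p mxtrace_mulC (unitarymxP VU) mxtrace1.
have Nc : N * c = m%:R by rewrite cE mulrC divfK ?gt_eqF.
have trc : \tr ((c%:C)%:M : 'M[C]_n.+1) = m%:R.
  rewrite mxtrace_scalar -[LHS]mulr_natl -[RHS](rmorph_nat (real_complex R)) -Nc.
  by rewrite rmorphM /= /N rmorph_nat.
have p0tr : \tr p0 = 0 by rewrite /p0 linearB /= ptr trc subrr.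
have cadj : ((c%:C)%:M : 'M[C]_n.+1)^t* = (c%:C)%:M.
  rewrite tr_scalar_mx map_scalar_mx; congr _%:M.
  by apply/CrealP; rewrite ger0_real// ler0c cE divr_ge0// ltW.
have p0a : p0^t* = p0 by rewrite /p0 adjmxB pa cadj.
have pE : p = p0 + (c%:C)%:M by rewrite subrK.
have p0hs : hs2 p0 <= m%:R.
  have -> : hs2 p0 = m%:R - c * m%:R.
    apply: (@complexI R); rewrite hs2E p0a {2}/p0 mulmxBr linearB /= mul_mx_scalar linearZ /=.
    rewrite p0tr mulr0 subr0 /p0 mulmxBl pp linearB /= mul_scalar_mx linearZ /= ptr.
    by rewrite rmorphB rmorphM /= rmorph_nat.
  by rewrite gerBl mulr_ge0 ?ler0n// cE divr_ge0// ltW.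
pose Q0 := \sum_i u i *m p0 *m (u i)^t*.
have Q0tr : \tr Q0 = 0.
  rewrite raddf_sum big1 // => i _; rewrite /= mxtrace_mulC mulmxA unitary_adjK//.
  by rewrite mul1mx.
have Q0a : Q0^t* = Q0.
  rewrite /Q0 raddf_sum map_mx_sum; apply: eq_bigr => i _ /=.
  by rewrite adjmxM adjmxM trmxCK p0a mulmxA.
have Q0hs : hs2 Q0 <= k%:R ^+ 2 / 64 * m%:R.
  apply: (le_trans (uG _ p0tr)); apply: ler_pM => //; rewrite ?hs2_ge0//.
    by rewrite mulr_ge0 ?sqr_ge0// exprn_ge0//; lra.
  by rewrite ler_wpM2l ?sqr_ge0.
have QE : \sum_i u i *m p *m (u i)^t* = Q0 + ((k%:R * c)%:C)%:M.
  rewrite pE /Q0 (eq_bigr (fun i => u i *m p0 *m (u i)^t* + (c%:C)%:M)) => [|i _].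
    rewrite big_split /= sumr_const; congr (_ + _); rewrite -/k.
    by rewrite -scaler_nat scale_scalar_mx [X in _ = X%:M]rmorphM /= rmorph_nat.
  rewrite mulmxDr mulmxDl; congr (_ + _).
  by rewrite mul_mx_scalar -scalemxAl (adj_unitaryK (uU i)) scalemx1.
have sE : \sum_i hs2 (V *m u i *m V^t*) = complex.Re (\tr (p0 *m Q0)) + k%:R * c * m%:R.
  have q : (\sum_i hs2 (V *m u i *m V^t*))%:C = \tr (p *m \sum_i u i *m p *m (u i)^t*).
    rewrite rmorph_sum /= mulmx_sumr raddf_sum; apply: eq_bigr => i _ /=.
    by rewrite hs2E !adjmxM trmxCK /p -!mulmxA [RHS]mxtrace_mulC -!mulmxA.
  have e : \tr (p *m \sum_i u i *m p *m (u i)^t*) = \tr (p0 *m Q0) + (k%:R * c * m%:R)%:C.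
    rewrite QE mulmxDr mul_mx_scalar linearD linearZ /= ptr pE mulmxDl linearD /=.
    by rewrite mul_scalar_mx linearZ /= Q0tr mulr0 addr0 [X in _ = _ + X]rmorphM /= rmorph_nat.
  by rewrite -[LHS]/(complex.Re (_%:C)) q e raddfD.
rewrite sE.
(* The weight k/8 balances hs2 p0 <= m against hs2 Q0 <= (k/8)^2 m. *)
have k8 : 0 < k%:R / 8 :> R by rewrite divr_gt0.
have := trace_AMGM p0 Q0 k8; rewrite Q0a => h.
have h1 : k%:R / 8 * hs2 p0 <= k%:R / 8 * m%:R by rewrite ler_wpM2l// ltW.
have h2 : (k%:R / 8)^-1 * hs2 Q0 <= k%:R / 8 * m%:R.
  apply: (le_trans (ler_wpM2l _ Q0hs)); first by rewrite invr_ge0 ltW.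
  by rewrite le_eqVlt; apply/orP; left; apply/eqP; field; rewrite gt_eqF.
rewrite -cE; lra.
Qed.

End StrongExpander.

(** * Thin projections *)

Section RobustExpansion.
Variable R : realType.
Local Notation C := R[i].

(** For a projection h with corners c_i = h u_i h this is the sum of the c_i^* c_i + c_i c_i^*. Its
    quadratic form at a unit vector of the range of h tells how much of that vector the u_i and
    u_i^* bring back into the range; for unitaries commuting with h it is 2k h. It is written as a
    *-polynomial in order to be expressible by a term. *)
Definition returnmx k n (u : 'I_k -> 'M[C]_n) (h : 'M[C]_n) : 'M[C]_n :=
  \sum_i (h *m ((u i)^t* *m (h *m (u i *m h))) + h *m (u i *m (h *m ((u i)^t* *m h)))).

Lemma diag_sandwichE n (l : 'I_n -> R) (A : 'M[C]_n) a :
  let D := diag_mx (\row_a (l a)%:C) in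
  (D *m (A^t* *m (D *m (A *m D)))) a a =
    (l a ^+ 2 * \sum_b l b * rnorm (A b a) ^+ 2)%:C.
Proof.
move=> D; rewrite mul_diag_mx !mxE [in RHS]rmorphM /= rmorphXn /= expr2 -mulrA.
congr (_ * _); rewrite rmorph_sum /= mulr_sumr; apply: eq_bigr => b _.
rewrite /D mul_mx_diag mul_diag_mx !mxE rmorphM /= rnorm_sqr; ring.
Qed.

Lemma opnorm_diag n (l : 'I_n -> R) (c : R) : 0 <= c -> (forall a, `|l a| <= c) ->
  opnorm (diag_mx (\row_a (l a)%:C) : 'M[C]_n) <= c.
Proof.
move=> c0 lc; apply: opnorm_le => // x.
rewrite -ler_sqr ?nnegrE ?mulr_ge0 ?l2_ge0// exprMn !l2sq mulr_sumr.
apply: ler_sum => i _; rewrite mul_diag_mx !mxE rnormM exprMn ler_wpM2r ?sqr_ge0//.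
by rewrite rnormC ler_sqr ?nnegrE.
Qed.

Lemma Re_trace_le n (A : 'M[C]_n) : complex.Re (\tr A) <= n%:R * opnorm A.
Proof.
rewrite raddf_sum mulr_natl -[X in _ *+ X]card_ord -sumr_const; apply: ler_sum => i _.
exact: le_trans (Re_le_rnorm _) (opnorm_entry _ _ _).
Qed.

Lemma diag_entry_le n (P A : 'M[C]_n) a : P \is unitarymx ->
  rnorm ((P *m A *m P^t*) a a) <= opnorm A.
Proof.
by move=> PP; exact: le_trans (opnorm_entry _ _ _) (opnorm_compress _ PP).
Qed.

Lemma adj_unitary n (P : 'M[C]_n) : P \is unitarymx -> P^t* \is unitarymx.
Proof. by move=> PP; apply/unitarymxP; rewrite trmxCK unitary_adjK. Qed.

Section Conj.
Variables (n : nat) (P : 'M[C]_n).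
Hypothesis PP : P \is unitarymx.
Let cj (A : 'M[C]_n) := P *m A *m P^t*.

Lemma uconjM A B : cj (A *m B) = cj A *m cj B.
Proof. by rewrite /cj !mulmxA mulmxKtV. Qed.

Lemma uconjadj A : cj (A^t*) = (cj A)^t*.
Proof. by rewrite /cj !adjmxM trmxCK mulmxA. Qed.

Lemma uconj_diag (d : 'I_n -> C) A : cj A = diag_mx (\row_a d a) ->
  A = P^t* *m diag_mx (\row_a d a) *m P.
Proof. by move=> <-; rewrite /cj !mulmxA unitary_adjK// mul1mx -mulmxA unitary_adjK// mulmx1. Qed.

Lemma uconj_unitary A : A \is unitarymx -> cj A \is unitarymx.
Proof.
move=> AU; have PC := adj_unitary PP.
exact: (mul_unitarymx (mul_unitarymx PP AU) PC).
Qed.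

End Conj.

Lemma unitary_rowE n (A : 'M[C]_n) a : A \is unitarymx -> \sum_b rnorm (A a b) ^+ 2 = 1.
Proof.
move=> /unitarymxP AA; apply: (@complexI R).
by rewrite -mulmxadjE AA mxE eqxx.
Qed.

Lemma unitary_colE n (A : 'M[C]_n) a : A \is unitarymx -> \sum_b rnorm (A b a) ^+ 2 = 1.
Proof.
move=> AU; apply: (@complexI R).
by rewrite -adjmulmxE unitary_adjK// mxE eqxx.
Qed.

Lemma almost_idempotent_diag n (A : 'M[C]_n) (e : R) :
  opnorm (A^t* *m A) <= 1 ->
  opnorm ((A^t* *m A) *m (A^t* *m A) - A^t* *m A) <= e ->
  exists (P : 'M[C]_n) (l : 'I_n -> R), [/\ P \is unitarymx,
    P *m (A^t* *m A) *m P^t* = diag_mx (\row_a (l a)%:C) &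
    forall a, [/\ 0 <= l a, l a <= 1 & l a * (1 - l a) <= e]].
Proof.
set h := A^t* *m A => h1 hproj.
have hh : h^t* = h by rewrite /h adjmxM trmxCK.
have [P [d [PU hd]]] := hermitian_diag hh.
pose l a := \sum_x rnorm ((A *m P^t*) x a) ^+ 2.
have {}hd : P *m h *m P^t* = diag_mx (\row_a (l a)%:C).
  rewrite hd; congr diag_mx; apply/rowP => a; rewrite !mxE.
  have <- : (P *m h *m P^t*) a a = d a by rewrite hd !mxE eqxx mulr1n.
  by rewrite -adjmulmxE /h adjmxM trmxCK !mulmxA.
exists P, l; split=> // a; have l0 : 0 <= l a by rewrite sumr_ge0// => x _; rewrite sqr_ge0.
split=> //.
  rewrite -(ger0_norm l0) -rnormC; apply: le_trans h1.
  by have := diag_entry_le h a PU; rewrite hd !mxE eqxx mulr1n.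
apply: le_trans hproj; apply: le_trans (diag_entry_le _ a PU).
rewrite mulmxBr mulmxBl uconjM// hd mul_diag_mx !mxE eqxx !mulr1n -rmorphM -rmorphB rnormC.
by rewrite mulrBr mulr1 distrC ler_norm.
Qed.

(** Compare traces. Each w_j^* w_j is within e of h, so it has diagonal entries at least 1 - 3e on S
    in the basis P; on the other side, the sum of the w_j w_j^* has trace at most n (1 + e). *)
Lemma orthogonal_copies_thin n (P : 'M[C]_n) (l : 'I_n -> R) (h : 'M[C]_n)
    (S : {set 'I_n}) (w : 'I_4 -> 'M[C]_n) (e : R) :
  P \is unitarymx -> P *m h *m P^t* = diag_mx (\row_a (l a)%:C) ->
  (forall a, a \in S -> 1 - 2 * e <= l a) ->
  (forall j, opnorm ((w j)^t* *m w j - h) <= e) ->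
  opnorm (\sum_j w j *m (w j)^t*) <= 1 + e ->
  4 * #|S|%:R * (1 - 3 * e) <= n%:R * (1 + e).
Proof.
move=> PU hd lS hw hsum.
have hj j : #|S|%:R * (1 - 3 * e) <= hs2 (w j).
  rewrite -(hs2_isor _ (adj_unitary PU)) -hs2_adj hs2.unlock.
  apply: (@le_trans _ _ (\sum_(a in S) (1 - 3 * e))).
    by rewrite sumr_const -[leRHS]mulr_natl.
  rewrite big_mkcond; apply: ler_sum => a _; case: ifP => aS; last first.
    by rewrite sumr_ge0// => x _; rewrite sqr_ge0.
  have -> : \sum_x rnorm ((w j *m P^t*)^t* a x) ^+ 2 = \sum_x rnorm ((w j *m P^t*) x a) ^+ 2.
    by apply: eq_bigr => x _; rewrite !mxE rnorm_conj.
  set s := \sum_x _; have sE : (P *m ((w j)^t* *m w j) *m P^t*) a a = s%:C.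
    by rewrite -adjmulmxE adjmxM trmxCK !mulmxA.
  have := le_trans (diag_entry_le ((w j)^t* *m w j - h) a PU) (hw j).
  rewrite mulmxBr mulmxBl hd mxE sE !mxE eqxx mulr1n -rmorphB rnormC ler_norml => /andP[h3 _].
  by move: h3 (lS a aS); clear; lra.
have : \sum_j hs2 (w j) <= n%:R * (1 + e).
  apply: (@le_trans _ _ (n%:R * opnorm (\sum_j w j *m (w j)^t*))); last first.
    by rewrite ler_wpM2l.
  apply: le_trans (Re_trace_le _); rewrite le_eqVlt; apply/orP; left; apply/eqP.
  rewrite [\tr _]raddf_sum raddf_sum; apply: eq_bigr => j _ /=.
  by rewrite -hs2E.
apply: le_trans; apply: (@le_trans _ _ (\sum_(j < 4) #|S|%:R * (1 - 3 * e))).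
  by rewrite sumr_const card_ord -[leRHS]mulr_natl mulrA.
by apply: ler_sum => j _; exact: hj.
Qed.

Lemma hs2_compress_set m n (P : 'M[C]_(m, n)) (A : 'M[C]_n) (S : {set 'I_m}) :
  hs2 (rowsub (@enum_val _ (mem S)) P *m A *m (rowsub (@enum_val _ (mem S)) P)^t*) =
  \sum_(a in S) \sum_(b in S) rnorm ((P *m A *m P^t*) a b) ^+ 2.
Proof.
rewrite hs2.unlock [RHS]big_enum_val; apply: eq_bigr => a _.
rewrite [RHS]big_enum_val; apply: eq_bigr => b _; congr (rnorm _ ^+ 2).
rewrite !mxE; apply: eq_bigr => x _; rewrite !mxE; congr (_ * _).
by apply: eq_bigr => y _; rewrite !mxE.
Qed.

Lemma rowsub_unitary p m n (P : 'M[C]_(m, n)) (f : 'I_p -> 'I_m) :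
  injective f -> P \is unitarymx -> rowsub f P \is unitarymx.
Proof.
move=> finj PU; apply/unitarymxP/matrixP => a b.
have -> : (1%:M : 'M[C]_p) a b = (1%:M : 'M[C]_m) (f a) (f b) by rewrite !mxE (inj_eq finj).
by rewrite -(unitarymxP PU) !mxE; apply: eq_bigr => x _; rewrite !mxE.
Qed.

Lemma weighted_mass_le (I : finType) (l r : I -> R) (S : {set I}) (t e : R) :
  0 <= t <= 1 -> 0 <= e -> (forall a, 0 <= l a <= 1) -> (forall a, a \notin S -> l a <= e) ->
  (forall a, 0 <= r a) -> \sum_a r a = 1 ->
  t ^+ 2 * \sum_b l b * r b <= \sum_(b in S) r b + e.
Proof.
move=> /andP[t0 t1] e0 l01 lS r0 r1.
have h : \sum_b l b * r b <= \sum_(b in S) r b + e.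
  rewrite -[e in leRHS]mulr1 -r1 mulr_sumr [X in _ <= X + _]big_mkcond -big_split /=.
  apply: ler_sum => b _; have /andP[lb0 lb1] := l01 b.
  case: ifP => bS.
    by apply: ler_wpDr; rewrite ?mulr_ge0// ler_piMl.
  by rewrite add0r ler_wpM2r// lS// bS.
apply: le_trans h; rewrite ler_piMl ?exprn_ile1//.
by rewrite sumr_ge0// => b _; have /andP[lb0 _] := l01 b; rewrite mulr_ge0.
Qed.

Lemma returnmx_entryE k n (u : 'I_k -> 'M[C]_n) (P h : 'M[C]_n) (l : 'I_n -> R) a :
  P \is unitarymx -> P *m h *m P^t* = diag_mx (\row_a (l a)%:C) ->
  let v i := P *m u i *m P^t* in
  (P *m ((2 * k%:R)%:C *: h - returnmx u h) *m P^t*) a a =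
  (2 * k%:R * l a - \sum_i (l a ^+ 2 * (\sum_b l b * rnorm (v i b a) ^+ 2) +
                           l a ^+ 2 * (\sum_b l b * rnorm (v i a b) ^+ 2)))%:C.
Proof.
move=> PU hd v; rewrite mulmxBr mulmxBl mxE -scalemxAr -scalemxAl hd [in RHS]rmorphB /=.
congr (_ + _); first by rewrite !mxE eqxx mulr1n -rmorphM.
rewrite mxE; congr (- _); rewrite rmorph_sum /= /returnmx mulmx_sumr mulmx_suml summxE.
apply: eq_bigr => i _; rewrite mulmxDr mulmxDl mxE rmorphD /=; congr (_ + _).
  by rewrite -diag_sandwichE !(uconjM PU) (uconjadj P) hd.
have -> : \sum_b l b * rnorm (v i a b) ^+ 2 = \sum_b l b * rnorm ((v i)^t* b a) ^+ 2.
  by apply: eq_bigr => b _; rewrite !mxE rnorm_conj.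
by rewrite -diag_sandwichE trmxCK !(uconjM PU) (uconjadj P) hd.
Qed.

(** The diagonal entries of 2k h - [returnmx u h] over the spectral set S are averaged. The mean is
    at least k (2 - 8e) minus twice the mean mass that stays in S, and expansion bounds the latter
    by k (1/8 + 3/10) = 17k/40. What remains, k (23/20 - 8e), exceeds 11k/10 + e at e = 1/1000. *)
Lemma robust_expansion k n (u : 'I_k -> 'M[C]_n.+1) (w : 'I_4 -> 'M[C]_n.+1) (e : R) :
  (0 < k)%N -> e = 1000^-1 -> (forall i, u i \is unitarymx) ->
  (forall m (V : 'M[C]_(m, n.+1)), V \is unitarymx ->
    \sum_i hs2 (V *m u i *m V^t*) <= k%:R * (1 / 8 + m%:R / n.+1%:R) * m%:R) ->
  let h := (w ord0)^t* *m w ord0 in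
  opnorm h <= 1 -> opnorm (h *m h - h) <= e ->
  (forall j, opnorm ((w j)^t* *m w j - h) <= e) ->
  opnorm (\sum_j w j *m (w j)^t*) <= 1 + e -> 1 - e <= opnorm h ->
  k%:R * (11 / 10) + e <= opnorm ((2 * k%:R)%:C *: h - returnmx u h).
Proof.
move=> k0 eE uU exp_u h h1 hproj hw hsum.
have [P [l [PU hd lP]]] := almost_idempotent_diag h1 hproj.
have e0 : 0 < e by rewrite eE; clear; lra.
have {hproj} e1 : e <= 8^-1 by rewrite eE; clear; lra.
(* Since l (1 - l) <= e, the eigenvalues cluster near 0 and 1, and cutting at 1/2 gives distance at
   most 2e on either side. *)
pose S := [set a | 1 / 2 < l a]%SET.
have lS a : a \in S -> 1 - 2 * e <= l a.
  rewrite inE => h2; have [h3 h4 h5] := lP a; move: h2 h3 h4 h5 e0 e1.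
  by move: (l a) => x; clear; nra.
have lSN a : a \notin S -> l a <= 2 * e.
  rewrite inE -leNgt => h2; have [h3 h4 h5] := lP a; move: h2 h3 h4 h5 e0 e1.
  by move: (l a) => x; clear; nra.
move=> hnz; set X := opnorm (_ - _).
have S0 : (0 < #|S|)%N.
  rewrite lt0n; apply/negP => /eqP/cards0_eq S0.
  suff /(le_trans hnz) : opnorm h <= 2 * e by move: e0 e1; clear; lra.
  rewrite [h](uconj_diag PU hd).
  have := opnorm_compress (diag_mx (\row_a (l a)%:C)) (adj_unitary PU).
  rewrite trmxCK => hD; apply: (le_trans hD).
  apply: opnorm_diag => [|a]; first by rewrite mulr_ge0// ltW.
  by have [h3 _ _] := lP a; rewrite ger0_norm// lSN// S0 inE.
have thin := orthogonal_copies_thin PU hd lS hw hsum.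
pose v i := P *m u i *m P^t*.
have vU i : v i \is unitarymx := uconj_unitary PU (uU i).
pose c i := \sum_(a in S) \sum_(b in S) rnorm (v i a b) ^+ 2.
have cle : \sum_i c i <= k%:R * (1 / 8 + #|S|%:R / n.+1%:R) * #|S|%:R.
  have := exp_u _ _ (rowsub_unitary (@enum_val_inj _ (mem S)) PU).
  by apply: le_trans; rewrite le_eqVlt; apply/orP; left; apply/eqP/eq_bigr => i _; rewrite hs2_compress_set.
have key a : a \in S -> 2 * k%:R * (1 - 2 * e) -
    \sum_i (\sum_(b in S) rnorm (v i b a) ^+ 2 + \sum_(b in S) rnorm (v i a b) ^+ 2 + 4 * e) <= X.
  move=> aS; have := le_trans (Re_le_rnorm _) (diag_entry_le ((2 * k%:R)%:C *: h - returnmx u h) a PU).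
  rewrite -/X (returnmx_entryE _ _ PU hd) -/v [complex.Re _]/=; apply: le_trans.
  have [h3 h4 _] := lP a.
  have l01 b : 0 <= l b <= 1 by have [-> -> _] := lP b.
  apply: lerB.
    by rewrite ler_wpM2l ?mulr_ge0// lS.
  apply: ler_sum => i _; have -> : 4 * e = 2 * e + 2 * e by clear; lra.
  rewrite addrACA; apply: lerD; apply: weighted_mass_le; rewrite ?h3 ?h4 ?mulr_ge0 ?(ltW e0)//.
  - by move=> b; rewrite sqr_ge0.
  - exact: (unitary_colE _ (vU i)).
  - by move=> b; rewrite sqr_ge0.
  - exact: (unitary_rowE _ (vU i)).
have total : #|S|%:R * (2 * k%:R * (1 - 2 * e)) -
    (\sum_i c i + \sum_i c i + #|S|%:R * (k%:R * (4 * e))) <= #|S|%:R * X.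
  have -> : #|S|%:R * X = \sum_(a in S) X by rewrite sumr_const -[RHS]mulr_natl.
  apply: le_trans (ler_sum _ key); rewrite sumrB sumr_const -[X in _ <= X - _]mulr_natl.
  rewrite lerD2l lerN2 exchange_big /= le_eqVlt; apply/orP; left; apply/eqP.
  under eq_bigr => i _ do rewrite 2!big_split /= sumr_const.
  rewrite 2!big_split /= sumr_const card_ord; congr (_ + _ + _).
    by apply: eq_bigr => i _; rewrite /c exchange_big.
  by rewrite -[LHS]mulr_natl -[4 * e *+ _]mulr_natl mulrCA.
have n0 : 0 < n.+1%:R :> R by rewrite ltr0n.
have s0 : 0 < #|S|%:R :> R by rewrite ltr0n.
have kR : 1 <= k%:R :> R by rewrite ler1n.
(* The approximate copies give a ratio at most (1 + e) / (4 (1 - 3e)), slightly above 1/4; 3/10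
   leaves room. *)
have frac : #|S|%:R / n.+1%:R <= 3 / 10 :> R.
  rewrite ler_pdivrMr//; move: thin s0 n0; rewrite eE.
  by move: (#|S|%:R : R) (n.+1%:R : R) => s N; clear; lra.
rewrite -(ler_pM2l s0); apply: le_trans total.
have cle' : \sum_i c i <= #|S|%:R * (k%:R * (17 / 40)).
  apply: (le_trans cle); rewrite mulrC ler_wpM2l ?ler0n// ler_wpM2l ?ler0n//.
  by move: frac; move: (#|S|%:R / n.+1%:R : R) => x; clear; lra.
have -> : #|S|%:R * (2 * k%:R * (1 - 2 * e)) -
    (\sum_i c i + \sum_i c i + #|S|%:R * (k%:R * (4 * e))) =
  #|S|%:R * (k%:R * (2 - 8 * e)) - 2 * \sum_i c i by ring.
apply: (@le_trans _ _ (#|S|%:R * (k%:R * (2 - 8 * e)) - 2 * (#|S|%:R * (k%:R * (17 / 40))))); last first.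
  by rewrite lerD2l lerN2 ler_pM2l.
rewrite [2 * _]mulrCA -mulrBr ler_pM2l// eE; move: kR; clear; lra.
Qed.

End RobustExpansion.

(** * From operator norms back to traces on thin corners *)

Section ThinCorners.
Variable R : realType.
Local Notation C := R[i].

Lemma opnorm_projection n (Q : 'M[C]_n) : Q^t* = Q -> Q *m Q = Q ->
  opnorm Q <= 1 /\ (Q != 0 -> 1 <= opnorm Q).
Proof.
move=> Qa QQ; have := opnorm_cstar Q.
have -> : mxadj Q = Q by exact: Qa.
rewrite QQ => e; have [Q0|Q0] := eqVneq (opnorm Q) 0.
  by rewrite Q0; split=> // /eqP[]; exact: opnorm_eq0.
have q1 : opnorm Q = 1.
  by apply: (mulfI Q0); rewrite mulr1 -expr2 -e.
by rewrite q1.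
Qed.

Lemma opnorm_le1_sqr n (A B : 'M[C]_n) : A^t* *m A = B -> opnorm B <= 1 -> opnorm A <= 1.
Proof.
move=> AB; have := opnorm_cstar A; have -> : mxadj A *m A = B by exact: AB.
by move=> -> ; rewrite expr_le1// opnorm_ge0.
Qed.

Lemma orthogonal_isometries m n : (4 * m <= n)%N ->
  exists E : 'I_4 -> 'M[C]_(n, m),
    forall i j, (E i)^t* *m E j = if i == j then 1%:M else 0.
Proof.
move=> mn; have cmn : (#|{: 'I_4 * 'I_m}| <= n)%N by rewrite card_prod !card_ord.
pose f x := widen_ord cmn (enum_rank x).
have finj : injective f by move=> x y /(congr1 val) /= /val_inj /enum_rank_inj.
exists (fun j => \matrix_(x, a) (x == f (j, a))%:R) => i j.
apply/matrixP => a b; rewrite !mxE (bigD1 (f (i, a)))//= !mxE eqxx rmorph1 mul1r.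
rewrite big1 ?addr0 => [|x xf]; last by rewrite !mxE (negbTE xf) rmorph0 mul0r.
by rewrite (inj_eq finj) xpair_eqE; case: eqP => ij; rewrite !mxE.
Qed.

Lemma opnorm_iso_diag m n (W : 'M[C]_(m, n)) (l : 'I_m -> R) (c : R) :
  W \is unitarymx -> 0 <= c -> (forall a, `|l a| <= c) ->
  opnorm (W^t* *m diag_mx (\row_a (l a)%:C) *m W) <= c.
Proof.
move=> WU c0 lc; apply: opnorm_le => // x.
rewrite -!mulmxA l2_iso; last by rewrite trmxCK; exact/unitarymxP.
apply: (le_trans (opnormP _ _)); apply: ler_pM; rewrite ?opnorm_ge0 ?l2_ge0//.
  exact: opnorm_diag.
exact: l2_coiso.
Qed.

(* The tuples [w] satisfying the hypotheses are the four partial isometries that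
   move a nonzero projection [h] onto orthogonal copies of it, and they exist
   exactly when [h] has rank at most n / 4. *)
Definition expands_thin k n (u : 'I_k -> 'M[C]_n) : Prop :=
  forall w : 'I_4 -> 'M[C]_n, let h := (w ord0)^t* *m w ord0 in
    (forall j, opnorm (w j) <= 1) -> h *m h = h ->
    (forall j, (w j)^t* *m w j = h) ->
    opnorm (\sum_j w j *m (w j)^t*) <= 1 -> 1 <= opnorm h ->
    k%:R * (11 / 10) < opnorm ((2 * k%:R)%:C *: h - returnmx u h).

Lemma returnmx_corner k m n (u : 'I_k -> 'M[C]_n) (V : 'M[C]_(m, n)) (c : 'I_k -> 'M[C]_m) :
  V \is unitarymx -> (forall i, c i = V *m u i *m V^t*) ->
  returnmx u (V^t* *m V) =
    V^t* *m (\sum_i ((c i)^t* *m c i + c i *m (c i)^t*)) *m V.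
Proof.
move=> VU cE; rewrite /returnmx mulmx_sumr mulmx_suml; apply: eq_bigr => i _.
have caE : (c i)^t* = V *m (u i)^t* *m V^t* by rewrite cE !adjmxM trmxCK mulmxA.
by rewrite mulmxDr mulmxDl caE cE; congr (_ + _); rewrite !mulmxA.
Qed.

Lemma sum_squares_hermitian k m (c : 'I_k -> 'M[C]_m) :
  let M := \sum_i ((c i)^t* *m c i + c i *m (c i)^t*) in M^t* = M.
Proof.
move=> M; rewrite /M raddf_sum map_mx_sum; apply: eq_bigr => i _ /=.
by rewrite adjmxD (adjmxM _ (c i)) (adjmxM (c i)) trmxCK.
Qed.

Lemma sum_squares_conjE k m (c g : 'I_k -> 'M[C]_m) (P : 'M[C]_m) a :
  P \is unitarymx -> (forall i, g i = P *m c i *m P^t*) ->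
  let M := \sum_i ((c i)^t* *m c i + c i *m (c i)^t*) in
  (P *m M *m P^t*) a a =
    (\sum_i (\sum_b rnorm (g i b a) ^+ 2 + \sum_b rnorm (g i a b) ^+ 2))%:C.
Proof.
move=> PU gE M; rewrite /M mulmx_sumr mulmx_suml summxE rmorph_sum /=; apply: eq_bigr => i _.
rewrite mulmxDr mulmxDl mxE !(uconjM PU) !(uconjadj P) -gE.
by rewrite adjmulmxE mulmxadjE rmorphD.
Qed.

(* Induction on [m]: an eigenvector of the corner with eigenvalue at most 9k/10
   is split off. *)
Lemma thin_contraction k n (u : 'I_k -> 'M[C]_n) :
  (forall i, opnorm (u i) <= 1) -> expands_thin u ->
  forall m (V : 'M[C]_(m, n)), (4 * m <= n)%N -> V \is unitarymx ->
    \sum_i hs2 (V *m u i *m V^t*) <= k%:R * (9 / 10) * m%:R.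
Proof.
move=> u1 uexp; elim=> [|m ih] V mn VU.
  rewrite mulr0 big1 // => i _; rewrite hs2.unlock big1 // => -[] //.
have [c cE] : exists c, forall i, c i = V *m u i *m V^t* by eexists.
set h := V^t* *m V.
have hh : h^t* = h by rewrite /h adjmxM trmxCK.
have hsq : h *m h = h by rewrite /h mulmxA mulmxtVK.
have [h1 h2] := opnorm_projection hh hsq.
have hnz : 1 <= opnorm h.
  apply: h2; apply/eqP => h0; have := congr1 (fun X => V *m X *m V^t*) h0.
  rewrite mulmx0 mul0mx /h !mulmxA mulmxtVK// (unitarymxP VU).
  by move=> /matrixP/(_ ord0 ord0)/eqP; rewrite !mxE eqxx oner_eq0.
(* The partial isometries E_j V carry the row space of V onto four orthogonal subspaces, for which
   4m <= n leaves room, so the expansion hypothesis applies to h. *)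
have [E hE] := orthogonal_isometries mn.
have wE j : (E j *m V)^t* *m (E j *m V) = h.
  by rewrite adjmxM -mulmxA [_ *m (E j *m V)]mulmxA hE eqxx mul1mx.
have w1 j : opnorm (E j *m V) <= 1.
  exact: opnorm_le1_sqr (wE j) h1.
have wsum : opnorm (\sum_j (E j *m V) *m (E j *m V)^t*) <= 1.
  have -> : \sum_j (E j *m V) *m (E j *m V)^t* = \sum_j E j *m (E j)^t*.
    by apply: eq_bigr => j _; rewrite adjmxM mulmxA mulmxtVK.
  set Q := \sum_j _; have Qa : Q^t* = Q.
    rewrite raddf_sum map_mx_sum; apply: eq_bigr => j _ /=.
    by rewrite adjmxM trmxCK.
  have QQ : Q *m Q = Q.
    rewrite mulmx_suml; apply: eq_bigr => i _; rewrite mulmx_sumr (bigD1 i)//= big1 => [|j ji].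
      by rewrite addr0 -mulmxA [_ *m (E i *m _)]mulmxA hE eqxx mul1mx.
    by rewrite -mulmxA [_ *m (E j *m _)]mulmxA hE eq_sym (negbTE ji) mul0mx mulmx0.
  by have [] := opnorm_projection Qa QQ.
have := uexp (fun j => E j *m V); rewrite wE => /(_ w1 hsq wE wsum hnz).
rewrite /h (returnmx_corner VU cE) -/h; have := sum_squares_hermitian c => /=.
have := sum_squares_conjE; move=> /(_ _ _ c) /=.
move: (\sum_i _) => M ME Mh big.
have [P [d [PU hd]]] := hermitian_diag Mh.
pose W := P *m V; have WU : W \is unitarymx := mul_unitarymx PU VU.
have [g gW] : exists g, forall i, g i = W *m u i *m W^t* by eexists.
have gE i : g i = P *m c i *m P^t* by rewrite gW cE /W adjmxM !mulmxA.
pose nu a := \sum_i (\sum_b rnorm (g i b a) ^+ 2 + \sum_b rnorm (g i a b) ^+ 2).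
have {}hd : P *m M *m P^t* = diag_mx (\row_a (nu a)%:C).
  rewrite hd; congr diag_mx; apply/rowP => a; rewrite !mxE.
  have -> : d a = (P *m M *m P^t*) a a by rewrite hd !mxE eqxx mulr1n.
  exact: (ME g P a PU gE).
have Wh : W^t* *m W = h.
  by rewrite /W adjmxM mulmxA -[V^t* *m P^t* *m P]mulmxA unitary_adjK// mulmx1.
have WM : W^t* *m diag_mx (\row_a (nu a)%:C) *m W = V^t* *m M *m V.
  by rewrite /W adjmxM (uconj_diag PU hd) !mulmxA.
have WE : (2 * k%:R)%:C *: h - V^t* *m M *m V =
    W^t* *m diag_mx (\row_a (2 * k%:R - nu a)%:C) *m W.
  have -> : diag_mx (\row_a (2 * k%:R - nu a)%:C) =
      (2 * k%:R)%:C%:M - diag_mx (\row_a (nu a)%:C) :> 'M[C]_m.+1.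
    by apply/matrixP => a b; rewrite !mxE rmorphB mulrnBl.
  by rewrite mulmxBr mulmxBl mul_mx_scalar -scalemxAl Wh WM.
have [a ha] : exists a, k%:R * (11 / 10) < `|2 * k%:R - nu a|.
  apply: contrapT => /forallNP H; move: big; rewrite WE ltNge => /negP; apply.
  apply: opnorm_iso_diag => // [|a]; first by rewrite mulr_ge0// divr_ge0.
  by rewrite leNgt; apply/negP; exact: H.
have g1 i : opnorm (g i) <= 1.
  by rewrite gW; apply: le_trans (opnorm_compress _ WU) (u1 i).
have nu2 : nu a <= 2 * k%:R.
  apply: (@le_trans _ _ (\sum_(i < k) (1 + 1))); last first.
    by rewrite sumr_const card_ord -[leLHS]mulr_natl mulrC.
  apply: ler_sum => i _; apply: lerD.
    by apply: (le_trans (col_sqr_le_opnorm _ _)); rewrite expr_le1 ?opnorm_ge0.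
  by apply: (le_trans (row_sqr_le_opnorm _ _)); rewrite expr_le1 ?opnorm_ge0.
(* As [nu a] is at most 2k, the absolute value opens with a known sign: a large deviation from 2k
   means a small return. *)
have nua : nu a <= k%:R * (9 / 10).
  move: ha; rewrite ger0_norm ?subr_ge0//; move: nu2.
  by move: (nu a) (k%:R : R) => x y; clear; lra.
have W'U : row' a W \is unitarymx.
  apply/unitarymxP/matrixP => b b'.
  have -> : (1%:M : 'M[C]_m) b b' = (1%:M : 'M[C]_m.+1) (lift a b) (lift a b').
    by rewrite !mxE (inj_eq lift_inj).
  by rewrite -(unitarymxP WU) !mxE; apply: eq_bigr => x _; rewrite !mxE.
have mn' : (4 * m <= n)%N by apply: leq_trans mn; rewrite leq_mul2l leqnSn orbT.
have := ih _ mn' W'U => ihW.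
have -> : \sum_i hs2 (V *m u i *m V^t*) = \sum_i hs2 (g i).
  by apply: eq_bigr => i _; rewrite gE hs2_unitary_conj// cE.
(* Deleting the basis vector a removes row a and column a of every g_i. Their mass is at most
   [nu a], in which the diagonal entry is counted twice. *)
apply: (@le_trans _ _ (\sum_i (hs2 (row' a W *m u i *m (row' a W)^t*)) + nu a)); last first.
  by rewrite -(natr1 m) mulrDr mulr1 lerD.
rewrite -big_split /=; apply: ler_sum => i _.
have -> : hs2 (row' a W *m u i *m (row' a W)^t*) =
    \sum_b \sum_b' rnorm (g i (lift a b) (lift a b')) ^+ 2.
  rewrite hs2.unlock; apply: eq_bigr => b _; apply: eq_bigr => b' _; congr (rnorm _ ^+ 2).
  rewrite gW !mxE; apply: eq_bigr => x _; rewrite !mxE; congr (_ * _).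
  by apply: eq_bigr => y _; rewrite !mxE.
rewrite hs2.unlock (bigD1_ord a)//=.
rewrite [X in _ + X <= _](eq_bigr (fun b => rnorm (g i (lift a b) a) ^+ 2 +
  \sum_b' rnorm (g i (lift a b) (lift a b')) ^+ 2)) => [|b _]; last by rewrite (bigD1_ord a).
rewrite big_split /=.
have : \sum_(b < m) rnorm (g i (lift a b) a) ^+ 2 <= \sum_b rnorm (g i b a) ^+ 2.
  by rewrite [leRHS](bigD1_ord a)//= lerDr sqr_ge0.
move: (\sum_(b < m) rnorm (g i (lift a b) a) ^+ 2) (\sum_b rnorm (g i b a) ^+ 2).
move: (\sum_j rnorm (g i a j) ^+ 2) (\sum_b \sum_b' _) => x y z t.
by clear; lra.
Qed.

End ThinCorners.

(** * Approximate intertwiners *)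

Section LayerCake.
Variables (R : realType) (I : finType).

(** The kernel min(l a, l b) is a superposition of indicators of B x B over the superlevel sets B of
    l. The induction peels off one layer: the least positive value t of l is subtracted on the
    support A, which then loses a point. *)
Lemma layer_cake (l : I -> R) (C : I -> I -> R) (K : R) :
  (forall a, 0 <= l a) ->
  (forall B : {set I}, \sum_(a in B) \sum_(b in B) C a b <= K * #|B|%:R) ->
  \sum_a \sum_b Num.min (l a) (l b) * C a b <= K * \sum_a l a.
Proof.
move=> l0 CK; have [m] := ubnP #|[set a | 0 < l a]%SET|.
elim: m => // m ih in l l0 *; rewrite ltnS => lm.
set A := [set a | 0 < l a]%SET in lm.
have [A0|[a0 a0A]] := set_0Vmem A.
  have lz a : l a = 0.
    apply/eqP; rewrite eq_le l0 andbT leNgt; apply/negP => la.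
    by move/finset.setP: A0 => /(_ a); rewrite !inE la.
  rewrite [X in _ <= _ * X]big1 ?mulr0 => [|a _]; last exact: lz.
  rewrite big1 // => a _.
  by rewrite big1// => b _; rewrite !lz minxx mul0r.
pose am := [arg min_(a < a0 | a \in A) l a]%O.
have [amA amin] : am \in A /\ forall a, a \in A -> l am <= l a.
  by rewrite /am; case: arg_minP => // i iA h; split.
pose t := l am; have t0 : 0 < t by move: amA; rewrite inE.
pose l' a := if a \in A then l a - t else 0.
have lE a : l a = l' a + (if a \in A then t else 0).
  rewrite /l'; case: ifP => aA; first by rewrite subrK.
  rewrite addr0; apply/eqP; rewrite eq_le l0 andbT leNgt; apply/negP => la.
  by rewrite inE la in aA.
have l'0 a : 0 <= l' a by rewrite /l'; case: ifP => // aA; rewrite subr_ge0 amin.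
have minE a b : Num.min (l a) (l b) = Num.min (l' a) (l' b) +
    (if a \in A then if b \in A then t else 0 else 0).
  rewrite (lE a) (lE b); case: ifP => aA; case: ifP => bA.
  - by rewrite addr_minl.
  - by rewrite !addr0 [l' b]/l' bA !min_r ?addr_ge0// ltW.
  - by rewrite !addr0 [l' a]/l' aA !min_l ?addr_ge0// ltW.
  - by rewrite !addr0.
have ihl : \sum_a \sum_b Num.min (l' a) (l' b) * C a b <= K * \sum_a l' a.
  apply: ih => //; apply: leq_trans lm; apply: proper_card; apply/properP; split.
    apply/fintype.subsetP => a; rewrite !inE /l'; case: ifP; last by rewrite ltxx.
    by rewrite inE.
  by exists am => //; rewrite inE /l' amA subrr ltxx.
have -> : \sum_a l a = \sum_a l' a + t * #|A|%:R.
  rewrite (eq_bigr _ (fun a _ => lE a)) big_split /=; congr (_ + _).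
  by rewrite -big_mkcond /= sumr_const mulr_natr.
have -> : \sum_a \sum_b Num.min (l a) (l b) * C a b =
    \sum_a \sum_b Num.min (l' a) (l' b) * C a b + t * \sum_(a in A) \sum_(b in A) C a b.
  rewrite mulr_sumr [X in _ + X]big_mkcond -big_split; apply: eq_bigr => a _ /=.
  rewrite (eq_bigr (fun b => Num.min (l' a) (l' b) * C a b +
    (if a \in A then if b \in A then t * C a b else 0 else 0))).
    rewrite big_split /=; congr (_ + _); case: ifP => _; last by rewrite big1.
    by rewrite -big_mkcond /= mulr_sumr.
  by move=> b _; rewrite minE mulrDl; case: ifP => _; [case: ifP|]; rewrite // mul0r.
by rewrite mulrDr lerD// mulrCA ler_pM2l.
Qed.

(* [sqrt (l a * l b)] is estimated by the weighted AM-GM inequality with weight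
   11/10 between the minimum and the maximum of [l a] and [l b]. *)
Lemma geometric_mean_form (s : I -> R) (C : I -> I -> R) (k : R) :
  0 <= k -> (forall a, 0 <= s a) -> (forall a b, 0 <= C a b) ->
  (forall a, \sum_b C a b <= k) -> (forall b, \sum_a C a b <= k) ->
  (forall B : {set I}, \sum_(a in B) \sum_(b in B) C a b <= k * (9 / 10) * #|B|%:R) ->
  \sum_a \sum_b s a * s b * C a b <= k * (199 / 200) * \sum_a s a ^+ 2.
Proof.
move=> k0 s0 C0 Crow Ccol CB.
have cake := @layer_cake (fun a => s a ^+ 2) C _ (fun a => sqr_ge0 (s a)) CB.
set L := \sum_a s a ^+ 2.
(* For z <= w the weighted inequality is zw <= (11/20) z^2 + (5/11) w^2, and 21/220 = 11/20 - 5/11.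
   The final factor is (21/220)(9/10) + 10/11 = 199/200. *)
have hs a b : s a * s b <= (21 / 220) * Num.min (s a ^+ 2) (s b ^+ 2) +
    5 / 11 * (s a ^+ 2 + s b ^+ 2).
  have sq : (s a <= s b) = (s a ^+ 2 <= s b ^+ 2) by rewrite ler_sqr ?nnegrE.
  move: (s0 a) (s0 b) sq; move: (s a) (s b) => x y x0 y0 sq.
  have h z w : (z : R) * w <= (21 / 220) * z ^+ 2 + 5 / 11 * (z ^+ 2 + w ^+ 2).
    by have := sqr_ge0 (11 * z - 10 * w); rewrite sqrrB; clear; nra.
  case: (leP x y) => xy.
    by rewrite min_l -?sq.
  have := h y x; rewrite min_r; last by rewrite ler_sqr ?nnegrE// ltW.
  by rewrite mulrC [y ^+ 2 + _]addrC.
apply: (@le_trans _ _ (\sum_a \sum_b ((21 / 220) * (Num.min (s a ^+ 2) (s b ^+ 2) * C a b) +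
   5 / 11 * (s a ^+ 2 * C a b + s b ^+ 2 * C a b)))).
  apply: ler_sum => a _; apply: ler_sum => b _.
  apply: (le_trans (ler_wpM2r (C0 a b) (hs a b))).
  by rewrite le_eqVlt; apply/orP; left; apply/eqP; ring.
have r1 : \sum_a \sum_b s a ^+ 2 * C a b <= k * L.
  rewrite mulr_sumr; apply: ler_sum => a _; rewrite -mulr_sumr mulrC.
  by rewrite ler_wpM2r ?sqr_ge0.
have r2 : \sum_a \sum_b s b ^+ 2 * C a b <= k * L.
  rewrite exchange_big mulr_sumr; apply: ler_sum => a _; rewrite -mulr_sumr mulrC.
  by rewrite ler_wpM2r ?sqr_ge0.
under eq_bigr => a _ do rewrite big_split /= -2!mulr_sumr big_split /=.
rewrite big_split /= -2!mulr_sumr big_split /=.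
move: cake r1 r2; rewrite -/L mulrAC [k * (199 / 200) * L]mulrAC.
move: (\sum_a \sum_b _) (\sum_a \sum_b _) (\sum_a \sum_b _) (k * L) => x y z w.
by clear; lra.
Qed.

End LayerCake.

(** * Completely positive models in matrix algebras *)

Section Model.
Variable R : realType.
Local Notation C := R[i].

(** In an eigenbasis P of X X^* the rows of P X are orthogonal. Only the nonzero rows are kept, so
    that they can be normalized to form V; their number m is the rank. *)
Lemma svd d n (X : 'M[C]_(d, n)) : exists (m : nat) (Q : 'M[C]_(m, d))
    (V : 'M[C]_(m, n)) (s : 'I_m -> R),
  [/\ (m <= d)%N, Q \is unitarymx, V \is unitarymx, (forall a, 0 <= s a) &
    X = Q^t* *m diag_mx (\row_a (s a)%:C) *m V].
Proof.
have Gh : (X *m X^t*)^t* = X *m X^t* by rewrite adjmxM trmxCK.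
have [P [l [PU hd]]] := hermitian_diag Gh.
pose Y := P *m X; have YY : Y *m Y^t* = diag_mx (\row_a l a).
  by rewrite -hd /Y adjmxM !mulmxA.
have YX : X = P^t* *m Y by rewrite /Y mulmxA unitary_adjK// mul1mx.
pose r a := \sum_b rnorm (Y a b) ^+ 2.
have r0 a : 0 <= r a by rewrite sumr_ge0// => b _; rewrite sqr_ge0.
have rE a b : (Y *m Y^t*) a b = if a == b then (r a)%:C else 0.
  case: eqP => [<-|/eqP ab]; first exact: mulmxadjE.
  by rewrite YY !mxE (negbTE ab).
pose S := [set a | r a != 0]%SET; pose f := @enum_val _ (mem S).
pose s a := Num.sqrt (r (f a)).
have s0 a : 0 < s a.
  have := enum_valP a; rewrite inE => ra.
  by rewrite sqrtr_gt0 lt_def ra r0.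
pose V : 'M[C]_(#|S|, n) := \matrix_(a, b) ((s a)^-1%:C * Y (f a) b).
exists #|S|, (rowsub f P), V, s; split.
- by rewrite -[X in (_ <= X)%N]card_ord max_card.
- exact: rowsub_unitary (@enum_val_inj _ _) PU.
- apply/unitarymxP/matrixP => a b.
  have -> : (V *m V^t*) a b = (s a)^-1%:C * (s b)^-1%:C * (Y *m Y^t*) (f a) (f b).
    rewrite !mxE mulr_sumr; apply: eq_bigr => x _; rewrite !mxE rmorphM /=.
    have -> : ((s b)^-1%:C : C)^*%R = (s b)^-1%:C.
      by apply/CrealP; rewrite ger0_real// ler0c invr_ge0 ltW.
    by rewrite mulrACA.
  rewrite rE (inj_eq (@enum_val_inj _ _)) !mxE; case: eqP => [<-|_]; last by rewrite mulr0.
  rewrite -!rmorphM /= -invfM -expr2 [s a ^+ 2]sqr_sqrtr// mulVf//.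
  by have := enum_valP a; rewrite inE.
- by move=> a; exact: ltW.
- rewrite {1}YX; apply/matrixP => i j.
  rewrite [LHS]mxE mul_mx_diag [RHS]mxE.
  rewrite (eq_bigr (fun a => if a \in S then P^t* i a * Y a j else 0)) => [|a _].
    rewrite -big_mkcond big_enum_val; apply: eq_bigr => a _; rewrite !mxE.
    by rewrite mulrA -[_ * (s a)%:C * _]mulrA -rmorphM /= mulfV ?gt_eqF// mulr1.
  case: ifP => // /negbT; rewrite inE negbK => /eqP ra.
  suff -> : Y a j = 0 by rewrite mulr0.
  apply: rnorm0_eq0; apply/eqP; rewrite -sqrf_eq0; apply/eqP.
  by have /psumr_eq0P := ra; apply => // b _; rewrite sqr_ge0.
Qed.

Lemma Re_sum (I : Type) (r : seq I) (P : pred I) (F : I -> C) :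
  complex.Re (\sum_(i <- r | P i) F i) = \sum_(i <- r | P i) complex.Re (F i).
Proof. exact: raddf_sum. Qed.

Lemma tr_sum n (I : Type) (r : seq I) (P : pred I) (F : I -> 'M[C]_n) :
  \tr (\sum_(i <- r | P i) F i) = \sum_(i <- r | P i) \tr (F i).
Proof. exact: raddf_sum. Qed.

(** In singular bases of X the trace is a sum of products of entries of the corners x_i and y_i of
    u_i and v_i, weighted by s_a s_b. By AM-GM it is at most half the sum of the two weighted
    masses. The mass of the x_i is at most 199k/200 of [hs2 X] by thinness, since at most d <= n/4
    singular values occur; that of the y_i is at most k, by contractivity. *)
Lemma thin_intertwiner_bound k d n (u : 'I_k -> 'M[C]_n) (v : 'I_k -> 'M[C]_d)
    (X : 'M[C]_(d, n)) :
  (forall i, opnorm (u i) <= 1) -> (forall i, opnorm (v i) <= 1) ->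
  expands_thin u -> (4 * d <= n)%N ->
  \sum_i complex.Re (\tr (v i *m (X *m (u i)^t* *m X^t*))) <= k%:R * (399 / 400) * hs2 X.
Proof.
move=> u1 v1 uexp dn.
have [m [Q [V [s [md QU VU s0 XE]]]]] := svd X.
set D := diag_mx _ in XE.
have DD : D^t* = D.
  rewrite tr_diag_mx map_diag_mx; congr diag_mx; apply/rowP => a; rewrite !mxE.
  by apply/CrealP; rewrite ger0_real// ler0c.
have hsX : hs2 X = \sum_a s a ^+ 2.
  rewrite XE hs2_isor// hs2_isol; last by rewrite trmxCK; exact/unitarymxP.
  rewrite hs2.unlock; apply: eq_bigr => a _; rewrite (bigD1 a)//= big1 => [|b ba].
    by rewrite !mxE eqxx mulr1n rnormC ger0_norm// addr0.
  by rewrite !mxE eq_sym (negbTE ba) mulr0n rnorm0 expr0n.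
have [x xE] : exists x, forall i, x i = V *m u i *m V^t* by eexists.
have [y yE] : exists y, forall i, y i = Q *m v i *m Q^t* by eexists.
have trE i : \tr (v i *m (X *m (u i)^t* *m X^t*)) =
    \sum_a \sum_b y i a b * (s b)%:C * (x i a b)^*%R * (s a)%:C.
  have -> : \tr (v i *m (X *m (u i)^t* *m X^t*)) = \tr (y i *m (D *m (x i)^t* *m D)).
    have -> : X *m (u i)^t* *m X^t* = Q^t* *m (D *m (x i)^t* *m D) *m Q.
      by rewrite XE xE !adjmxM !trmxCK DD !mulmxA.
    by rewrite yE !mulmxA mxtrace_mulC !mulmxA.
  rewrite /mxtrace; apply: eq_bigr => a _; rewrite [LHS]mxE; apply: eq_bigr => b _.
  by rewrite -!mulrA; congr (_ * _); rewrite mul_diag_mx mul_mx_diag !mxE mulrA.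
have x1 i : opnorm (x i) <= 1 by rewrite xE; exact: le_trans (opnorm_compress _ VU) (u1 i).
have y1 i : opnorm (y i) <= 1 by rewrite yE; exact: le_trans (opnorm_compress _ QU) (v1 i).
have contr_row (A : 'M[C]_m) b : opnorm A <= 1 -> \sum_a rnorm (A a b) ^+ 2 <= 1.
  by move=> A1; apply: (le_trans (col_sqr_le_opnorm A b)); rewrite expr_le1 ?opnorm_ge0.
have contr_col (A : 'M[C]_m) a : opnorm A <= 1 -> \sum_b rnorm (A a b) ^+ 2 <= 1.
  by move=> A1; apply: (le_trans (row_sqr_le_opnorm A a)); rewrite expr_le1 ?opnorm_ge0.
pose c a b := \sum_i rnorm (x i a b) ^+ 2.
pose c' a b := \sum_i rnorm (y i a b) ^+ 2.
have bound (z : 'I_k -> 'M[C]_m) : (forall i, opnorm (z i) <= 1) ->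
    (forall a, \sum_b \sum_i rnorm (z i a b) ^+ 2 <= k%:R) /\
    (forall b, \sum_a \sum_i rnorm (z i a b) ^+ 2 <= k%:R).
  move=> z1; split=> a; rewrite exchange_big /=; apply: (@le_trans _ _ (\sum_(i < k) 1)).
  - by apply: ler_sum => i _; exact: contr_col.
  - by rewrite sumr_const card_ord.
  - by apply: ler_sum => i _; exact: contr_row.
  - by rewrite sumr_const card_ord.
have [xr xc] := bound x x1; have [yr yc] := bound y y1.
have gx : \sum_a \sum_b s a * s b * c a b <= k%:R * (199 / 200) * hs2 X.
  rewrite hsX; apply: geometric_mean_form => // [a b|B].
    by rewrite sumr_ge0// => i _; rewrite sqr_ge0.
  have VB := rowsub_unitary (@enum_val_inj _ (mem B)) VU.
  have Bn : (4 * #|B| <= n)%N.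
    apply: leq_trans dn; rewrite leq_mul2l /=; apply: leq_trans md.
    by rewrite -[X in (_ <= X)%N]card_ord max_card.
  apply: le_trans (thin_contraction u1 uexp Bn VB); rewrite le_eqVlt; apply/orP; left; apply/eqP.
  under [RHS]eq_bigr => i _ do rewrite hs2_compress_set -xE.
  rewrite [RHS]exchange_big; apply: eq_bigr => a _.
  by rewrite [RHS]exchange_big.
have gy : \sum_a \sum_b s a * s b * c' a b <= k%:R * hs2 X.
  apply: (@le_trans _ _ (\sum_a \sum_b (1 / 2 * (s a ^+ 2 * c' a b) + 1 / 2 * (s b ^+ 2 * c' a b)))).
    apply: ler_sum => a _; apply: ler_sum => b _; rewrite -mulrDr -mulrDl mulrA.
    apply: ler_wpM2r; first by rewrite sumr_ge0// => i _; rewrite sqr_ge0.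
    by have := sqr_ge0 (s a - s b); rewrite sqrrB; clear; lra.
  under eq_bigr => a _ do rewrite big_split.
  rewrite big_split /= hsX; have -> : k%:R * \sum_a s a ^+ 2 =
    1 / 2 * (k%:R * \sum_a s a ^+ 2) + 1 / 2 * (k%:R * \sum_a s a ^+ 2) by clear; lra.
  have half : 0 < 1 / 2 :> R by rewrite divr_gt0.
  apply: lerD.
    rewrite !mulr_sumr; apply: ler_sum => a _; rewrite -!mulr_sumr (ler_pM2l half) mulrC.
    by apply: ler_wpM2r (yr a); rewrite sqr_ge0.
  rewrite exchange_big !mulr_sumr; apply: ler_sum => a _; rewrite -!mulr_sumr (ler_pM2l half) mulrC.
  by apply: ler_wpM2r (yc a); rewrite sqr_ge0.
apply: (@le_trans _ _ (1 / 2 * (\sum_a \sum_b s a * s b * c a b) +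
    1 / 2 * (\sum_a \sum_b s a * s b * c' a b))); last first.
  by move: gx gy; move: (\sum_a _) (\sum_a _) (hs2 X) => z w h; clear; lra.
rewrite !mulr_sumr -big_split /=.
under eq_bigr => i _ do rewrite trE Re_sum.
rewrite exchange_big; apply: ler_sum => a _; rewrite !mulr_sumr -big_split /=.
under eq_bigr => i _ do rewrite Re_sum.
rewrite exchange_big; apply: ler_sum => b _ /=.
rewrite /c /c' !mulr_sumr -big_split /=; apply: ler_sum => i _.
apply: (le_trans (Re_le_rnorm _)); rewrite !rnormM rnorm_conj !rnormC !ger0_norm//.
move: (rnorm (x i a b)) (rnorm (y i a b)) => X1 Y1.
have := mulr_ge0 (mulr_ge0 (s0 a) (s0 b)) (sqr_ge0 (X1 - Y1)).
move: (s a) (s b) => p q h; rewrite -subr_ge0.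
have -> : 1 / 2 * (p * q * X1 ^+ 2) + 1 / 2 * (p * q * Y1 ^+ 2) - Y1 * q * X1 * p =
  1 / 2 * (p * q * (X1 - Y1) ^+ 2) by field.
by rewrite mulr_ge0 ?divr_ge0.
Qed.

Definition kraus d n (b : 'I_d -> 'I_d -> 'M[C]_n) (m : 'M[C]_d) : 'M[C]_n :=
  \sum_r \sum_j \sum_l m j l *: ((b r j)^t* *m b r l).

(** Expanding b_rj^* b_rl over the rows s of the factors shows that [kraus b m] is the sum of the
    X^* m X, where X, for given r and s, collects the s-th rows of the b_rj. This passes to d x n
    matrices, to which the bound for thin intertwiners applies. *)
Lemma kraus_trace d n (b : 'I_d -> 'I_d -> 'M[C]_n) (m : 'M[C]_d) (A : 'M[C]_n) :
  \tr (A *m kraus b m) = \sum_r \sum_s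
    let X : 'M[C]_(d, n) := \matrix_(j, t) b r j s t in \tr (m *m (X *m A *m X^t*)).
Proof.
rewrite /kraus mulmx_sumr tr_sum; apply: eq_bigr => r _ /=.
rewrite mulmx_sumr tr_sum [RHS]exchange_big /=; apply: eq_bigr => j _.
rewrite mulmx_sumr tr_sum /=.
transitivity (\sum_s \sum_l m j l * ((\matrix_(j, t) b r j s t : 'M[C]_(d, n)) *m A *m
   (\matrix_(j, t) b r j s t : 'M[C]_(d, n))^t*) l j); last first.
  by apply: eq_bigr => s _; rewrite [RHS]mxE.
rewrite [RHS]exchange_big /=; apply: eq_bigr => l _.
rewrite -scalemxAr linearZ /= -mulr_sumr; congr (_ * _).
rewrite mulmxA mxtrace_mulC mulmxA; apply: eq_bigr => s _.
rewrite [LHS]mxE [RHS]mxE; apply: eq_bigr => t _.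
rewrite [LHS in LHS * _]mxE !mxE; congr (_ * _).
by apply: eq_bigr => t' _; rewrite !mxE.
Qed.

Lemma opnormN n (A : 'M[C]_n) : opnorm (- A) = opnorm A.
Proof. exact: (@rnormN R (matalg R n) A). Qed.

(** The real part of tr(u_i^* [kraus b (v i)]) is at least n (1 - 2t), as the model is close to u_i
    and u_i^* u_i to 1. Its mean over i is at most (399/400) n (1 + t), because the matrices X have
    total mass at most n (1 + t). At t = 1/2000 this reads 0.999 <= 0.998. *)
Lemma no_small_model k d n (u : 'I_k -> 'M[C]_n) (v : 'I_k -> 'M[C]_d)
    (b : 'I_d -> 'I_d -> 'M[C]_n) (t : R) :
  (0 < k)%N -> (0 < n)%N -> t = 2000^-1 ->
  (forall i, opnorm (u i) <= 1) -> (forall i, opnorm (v i) <= 1) ->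
  expands_thin u -> (4 * d <= n)%N ->
  (forall i, opnorm ((u i)^t* *m u i - 1%:M) <= t) ->
  (forall i, opnorm (kraus b (v i) - u i) <= t) ->
  ~ opnorm (kraus b 1%:M) <= 1 + t.
Proof.
move=> k0 n0 tE u1 v1 uexp dn uu uk b1.
pose X r s : 'M[C]_(d, n) := \matrix_(j, t) b r j s t.
have mass : \sum_r \sum_s hs2 (X r s) <= n%:R * (1 + t).
  apply: (@le_trans _ _ (n%:R * opnorm (kraus b 1%:M))); last first.
    by rewrite ler_wpM2l.
  apply: le_trans (Re_trace_le _); rewrite -[kraus b 1%:M]mul1mx kraus_trace Re_sum.
  apply: ler_sum => r _; rewrite Re_sum; apply: ler_sum => s _.
  by rewrite /= mulmx1 mul1mx -hs2E.
have low i : n%:R * (1 - 2 * t) <= complex.Re (\tr ((u i)^t* *m kraus b (v i))).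
  have e : (u i)^t* *m kraus b (v i) = 1%:M -
      ((1%:M - (u i)^t* *m u i) + (u i)^t* *m (u i - kraus b (v i))).
    by rewrite mulmxBr addrA subrK opprB addrC subrK.
  rewrite e linearB /= mxtrace1 raddfB /=.
  have -> : complex.Re (n%:R : C) = n%:R by rewrite -(rmorph_nat (real_complex R)).
  have -> : n%:R * (1 - 2 * t) = n%:R - n%:R * (t + t) by clear; ring.
  rewrite lerD2l lerN2; apply: (le_trans (Re_trace_le _)); rewrite ler_wpM2l//.
  apply: (le_trans (opnormD _ _)); apply: lerD.
    by rewrite -opprB opnormN.
  apply: (le_trans (opnormM _ _)); rewrite -[leRHS]mul1r; apply: ler_pM; rewrite ?opnorm_ge0//.
    by rewrite (opnorm_adj (u i)).
  by rewrite -opprB opnormN.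
have up : \sum_i complex.Re (\tr ((u i)^t* *m kraus b (v i))) <=
    k%:R * (399 / 400) * (n%:R * (1 + t)).
  apply: (@le_trans _ _ (k%:R * (399 / 400) * \sum_r \sum_s hs2 (X r s))); last first.
    by rewrite ler_wpM2l// mulr_ge0// divr_ge0.
  under eq_bigr => i _ do rewrite kraus_trace Re_sum.
  rewrite exchange_big mulr_sumr; apply: ler_sum => r _ /=.
  under eq_bigr => i _ do rewrite Re_sum.
  rewrite exchange_big mulr_sumr; apply: ler_sum => s _ /=.
  exact: thin_intertwiner_bound.
have : k%:R * (n%:R * (1 - 2 * t)) <= k%:R * (399 / 400) * (n%:R * (1 + t)).
  apply: le_trans up; rewrite mulr_natl -[X in _ *+ X]card_ord -sumr_const.
  by apply: ler_sum => i _; exact: low.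
have k0R : 0 < k%:R :> R by rewrite ltr0n.
have n0R : 0 < n%:R :> R by rewrite ltr0n.
rewrite -mulrA ler_pM2l// mulrCA ler_pM2l// tE.
by clear; lra.
Qed.

End Model.

(** * Continuous logic and the theorem of Los *)

Section Boundedness.
Variable R : realType.

Lemma vcons_ball (A : cstarAlgType R) n (a : A) (v : 'I_n -> A) (r : R) :
  rnorm a <= r -> (forall i, rnorm (v i) <= r) -> forall i, rnorm (vcons a v i) <= r.
Proof. by move=> ar vr i; rewrite /vcons; case: unlift. Qed.

Lemma teval_bounded n (t : cterm R false n) (r : R) : exists2 K : R, 0 <= K &
  forall (A : cstarAlgType R) (v : 'I_n -> A), (forall i, rnorm (v i) <= r) ->
    rnorm (teval v t) <= K.
Proof.
elim: t => [i||//|s [K K0 sK] t [L L0 tL]|s [K K0 sK] t [L L0 tL]|t [L L0 tL]|c t [L L0 tL]].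
- exists (Num.max 0 r); first by rewrite le_max lexx.
  by move=> A v vr /=; rewrite le_max vr orbT.
- by exists 0 => // A v vr /=; rewrite rnorm0.
- exists (K + L); first by rewrite addr_ge0.
  move=> A v vr /=; apply: (le_trans (rnormD _ _)); apply: lerD; [exact: sK|exact: tL].
- exists (K * L); first by rewrite mulr_ge0.
  move=> A v vr /=; apply: (le_trans (rnorm_cmul _ _)).
  by apply: ler_pM; rewrite ?rnorm_ge0 ?sK ?tL.
- by exists L => // A v vr /=; rewrite rnorm_adj tL.
- exists (rnorm c * L); first by rewrite mulr_ge0 ?rnorm_ge0.
  by move=> A v vr /=; rewrite rnormZ ler_wpM2l ?rnorm_ge0 ?tL.
Qed.

Lemma continuous_bounded k (f : 'rV[R]_k -> R) (K : R) : continuous f ->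
  exists M : R, forall x : 'rV_k, (forall i, `|x 0 i| <= K) -> `|f x| <= M.
Proof.
move=> fc; pose B := [set x : 'rV[R]_k | forall i, `[- K, K]%classic (x 0 i)].
have cB : compact B by apply: (@rV_compact R k (fun=> `[- K, K]%classic)) => i; exact: segment_compact.
have := continuous_compact (continuous_subspaceT fc) cB => /compact_bounded[M [_ hM]].
exists (M + 1) => x xK; apply: (hM (M + 1)); first by rewrite ltrDl.
by exists x => // i /=; rewrite in_itv /= -ler_norml.
Qed.

(** A real [sup] has the order properties of a supremum only on bounded sets, so every use of a
    quantifier rests on this bound. It is stated for all radii r because a quantifier adds a
    variable with a radius of its own. *)
Lemma feval_bounded n (phi : cformula R false n) (r : R) : exists K : R,
  forall (A : cstarAlgType R) (v : 'I_n -> A), (forall i, rnorm (v i) <= r) ->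
    `|feval phi v| <= K.
Proof.
elim: phi r => {n} [n s t|n k f fc psi ih|n q psi ih|n q psi ih] r.
- have [K K0 sK] := teval_bounded s r; have [L L0 tL] := teval_bounded t r.
  exists (K + L) => A v vr /=; rewrite ger0_norm ?rnorm_ge0//.
  by apply: (le_trans (rnormD _ _)); rewrite rnormN lerD ?sK ?tL.
- have /choice[K hK] i := ih i r.
  have [M hM] := continuous_bounded (\sum_i `|K i|) fc.
  exists M => A v vr /=; apply: hM => i; rewrite mxE.
  apply: (le_trans (hK i A v vr)); apply: (le_trans (ler_norm _)).
  by rewrite (bigD1 i)//= lerDl sumr_ge0.
- have [K hK] := ih (Num.max q%:R r); exists K => A v vr /=.
  have h a : cball (A:=A) q a -> `|feval psi (vcons a v)| <= K.
    move=> aq; apply: hK; apply: vcons_ball => [|i]; rewrite le_max ?vr ?orbT//.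
    by rewrite aq.
  have z : cball (A:=A) q 0 by rewrite /cball /= rnorm0.
  rewrite ler_norml; apply/andP; split.
    apply: (@le_trans _ _ (feval psi (vcons 0 v))).
      by have := h _ z; rewrite ler_norml => /andP[].
    apply: ub_le_sup; last by exists 0.
    by exists K => _ [a /h] /[swap] <-; rewrite ler_norml => /andP[].
  apply: ge_sup; first by exists (feval psi (vcons 0 v)), 0.
  by move=> _ [a /h] /[swap] <-; rewrite ler_norml => /andP[].
- have [K hK] := ih (Num.max q%:R r); exists K => A v vr /=.
  have h a : cball (A:=A) q a -> `|feval psi (vcons a v)| <= K.
    move=> aq; apply: hK; apply: vcons_ball => [|i]; rewrite le_max ?vr ?orbT//.
    by rewrite aq.
  have z : cball (A:=A) q 0 by rewrite /cball /= rnorm0.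
  rewrite ler_norml; apply/andP; split; last first.
    apply: (@le_trans _ _ (feval psi (vcons 0 v))); last first.
      by have := h _ z; rewrite ler_norml => /andP[].
    apply: ge_inf; last by exists 0.
    by exists (- K) => _ [a /h] /[swap] <-; rewrite ler_norml => /andP[].
  apply: lb_le_inf; first by exists (feval psi (vcons 0 v)), 0.
  by move=> _ [a /h] /[swap] <-; rewrite ler_norml => /andP[].
Qed.

End Boundedness.

Section Quantifiers.
Variables (R : realType) (A : cstarAlgType R).

Lemma fin_bounded n (v : 'I_n -> A) : exists r : R, forall i, rnorm (v i) <= r.
Proof.
exists (\sum_i rnorm (v i)) => i.
by rewrite (bigD1 i)//= lerDl sumr_ge0// => j _; exact: rnorm_ge0.
Qed.

Lemma feval_sup_ge n r (psi : cformula R false n.+1) (v : 'I_n -> A) a :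
  rnorm a <= r%:R -> feval psi (vcons a v) <= feval (FSup r psi) v.
Proof.
move=> ar; have [q vq] := fin_bounded v.
have [K hK] := feval_bounded psi (Num.max r%:R q).
apply: ub_le_sup; last by exists a.
exists K => _ [b br <-]; apply: (le_trans (ler_norm _)); apply: hK.
by apply: vcons_ball => [|i]; rewrite le_max ?vq ?orbT// br.
Qed.

Lemma feval_sup_gt n r (psi : cformula R false n.+1) (v : 'I_n -> A) c :
  c < feval (FSup r psi) v -> exists2 a, rnorm a <= r%:R & c < feval psi (vcons a v).
Proof.
move=> /sup_gt; case; first by exists (feval psi (vcons 0 v)), 0; rewrite // /cball /= rnorm0.
by move=> _ [a ar <-]; exists a.
Qed.

End Quantifiers.

Section Negation.
Variables (R : realType) (u : bool).

Lemma negation_continuous : continuous (fun x : 'rV[R]_1 => - x 0 0).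
Proof. by move=> x; exact: (cvgN (@coord_continuous R 1 1 0 0 x)). Qed.

Definition FNeg n (phi : cformula R u n) := FConn negation_continuous (fun=> phi).

Lemma feval_neg (A : cstarAlgType R) n (phi : cformula R u n) (v : 'I_n -> A) :
  feval (FNeg phi) v = - feval phi v.
Proof. by rewrite /= mxE. Qed.

Lemma feval_inf_neg (A : cstarAlgType R) n r (psi : cformula R u n.+1) (v : 'I_n -> A) :
  feval (FInf r psi) v = - feval (FSup r (FNeg psi)) v.
Proof.
rewrite /= /inf; congr (- sup _); rewrite eqEsubset; split => x /=.
  by move=> [_ [a ar <-] <-]; exists a; rewrite // mxE.
by move=> [a ar]; rewrite mxE => <-; exists (feval psi (vcons a v)) => //; exists a.
Qed.

End Negation.

(** * Transfer of formulas to the ultraproduct *)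

Section Los.
Variables (R : realType) (U : set_system nat) (UU : UltraFilter U).
Variable A : nat -> cstarAlgType R.
Local Notation P := (cprod A).
Local Notation ulim := (ultraproduct UU A : cstarAlgType R).

Lemma teval_ucls n (t : cterm R false n) (a : 'I_n -> P) :
  teval (fun i => ucls UU (a i) : ulim) t = ucls UU (teval a t).
Proof.
elim: t => [i||//|s ihs t iht|s ihs t iht|t iht|c t iht] //=.
- exact/esym/raddf0.
- by rewrite ihs iht uclsD.
- by rewrite ihs iht; exact: ucls_mul.
- by rewrite iht; exact: ucls_adj.
- by rewrite iht; exact: ucls_scale.
Qed.

Lemma teval_coord n (t : cterm R false n) (a : 'I_n -> P) k :
  teval (fun i => a i k) t = cprod_val (teval a t) k.
Proof.
elim: t => [i||//|s ihs t iht|s ihs t iht|t iht|c t iht] //=.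
- by rewrite ihs iht.
- by rewrite ihs iht.
- by rewrite iht.
- by rewrite iht.
Qed.

(** The norms of a representative exceed r by an amount that vanishes along U. Rescaling the
    coordinates that are too long therefore changes the sequence by a null sequence. *)
Lemma ucls_ball_lift (x : ulim) (r : R) : 0 <= r -> rnorm x <= r ->
  exists2 b : P, ucls UU b = x & forall k, rnorm (b k) <= r.
Proof.
move=> r0 xr; pose b := urepr x.
pose c k := if rnorm (b k) <= r then b k else (r / rnorm (b k))%:C *: b k.
have cr k : rnorm (c k) <= r.
  rewrite /c; have [//|rb] := leP (rnorm (b k)) r; have b0 := le_lt_trans r0 rb.
  by rewrite rnormZ rnormC ger0_norm ?divr_ge0 ?rnorm_ge0// mulfVK// gt_eqF.
have cb : bounded_seq c by exists r.
exists (CProd cb) => //; rewrite -[x]ureprK; apply/ucls_eq/null_idealP => e e0.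
have := unorm_nearU UU b e0; apply: filterS => k.
rewrite /b ureprK -/b -ultraproduct_normE => bk.
rewrite /= /c; have [rb|rb] := leP (rnorm (b k)) r; first by rewrite subrr rnorm0.
have b0 := le_lt_trans r0 rb.
rewrite -[X in _ - X]scale1r -scalerBl rnormZ -(rmorphB (real_complex R)) rnormC.
have -> : `|r / rnorm (b k) - 1| = 1 - r / rnorm (b k).
  rewrite distrC ger0_norm// subr_ge0 ler_pdivrMr// mul1r; exact: ltW.
rewrite mulrBl mul1r mulfVK ?gt_eqF//; clear -bk xr; lra.
Qed.

Definition los n (phi : cformula R false n) := forall a : 'I_n -> P,
  (fun k => feval phi (fun i => a i k)) @ U
    --> feval phi (fun i => ucls UU (a i) : ulim).

Lemma los_sup n r (psi : cformula R false n.+1) : los psi -> los (FSup r psi).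
Proof.
move=> ih a; set va := fun i => ucls UU (a i) : ulim.
set L := feval (FSup r psi) va.
have vlift (b : P) : (fun k => feval psi (vcons (b k) (fun i => a i k))) @ U
    --> feval psi (vcons (ucls UU b : ulim) va).
  have := ih (vcons b a); rewrite /va.
  have -> : vcons (ucls UU b : ulim) (fun i => ucls UU (a i) : ulim)
      = (fun i => ucls UU (vcons b a i) : ulim).
    by apply/funext => i; rewrite /vcons; case: unlift.
  suff -> : (fun k => feval psi (vcons (b k) (fun i => a i k)))
      = (fun k => feval psi (fun i => vcons b a i k)) by [].
  by apply/funext => k; congr feval; apply/funext => i; rewrite /vcons; case: unlift.
have r0 : (0 : R) <= r%:R by rewrite ler0n.
apply/cvgrPdist_lt => e e0.
have e20 : 0 < e / 2 by rewrite divr_gt0.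
suff [lo up] : (\forall k \near U, L - e < feval (FSup r psi) (fun i => a i k))
    /\ (\forall k \near U, feval (FSup r psi) (fun i => a i k) < L + e).
  apply: filterS2 lo up => k h1 h2; rewrite ltr_norml; clear -h1 h2; lra.
split.
  (* Lower bound: a near-maximizer in the ultraproduct is lifted to coordinates in the same ball. *)
  have /feval_sup_gt[x xr Lx] : L - e < feval (FSup r psi) va by rewrite ltrBlDr ltrDl.
  have [b bx br] := ucls_ball_lift r0 xr.
  have := vlift b; rewrite bx => /cvgr_gt/(_ _ Lx); apply: filterS => k h.
  exact: lt_le_trans h (feval_sup_ge _ _ (br k)).
have [//|nU] := in_ultra_setVsetC
  [set k | feval (FSup r psi) (fun i => a i k) < L + e] UU.
(* Upper bound: where it fails, x is a witness above L + e/2; elsewhere 0 is a filler. The class of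
   these witnesses has value at most L, which is contradicted at some coordinate of the failure
   set. *)
have hb k : exists x : A k, rnorm x <= r%:R /\
    (~ (feval (FSup r psi) (fun i => a i k) < L + e) ->
     L + e / 2 < feval psi (vcons x (fun i => a i k))).
  have [h|h] := pselect (feval (FSup r psi) (fun i => a i k) < L + e).
    by exists 0; rewrite rnorm0; split.
  have /feval_sup_gt[x xr Lx] : L + e / 2 < feval (FSup r psi) (fun i => a i k).
    by move/negP: h; rewrite -leNgt; apply: lt_le_trans; clear -e0; lra.
  by exists x.
pose b k := sval (cid (hb k)); have bP k := svalP (cid (hb k)).
have bb : bounded_seq b by exists r%:R => k; exact: (bP k).1.
have : feval psi (vcons (ucls UU (CProd bb) : ulim) va) < L + e / 2.
  apply: (@le_lt_trans _ _ L); last by rewrite ltrDl.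
  apply: feval_sup_ge; rewrite ultraproduct_normE; apply: unorm_leU => //.
  by apply: filterE => k /=; exact: (bP k).1.
move=> /(cvgr_lt _ (vlift _)) h.
have [k [/= h1 h2]] := filter_ex (filterI nU h).
by have := lt_trans h2 ((bP k).2 h1); rewrite ltxx.
Qed.

Lemma los_conn n k (f : 'rV[R]_k -> R) (fc : continuous f)
    (psi : 'I_k -> cformula R false n) : (forall i, los (psi i)) -> los (FConn fc psi).
Proof.
move=> ih a /=.
apply: (@cvg_comp _ _ _ (fun j => \row_i feval (psi i) (fun i => a i j)) f _
  (nbhs (\row_i feval (psi i) (fun i => ucls UU (a i) : ulim)))); last exact: fc.
apply/cvg_ballP => e e0.
suff : \forall j \near U, forall i, ball (feval (psi i) (fun i => ucls UU (a i) : ulim)) e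
    (feval (psi i) (fun i => a i j)).
  by apply: filterS => j h; split=> // i l; rewrite !mxE; exact: h.
apply: filter_forall => i.
by have /cvg_ballP := ih i a; apply.
Qed.

Lemma los_theorem n (phi : cformula R false n) : los phi.
Proof.
elim: phi => {n} [n s t|n k f fc psi ih|n r psi ih|n r psi ih].
- move=> a /=; rewrite !teval_ucls.
  have -> : ucls UU (teval a s) - ucls UU (teval a t) = ucls UU (teval a s - teval a t).
    exact/esym/raddfB.
  have := @unorm_cvg _ _ UU _ (teval a s - teval a t).
  suff -> : (fun k => rnorm ((teval a s - teval a t) k))
    = (fun k => rnorm (teval (fun i => a i k) s - teval (fun i => a i k) t)) by [].
  by apply/funext => k; rewrite !teval_coord.
- exact: los_conn.
- exact: los_sup.
- move=> a; rewrite feval_inf_neg.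
  have -> : (fun k => feval (FInf r psi) (fun i => a i k))
    = (fun k => - feval (FSup r (FNeg psi)) (fun i => a i k)).
    by apply/funext => k; rewrite feval_inf_neg.
  apply: cvgN; apply: los_sup; apply: los_conn => i; exact: ih.
Qed.

End Los.

(** * The sentences *)

Section Combinators.
Variables (R : realType) (u : bool).

Definition FNorm n (t : cterm R u n) := FDist t (TZero R u n).

Definition TSum n k (t : 'I_k -> cterm R u n) := \big[@TAdd R u n/TZero R u n]_i t i.

Definition TSub n (s t : cterm R u n) := TAdd s (TScale (- 1) t).

Lemma entries_sum_continuous k : continuous (fun x : 'rV[R]_k => \sum_i x 0 i).
Proof.
move=> x; elim: (index_enum _) => [|i s ih].
  by under eq_fun do rewrite big_nil; exact: cst_continuous.
under eq_fun do rewrite big_cons.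
by apply: cvgD ih; exact: coord_continuous.
Qed.

Definition FSum n k (psi : 'I_k -> cformula R u n) := FConn (@entries_sum_continuous k) psi.

Definition FAdd n (phi psi : cformula R u n) :=
  FSum (fun i : 'I_2 => if i == ord0 then phi else psi).

Lemma entry_comp_continuous (g : R -> R) : continuous g ->
  continuous (fun x : 'rV[R]_1 => g (x 0 0)).
Proof. by move=> gc x; apply: continuous_comp (gc _); exact: coord_continuous. Qed.

Definition FUn n (g : R -> R) (gc : continuous g) (phi : cformula R u n) :=
  FConn (entry_comp_continuous gc) (fun=> phi).

Lemma pos_part_continuous (s c : R) : continuous (fun x : R => Num.max 0 (s * x + c)).
Proof.
move=> x; apply: (@continuous_max R R (fun=> 0) (fun x => s * x + c)) => /=.
  exact: cst_continuous.
by apply: cvgD; [exact: mulrl_continuous|exact: cvg_cst].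
Qed.

Definition FPos n s c (phi : cformula R u n) := FUn (@pos_part_continuous s c) phi.

Definition FScale n c (phi : cformula R u n) := FUn (@mulrl_continuous R c) phi.

Variable A : cstarAlgType R.

Lemma teval_sum n k (t : 'I_k -> cterm R u n) (v : 'I_n -> A) :
  teval v (TSum t) = \sum_i teval v (t i).
Proof. exact: (big_morph (teval v)). Qed.

Lemma teval_sub n (s t : cterm R u n) (v : 'I_n -> A) :
  teval v (TSub s t) = teval v s - teval v t.
Proof. by rewrite /= scaleN1r. Qed.

Lemma feval_norm n (t : cterm R u n) (v : 'I_n -> A) : feval (FNorm t) v = rnorm (teval v t).
Proof. by rewrite /= subr0. Qed.

Lemma feval_sum n k (psi : 'I_k -> cformula R u n) (v : 'I_n -> A) :
  feval (FSum psi) v = \sum_i feval (psi i) v.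
Proof. by apply: eq_bigr => i _; rewrite mxE. Qed.

Lemma feval_add n (phi psi : cformula R u n) (v : 'I_n -> A) :
  feval (FAdd phi psi) v = feval phi v + feval psi v.
Proof. by rewrite feval_sum big_ord_recl big_ord1. Qed.

Lemma feval_pos n s c (phi : cformula R u n) (v : 'I_n -> A) :
  feval (FPos s c phi) v = Num.max 0 (s * feval phi v + c).
Proof. by rewrite /= mxE. Qed.

Lemma feval_scale n c (phi : cformula R u n) (v : 'I_n -> A) :
  feval (FScale c phi) v = c * feval phi v.
Proof. by rewrite /= mxE. Qed.

End Combinators.

Section Tuples.
Variables (R : realType).

Definition vcat (A : Type) m n (a : 'I_m -> A) (v : 'I_n -> A) (i : 'I_(m + n)) : A :=
  match fintype.split i with inl j => a j | inr j => v j end.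

Lemma vcat_lshift (A : Type) m n (a : 'I_m -> A) (v : 'I_n -> A) i :
  vcat a v (lshift n i) = a i.
Proof. by rewrite /vcat -[lshift n i]/(unsplit (inl i)) unsplitK. Qed.

Lemma vcat_rshift (A : Type) m n (a : 'I_m -> A) (v : 'I_n -> A) i :
  vcat a v (rshift m i) = v i.
Proof. by rewrite /vcat -[rshift m i]/(unsplit (inr i)) unsplitK. Qed.

Lemma vcons_vcat (A : cstarAlgType R) m n x (a : 'I_m -> A) (v : 'I_n -> A) :
  vcons x (vcat a v) = vcat (vcons x a) v :> ('I_(m.+1 + n) -> A).
Proof.
apply/funext => i; rewrite /vcons; case: (unliftP ord0 i) => [j ->|->].
  case: (split_ordP j) => l ->; rewrite ?vcat_lshift ?vcat_rshift.
    have -> : lift ord0 (lshift n l) = lshift n (lift ord0 l) by exact/val_inj.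
    by rewrite vcat_lshift liftK.
  have -> : lift ord0 (rshift m l) = rshift m.+1 l by exact/val_inj.
  by rewrite vcat_rshift.
have -> : ord0 = lshift n (@ord0 m) by exact/val_inj.
by rewrite vcat_lshift unlift_none.
Qed.

Fixpoint FSups m n (r : nat) : cformula R false (m + n) -> cformula R false n :=
  match m with
  | 0%N => id
  | m'.+1 => fun phi => @FSups m' n r (FSup r phi)
  end.

Definition FInfs m n r (phi : cformula R false (m + n)) := FNeg (FSups r (FNeg phi)).

Variable A : cstarAlgType R.

Lemma feval_sups_ge m n r (phi : cformula R false (m + n)) (v : 'I_n -> A) a :
  (forall i, rnorm (a i) <= r%:R) -> feval phi (vcat a v) <= feval (FSups r phi) v.
Proof.
elim: m phi a => [|m ih] phi a ar /=.
  suff -> : vcat a v = v by [].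
  by apply/funext => i; rewrite -(vcat_rshift a v i); congr vcat; exact/val_inj.
have -> : a = vcons (a ord0) (fun i => a (lift ord0 i)).
  by apply/funext => i; rewrite /vcons; case: (unliftP ord0 i) => [j ->|->].
rewrite -vcons_vcat; apply: (le_trans (feval_sup_ge _ _ (ar _))).
by apply: (ih (FSup r phi)) => i; exact: ar.
Qed.

Lemma feval_sups_gt m n r (phi : cformula R false (m + n)) (v : 'I_n -> A) c :
  c < feval (FSups r phi) v ->
  exists2 a, (forall i, rnorm (a i) <= r%:R) & c < feval phi (vcat a v).
Proof.
elim: m phi => [|m ih] phi /= cphi.
  have a : 'I_0 -> A by case.
  exists a; first by case.
  suff -> : vcat a v = v by [].
  by apply/funext => i; rewrite -(vcat_rshift a v i); congr vcat; exact/val_inj.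
have [a ar /feval_sup_gt[x xr h]] := ih _ cphi.
by exists (vcons x a); [exact: vcons_ball|rewrite -vcons_vcat].
Qed.

Lemma feval_infs_le m n r (phi : cformula R false (m + n)) (v : 'I_n -> A) a :
  (forall i, rnorm (a i) <= r%:R) -> feval (FInfs r phi) v <= feval phi (vcat a v).
Proof.
move=> ar; rewrite /FInfs feval_neg lerNl -feval_neg; exact: feval_sups_ge.
Qed.

Lemma feval_infs_lt m n r (phi : cformula R false (m + n)) (v : 'I_n -> A) c :
  feval (FInfs r phi) v < c ->
  exists2 a, (forall i, rnorm (a i) <= r%:R) & feval phi (vcat a v) < c.
Proof.
rewrite /FInfs feval_neg ltrNl => /feval_sups_gt[a ar].
by rewrite feval_neg ltrN2; exists a.
Qed.

End Tuples.

Section Defects.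
Variables (R : realType) (k d : nat).

Section Values.
Variable A : cstarAlgType R.

Definition creturn (u : 'I_k -> A) (p : A) : A :=
  \sum_i (cmul p (cmul (adj (u i)) (cmul p (cmul (u i) p)))
        + cmul p (cmul (u i) (cmul p (cmul (adj (u i)) p)))).

(* Failure of [expands_thin] at [w], as a sum of nonnegative terms. *)
Definition thin_defect (u : 'I_k -> A) (w : 'I_4 -> A) : R :=
  let p := cmul (adj (w ord0)) (w ord0) in
  rnorm (cmul p p - p) + (\sum_j rnorm (cmul (adj (w j)) (w j) - p)
  + (Num.max 0 (1 * rnorm (\sum_j cmul (w j) (adj (w j))) + - 1)
  + (Num.max 0 (- 1 * rnorm p + 1)
  + Num.max 0 (1 * rnorm ((2 * k%:R)%:C *: p - creturn u p) + - (k%:R * (11/10)))))).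

(** In the language without 1, u^* u = 1 is expressed by its action on elements x of the unit
    ball. *)
Definition isometry_defect (u : 'I_k -> A) (x : A) : R :=
  \sum_i rnorm (cmul (adj (u i)) (cmul (u i) x) - x).

(* For a completely positive map on 'M_d with Choi matrix b^* b, its value at [m]. *)
Definition ckraus (b : 'I_d -> 'I_d -> A) (m : 'M[R[i]]_d) : A :=
  \sum_r \sum_j \sum_l m j l *: cmul (adj (b r j)) (b r l).

Definition kraus_defect (v : 'I_k -> 'M[R[i]]_d) (u : 'I_k -> A) (b : 'I_d -> 'I_d -> A) : R :=
  \sum_i rnorm (ckraus b (v i) - u i) + Num.max 0 (1 * rnorm (ckraus b 1%:M) + - 1).

Lemma thin_defect_lt u w e : thin_defect u w < e ->
  let p := cmul (adj (w ord0)) (w ord0) in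
  [/\ rnorm (cmul p p - p) <= e, forall j, rnorm (cmul (adj (w j)) (w j) - p) <= e,
      rnorm (\sum_j cmul (w j) (adj (w j))) <= 1 + e, 1 - e <= rnorm p
    & rnorm ((2 * k%:R)%:C *: p - creturn u p) < k%:R * (11/10) + e].
Proof.
move=> + p; rewrite /thin_defect -/p.
set a1 := rnorm (_ - p); set a2 := \sum_j rnorm _; set x3 := rnorm _.
set x4 := rnorm p; set x5 := rnorm _; set K := k%:R * _.
have h1 : 0 <= a1 by exact: rnorm_ge0.
have h2 : 0 <= a2 by rewrite sumr_ge0// => j _; exact: rnorm_ge0.
have h3 : 0 <= Num.max 0 (1 * x3 + - 1) by rewrite le_max lexx.
have h4 : 0 <= Num.max 0 (- 1 * x4 + 1) by rewrite le_max lexx.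
have h5 : 0 <= Num.max 0 (1 * x5 + - K) by rewrite le_max lexx.
have g3 : 1 * x3 + - 1 <= Num.max 0 (1 * x3 + - 1) by rewrite le_max lexx orbT.
have g4 : - 1 * x4 + 1 <= Num.max 0 (- 1 * x4 + 1) by rewrite le_max lexx orbT.
have g5 : 1 * x5 + - K <= Num.max 0 (1 * x5 + - K) by rewrite le_max lexx orbT.
move: h3 h4 h5 g3 g4 g5; move: (Num.max _ _) (Num.max _ _) (Num.max _ _) => y3 y4 y5 *.
have h2j j : rnorm (cmul (adj (w j)) (w j) - p) <= a2.
  by rewrite /a2 (bigD1 j)//= lerDl sumr_ge0// => l _; exact: rnorm_ge0.
split; [lra|move=> j; have := h2j j; lra|lra|lra|lra].
Qed.

Lemma thin_defect_gt0 u w : 0 < thin_defect u w ->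
  let p := cmul (adj (w ord0)) (w ord0) in
  cmul p p = p -> (forall j, cmul (adj (w j)) (w j) = p) ->
  rnorm (\sum_j cmul (w j) (adj (w j))) <= 1 -> 1 <= rnorm p ->
  k%:R * (11/10) < rnorm ((2 * k%:R)%:C *: p - creturn u p).
Proof.
rewrite /thin_defect; move: (cmul (adj (w ord0)) (w ord0)) => p /= + pp wp.
rewrite pp subrr rnorm0 big1 => [|j _]; last first.
  by rewrite wp subrr rnorm0.
set x3 := rnorm _; set x4 := rnorm p; set x5 := rnorm _; set K := k%:R * _.
move=> + h3 h4; rewrite !mul1r mulN1r.
have -> : Num.max 0 (x3 - 1) = 0 by apply/max_idPl; rewrite subr_le0.
have -> : Num.max 0 (- x4 + 1) = 0 by apply/max_idPl; rewrite addrC subr_le0.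
by rewrite !add0r lt_max ltxx /= subr_gt0.
Qed.

Lemma cmul0r (x : A) : cmul 0 x = 0.
Proof. by rewrite -[X in cmul X _](scale0r (0 : A)) cmulZl scale0r. Qed.

Lemma adj0 : adj (0 : A) = 0.
Proof. by rewrite -[X in adj X](scale0r (0 : A)) Defs.adjZ rmorph0 scale0r. Qed.

(** At w = 0 only the term asking for a norm at least 1 survives. This value bounds the infimum over
    w. *)
Lemma thin_defect0 u : thin_defect u (fun=> 0) = 1.
Proof.
rewrite /thin_defect adj0 !cmul0r /creturn scaler0 !subr0 rnorm0 !big1.
- rewrite subr0 rnorm0 !mulr0 !add0r.
  rewrite [Num.max 0 (- 1)](max_idPl _) ?lerN10// [Num.max 0 1](max_idPr _) ?ler01//.
  by rewrite add0r (max_idPl _) ?addr0// oppr_le0 mulr_ge0// divr_ge0.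
- by move=> i _; rewrite !cmul0r addr0.
- by [].
- by [].
Qed.

Lemma isometry_defect_ge0 u x : 0 <= isometry_defect u x.
Proof. by rewrite sumr_ge0// => i _; exact: rnorm_ge0. Qed.

Lemma kraus_defect_ge0 v u b : 0 <= kraus_defect v u b.
Proof. by rewrite addr_ge0 ?le_max ?lexx// sumr_ge0// => i _; exact: rnorm_ge0. Qed.

End Values.

Section Formulas.
Variable n : nat.
Local Notation term := (cterm R false n).
Local Notation form := (cformula R false n).

Definition TReturn (u : 'I_k -> term) (p : term) : term :=
  TSum (fun i => TAdd (TMul p (TMul (TAdj (u i)) (TMul p (TMul (u i) p))))
                      (TMul p (TMul (u i) (TMul p (TMul (TAdj (u i)) p))))).

Definition FThin (u : 'I_k -> term) (w : 'I_4 -> term) : form :=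
  let p := TMul (TAdj (w ord0)) (w ord0) in
  FAdd (FNorm (TSub (TMul p p) p))
  (FAdd (FSum (fun j => FNorm (TSub (TMul (TAdj (w j)) (w j)) p)))
  (FAdd (FPos 1 (- 1) (FNorm (TSum (fun j => TMul (w j) (TAdj (w j))))))
  (FAdd (FPos (- 1) 1 (FNorm p))
  (FPos 1 (- (k%:R * (11/10))) (FNorm (TSub (TScale (2 * k%:R)%:C p) (TReturn u p))))))).

Definition FIsometry (u : 'I_k -> term) (x : term) : form :=
  FSum (fun i => FNorm (TSub (TMul (TAdj (u i)) (TMul (u i) x)) x)).

Definition TKraus (b : 'I_d -> 'I_d -> term) (m : 'M[R[i]]_d) : term :=
  TSum (fun r => TSum (fun j => TSum (fun l =>
    TScale (m j l) (TMul (TAdj (b r j)) (b r l))))).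

Definition FKraus (v : 'I_k -> 'M[R[i]]_d) (u : 'I_k -> term) (b : 'I_d -> 'I_d -> term) : form :=
  FAdd (FSum (fun i => FNorm (TSub (TKraus b (v i)) (u i))))
       (FPos 1 (- 1) (FNorm (TKraus b 1%:M))).

Variables (A : cstarAlgType R) (e : 'I_n -> A).

Lemma feval_thin u w :
  feval (FThin u w) e = thin_defect (fun i => teval e (u i)) (fun j => teval e (w j)).
Proof.
rewrite /FThin !feval_add feval_sum !feval_pos !feval_norm !teval_sub !teval_sum.
by congr (_ + (_ + _)); apply: eq_bigr => j _; rewrite feval_norm teval_sub.
Qed.

Lemma feval_isometry u x :
  feval (FIsometry u x) e = isometry_defect (fun i => teval e (u i)) (teval e x).
Proof. by rewrite feval_sum; apply: eq_bigr => i _; rewrite feval_norm teval_sub. Qed.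

Lemma teval_kraus b m : teval e (TKraus b m) = ckraus (fun r j => teval e (b r j)) m.
Proof.
rewrite teval_sum; apply: eq_bigr => r _; rewrite teval_sum; apply: eq_bigr => j _.
by rewrite teval_sum.
Qed.

Lemma feval_kraus v u b : feval (FKraus v u b) e
  = kraus_defect v (fun i => teval e (u i)) (fun r j => teval e (b r j)).
Proof.
rewrite feval_add feval_pos feval_norm feval_sum teval_kraus; congr (_ + _).
by apply: eq_bigr => i _; rewrite feval_norm teval_sub teval_kraus.
Qed.

End Formulas.

End Defects.

Section Sentences.
Variables (R : realType) (k : nat).

(* As [thin_defect] is 1 at w = 0, the infimum is at most 1: a positive value of
   [FGap] bounds the isometry defect by 1/2000. *)
Definition FGap : cformula R false (k + 0) :=
  FAdd (FInfs (m := 4) 1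
          (FThin (fun i => TVar R false (rshift 4 (lshift 0 i)))
                 (fun j => TVar R false (lshift (k + 0) j))))
       (FScale (- 2000) (FSups (m := 1) 1
          (FIsometry (fun i => TVar R false (rshift 1 (lshift 0 i)))
                     (TVar R false (lshift (k + 0) ord0))))).

Section Gap.
Variables (A : cstarAlgType R) (v : 'I_(k + 0) -> A).
Let u i := v (lshift 0 i).

Lemma FGap_ge c :
  (forall w, (forall j, rnorm (w j) <= 1) -> c <= thin_defect u w) ->
  (forall i x, cmul (adj (u i)) (cmul (u i) x) = x) -> c <= feval FGap v.
Proof.
move=> hw hu; rewrite /FGap feval_add feval_scale.
set I := feval _ v; set S := feval _ v.
have hI : c <= I.
  rewrite leNgt; apply/negP; rewrite /I => /feval_infs_lt[w w1].
  rewrite feval_thin /= => /lt_geF.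
  have -> : (fun i => vcat w v (rshift 4 (lshift 0 i))) = u.
    by apply/funext => i; rewrite vcat_rshift.
  have -> : (fun j => vcat w v (lshift (k + 0) j)) = w.
    by apply/funext => j; rewrite vcat_lshift.
  by rewrite hw.
have hS : S <= 0.
  rewrite leNgt; apply/negP; rewrite /S => /feval_sups_gt[x x1].
  rewrite feval_isometry /isometry_defect big1 ?ltxx// => i _ /=.
  by rewrite vcat_rshift hu subrr rnorm0.
clear -hI hS; lra.
Qed.

Lemma FGap_gt c : c < feval FGap v ->
  forall w x, (forall j, rnorm (w j) <= 1) -> rnorm x <= 1 ->
  c + 2000 * isometry_defect u x < thin_defect u w.
Proof.
move=> + w x w1 x1; rewrite /FGap feval_add feval_scale.
set I := feval _ v; set S := feval _ v.
have : I <= thin_defect u w.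
  rewrite /I; apply: (le_trans (feval_infs_le (a := w) _ _ _)) => //.
  rewrite feval_thin /=.
  rewrite le_eqVlt; apply/orP; left; apply/eqP; congr thin_defect; apply/funext => i.
    by rewrite vcat_rshift.
  by rewrite vcat_lshift.
have : isometry_defect u x <= S.
  rewrite /S; apply: le_trans (feval_sups_ge (a := fun=> x) _ _ _) => //.
  rewrite feval_isometry /=.
  rewrite vcat_lshift le_eqVlt; apply/orP; left; apply/eqP; congr isometry_defect.
  by apply/funext => i; rewrite vcat_rshift.
by move: (isometry_defect _ _) (thin_defect _ _) => *; lra.
Qed.

End Gap.

Definition gap_sentence : cformula R false 0 := FSups (m := k) 1 FGap.

(** The entries of v are scalars inside the terms; only the d^2 elements b are quantified. Their
    radius r is a parameter, as a single sentence quantifies over fixed balls. *)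
Definition FFactor d (v : 'I_k -> 'M[R[i]]_d) (r : nat) : cformula R false (k + 0) :=
  FInfs (m := d * d) r
    (FKraus v (fun i => TVar R false (rshift (d * d) (lshift 0 i)))
              (fun s j => TVar R false (lshift (k + 0) (mxvec_index s j)))).

Section Factor.
Variables (A : cstarAlgType R) (e : 'I_(k + 0) -> A).
Let u i := e (lshift 0 i).
Variables (d : nat) (v : 'I_k -> 'M[R[i]]_d) (r : nat).

Lemma FFactor_le b : (forall s j, rnorm (b s j) <= r%:R) ->
  feval (FFactor v r) e <= kraus_defect v u b.
Proof.
move=> br; pose a z := mxvec (\matrix_(s, j) b s j) 0 z.
have ab s j : a (mxvec_index s j) = b s j by rewrite /a mxvecE mxE.
apply: (le_trans (feval_infs_le (a := a) _ _ _)).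
  by move=> z; case/mxvec_indexP: z => s j; rewrite ab.
rewrite feval_kraus /=; have -> : (fun i => vcat a e (rshift (d * d) (lshift 0 i))) = u.
  by apply/funext => i; rewrite vcat_rshift.
suff -> : (fun s j => vcat a e (lshift (k + 0) (mxvec_index s j))) = b by [].
by apply/funext => s; apply/funext => j; rewrite vcat_lshift.
Qed.

Lemma FFactor_lt c : feval (FFactor v r) e < c ->
  exists b, kraus_defect v u b < c.
Proof.
move=> /feval_infs_lt[a _]; rewrite feval_kraus /= => h.
exists (fun s j => vcat a e (lshift (k + 0) (mxvec_index s j))).
suff <- : (fun i => vcat a e (rshift (d * d) (lshift 0 i))) = u by [].
by apply/funext => i; rewrite vcat_rshift.
Qed.

End Factor.

(** As [FGap] is at most 1, the weight 2000 makes a positive value force a factorization within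
    1/2000. *)
Definition factor_sentence d (v : 'I_k -> 'M[R[i]]_d) (r : nat) : cformula R false 0 :=
  FSups (m := k) 1 (FAdd FGap (FScale (- 2000) (FFactor v r))).

End Sentences.

(** * Choi matrices and nuclearity *)

Section Nuclear.
Variables (R : realType) (A : cstarAlgType R).

(** Choi's argument: the matrix of matrix units E_jl is positive, hence so is its image under psi.
    This gives psi(E_jl) as the sum over r of b_rj^* b_rl, and linearity does the rest. The v_i are
    the phi(u_i). *)
Lemma nuclear_kraus k (u : 'I_k -> A) (e : R) : nuclear A ->
  (forall i, rnorm (u i) <= 1) -> 0 < e ->
  exists d (v : 'I_k -> 'M[R[i]]_d) (b : 'I_d -> 'I_d -> A),
    (forall i, opnorm (v i) <= 1) /\ kraus_defect v u b < e.
Proof.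
move=> nA u1 e0; have e'0 : 0 < e / (k%:R + 1) by rewrite divr_gt0// ltr_wpDl.
have matalg_adjE d (i j : 'I_d) : adj (delta_mx i j : matalg R d) = delta_mx j i :> matalg R d.
  by rewrite -[LHS]/(map_mx Num.conj (delta_mx i j)^T) trmx_delta map_delta_mx.
have mulE d (x y : matalg R d) : cmul x y = (x : 'M[R[i]]_d) *m y by [].
have [d [phi [psi [[_ phi1] [psicp psi1] hF]]]] := nA [seq u i | i : 'I_k] _ e'0.
pose X : 'M[matalg R d]_d := \matrix_(j, l) (delta_mx j l : matalg R d).
have Xpos : mx_positive X.
  (* The witness has E_0j in its row 0 and zeros below: E_0i^* E_0j = E_ij. *)
  exists (\matrix_(r, j) ((val r == 0%N)%:R *: delta_mx r j : matalg R d)) => i j.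
  have d0 : (0 < d)%N by exact: leq_ltn_trans (ltn_ord i).
  rewrite (bigD1 (Ordinal d0))//= big1 => [|l l0].
    by rewrite addr0 !mxE !scale1r matalg_adjE mulE mul_delta_mx.
  have /negPf l0' : val l != 0%N by apply: contraNneq l0 => l0; exact/eqP/val_inj.
  by rewrite !mxE l0' !scale0r adj0 cmul0r.
have [b bP] := psicp _ _ Xpos.
have psiE m : psi m = ckraus b m.
  rewrite /ckraus exchange_big /=.
  rewrite [in LHS](matrix_sum_delta m).
  rewrite raddf_sum; apply: eq_bigr => j _.
  rewrite exchange_big raddf_sum; apply: eq_bigr => l _ /=.
  rewrite linearZ -scaler_sumr; congr (_ *: _).
  by have := bP j l; rewrite !mxE.
exists d, (fun i => phi (u i)), b; split.
  move=> i; apply: le_trans (u1 i); rewrite -matalg_normE.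
  by have := phi1 (u i); rewrite !rnormE lecR.
rewrite /kraus_defect.
have -> : Num.max 0 (1 * rnorm (ckraus b 1%:M) + - 1) = 0.
  apply/max_idPl; rewrite mul1r subr_le0 -psiE.
  have := psi1 1%:M; rewrite !rnormE lecR => /le_trans; apply.
  by rewrite matalg_normE; apply: opnorm_unitary; apply/unitarymxP; rewrite adjmx1 mulmx1.
rewrite addr0; apply: (@le_lt_trans _ _ (k%:R * (e / (k%:R + 1)))).
  rewrite mulr_natl -[X in _ *+ X]card_ord -sumr_const; apply: ler_sum => i _.
  rewrite -psiE; apply/ltW/hF; apply/mapP; exists i => //; exact: mem_enum.
rewrite mulrA ltr_pdivrMr ?ltr_wpDl// mulrC ltr_pM2l//; rewrite ltrDl//.
Qed.

End Nuclear.

(** * The sentences in matrix algebras *)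

Section MatrixModels.
Variable R : realType.
Local Notation C := R[i].

Lemma expander_thin_defect k n (u : 'I_k -> matalg R n.+1) (w : 'I_4 -> matalg R n.+1) :
  (0 < k)%N -> (forall i, (u i : 'M[C]_n.+1) \is unitarymx) ->
  (forall m (V : 'M[C]_(m, n.+1)), V \is unitarymx ->
    \sum_i hs2 (V *m u i *m V^t*) <= k%:R * (1 / 8 + m%:R / n.+1%:R) * m%:R) ->
  (forall j, rnorm (w j) <= 1) -> 1000^-1 <= thin_defect u w.
Proof.
move=> k0 uU uexp w1; rewrite leNgt; apply/negP => /thin_defect_lt[].
rewrite !matalg_normE => h1 h2 h3 h4.
suff : k%:R * (11 / 10) + 1000^-1 <= opnorm ((2 * k%:R)%:C *: ((w ord0)^t* *m w ord0)
    - returnmx u ((w ord0)^t* *m w ord0)) by move=> /le_lt_trans h /h; rewrite ltxx.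
apply: (robust_expansion (w := w) k0 _ uU uexp) => //.
have := rnorm_cstar (w ord0); rewrite matalg_normE => ->.
exact: exprn_ile1 (rnorm_ge0 _) (w1 ord0).
Qed.

Lemma thin_defect_expands k n (u : 'I_k -> matalg R n) :
  (forall w, (forall j, rnorm (w j) <= 1) -> 0 < thin_defect u w) ->
  expands_thin (u : 'I_k -> 'M[C]_n).
Proof.
move=> hu w h w1 hh wh ws h1.
by have /thin_defect_gt0 := hu w w1; rewrite !matalg_normE; apply.
Qed.

(** A positive value provides a tuple u with [FGap] positive. Inserting w = 0 bounds the isometry
    defect by 1/2000, inserting x = 0 gives expansion of thin projections, and the remaining term
    gives a factorization within 1/2000. These are the data excluded by [no_small_model]. *)
Lemma no_factorization k n d (v : 'I_k -> 'M[C]_d) r : (0 < k)%N -> (4 * d <= n.+1)%N ->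
  (forall i, opnorm (v i) <= 1) -> seval (matalg R n.+1) (factor_sentence v r) <= 0.
Proof.
move=> k0 dn v1; rewrite leNgt; apply/negP => /feval_sups_gt[u0 u01].
set e := vcat u0 _; pose u i := e (lshift 0 i).
have u1 i : rnorm (u i) <= 1 by rewrite /u /e vcat_lshift.
rewrite feval_add feval_scale; set G := feval (FGap _ _) e; set N := feval _ e => hGN.
have N0 : 0 <= N by rewrite leNgt; apply/negP => /FFactor_lt[b]; rewrite ltNge kraus_defect_ge0.
have G0 : 0 < G by move: N0 hGN; move: (G) (N) => x y; clear; lra.
have hG := FGap_gt G0.
have hx x : rnorm x <= 1 -> isometry_defect u x <= 2000^-1.
  move=> x1; have := hG (fun=> 0) x.
  rewrite thin_defect0 rnorm0 => /(_ (fun=> ler01) x1).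
  by move: (isometry_defect _ _) => y; clear; lra.
have G1 : G <= 1.
  rewrite leNgt; apply/negP => /FGap_gt/(_ (fun=> 0) 0).
  rewrite rnorm0 => /(_ (fun=> ler01) ler01); rewrite thin_defect0.
  have := isometry_defect_ge0 (fun i => e (lshift 0 i)) 0.
  by move: (isometry_defect _ _) => x; clear; lra.
have [|b] := @FFactor_lt _ _ _ e _ v r 2000^-1; first by rewrite -/N; move: hGN G1; move: (G) (N) => x y; clear; lra.
rewrite /kraus_defect; set x1 := \sum_i _; set x2 := rnorm _ => hb.
have x10 : 0 <= x1 by rewrite sumr_ge0// => i _; exact: rnorm_ge0.
have x2m : 1 * x2 + - 1 <= Num.max 0 (1 * x2 + - 1) by rewrite le_max lexx orbT.
have x2p : 0 <= Num.max 0 (1 * x2 + - 1) by rewrite le_max lexx.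
have x1b i : rnorm (ckraus b (v i) - u i) <= x1.
  by rewrite /x1 (bigD1 i)//= lerDl sumr_ge0// => j _; exact: rnorm_ge0.
apply: (@no_small_model R k d n.+1 u v b 2000^-1 k0 isT erefl _ v1 _ dn).
- by move=> i; rewrite -matalg_normE.
- apply: thin_defect_expands => w w1; have := hG w 0 w1.
  rewrite rnorm0 => /(_ ler01) h.
  have h0 := isometry_defect_ge0 (fun i => e (lshift 0 i)) 0.
  move: h h0; rewrite -/u.
  by move: (isometry_defect _ _) (thin_defect _ _) => x y; clear; lra.
- move=> i; rewrite -matalg_normE.
  have one1 : rnorm (1%:M : matalg R n.+1) <= 1.
    by rewrite matalg_normE; apply: opnorm_unitary; apply/unitarymxP; rewrite adjmx1 mulmx1.
  apply: le_trans (hx _ one1); rewrite /isometry_defect (bigD1 i)//=.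
  have -> : cmul (adj (u i)) (cmul (u i) (1%:M : matalg R n.+1)) = (u i)^t* *m u i.
    by rewrite -[RHS]mulmx1 -mulmxA.
  by rewrite lerDl sumr_ge0// => j _; exact: rnorm_ge0.
- move=> i; rewrite -matalg_normE; apply: le_trans (x1b i) _.
  by move: hb x2p; move: (x1) (Num.max _ _) => x y; clear; lra.
- rewrite -matalg_normE; suff : x2 <= 1 + 2000^-1 by [].
  by move: hb x10 x2m; move: (x1) (x2) (Num.max _ _) => x y z; clear; lra.
Qed.

Lemma gap_sentence_ge k n (u : 'I_k -> 'M[C]_n.+1) :
  (0 < k)%N -> (forall i, u i \is unitarymx) ->
  (forall m (V : 'M[C]_(m, n.+1)), V \is unitarymx ->
    \sum_i hs2 (V *m u i *m V^t*) <= k%:R * (1 / 8 + m%:R / n.+1%:R) * m%:R) ->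
  1000^-1 <= seval (matalg R n.+1) (gap_sentence R k).
Proof.
move=> k0 uU uexp; pose e := vcat (u : 'I_k -> matalg R n.+1) (fun _ : 'I_0 => 0 : matalg R n.+1).
have ue : (fun i => e (lshift 0 i)) = u by apply/funext => i; rewrite /e vcat_lshift.
apply: (@le_trans _ _ (feval (FGap R k) e)); last first.
  by apply: feval_sups_ge => i; rewrite matalg_normE; exact: opnorm_unitary.
apply: FGap_ge => [w w1|i x]; first by rewrite ue; exact: expander_thin_defect.
have -> : e (lshift 0 i) = u i by rewrite -ue.
have -> : cmul (adj (u i : matalg R n.+1)) (cmul (u i : matalg R n.+1) x)
    = (u i)^t* *m (u i *m x) by [].
by rewrite mulmxA unitary_adjK// mul1mx.
Qed.

End MatrixModels.

Lemma seval_los (R : realType) (U : set_system nat) (UU : UltraFilter U)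
    (A : nat -> cstarAlgType R) (phi : cformula R false 0) :
  (fun n => seval (A n) phi) @ U --> seval (ultraproduct UU A : cstarAlgType R) phi.
Proof.
have := @los_theorem _ _ UU A _ phi (fun=> 0); rewrite /seval.
suff -> : (fun i : 'I_0 => ucls UU 0 : (ultraproduct UU A : cstarAlgType R)) = (fun=> 0) by [].
by apply/funext; case.
Qed.

(** Makes the sizes below 4d, where a model of size d is not excluded, negligible for U. *)
Lemma nonprincipal_ge (U : set_system nat) (UU : UltraFilter U)
    (U_nonprincipal : forall n : nat, ~ U [set n]) N : U [set n | (N <= n)%N].
Proof.
elim: N => [|N ih]; first by apply: filterE.
have [/U_nonprincipal//|hN] := in_ultra_setVsetC [set N] UU.
apply: filterS2 ih hN => n /= Nn nN; rewrite ltn_neqAle Nn andbT.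
by apply/eqP => /esym.
Qed.

(* The coordinate n carries the algebra of matrices of size n + 1, so that the
   sizes 1, 2, 3 and so on are listed by nat. *)
Theorem proposition7p2p5 (R : realType) (U : set_system nat)
    (UU : UltraFilter U) (U_nonprincipal : forall n : nat, ~ U [set n])
    (A : cstarAlgType R) (A_nuclear : nuclear A) :
  ~ elementarily_equivalent
      (ultraproduct UU (fun n => matalg R n.+1 : cstarAlgType R)) A.
Proof.
move=> [EE _]; have [k [k0 exp_k]] := strong_expander R.
have gap : 1000^-1 <= seval A (gap_sentence R k).
  rewrite -EE; apply: (cvgr_to_ge (@seval_los _ _ UU (fun n => matalg R n.+1 : cstarAlgType R) _)).
  apply: filterE => n; have [u [uU uexp]] := exp_k n.
  exact: gap_sentence_ge uU uexp.
(* The supremum need not be attained in A; half of the bound leaves room for a witness. *)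
have /feval_sups_gt[u u1 hu] : 2000^-1 < seval A (gap_sentence R k).
  by apply: lt_le_trans gap; rewrite ltf_pV2 ?posrE// ltr_nat.
set e := vcat u _ in hu.
have e1 i : rnorm (e (lshift 0 i)) <= 1 by rewrite /e vcat_lshift.
(* After multiplication by the weight 2000 a defect below this number stays below 1/2000, the lower
   bound for [FGap] at u. *)
have c0 : (0 : R) < 2000^-1 * 2000^-1 by rewrite mulr_gt0 ?invr_gt0 ?ltr0n.
have [d [v [b [v1 hb]]]] := nuclear_kraus A_nuclear e1 c0.
(* The elements b come without a common bound on their norms, while the sentence needs a fixed
   radius. *)
have [r hr] : exists r : nat, forall s j, rnorm (b s j) <= r%:R.
  exists (Num.bound (\sum_s \sum_j rnorm (b s j))) => s j.
  apply/ltW/(le_lt_trans _ (archi_boundP _)); last first.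
    by rewrite sumr_ge0// => i _; rewrite sumr_ge0// => l _; exact: rnorm_ge0.
  rewrite (bigD1 s)//= (bigD1 j)//= -addrA lerDl addr_ge0//.
    by rewrite sumr_ge0// => l _; exact: rnorm_ge0.
  by rewrite sumr_ge0// => i _; rewrite sumr_ge0// => l _; exact: rnorm_ge0.
have pos : 0 < seval A (factor_sentence v r).
  apply: lt_le_trans (feval_sups_ge (a := u) _ _ u1).
  rewrite feval_add feval_scale -/e.
  have := FFactor_le e v hr.
  move: hb hu; move: (feval (FGap _ _) e) (feval (FFactor _ _) e) (kraus_defect _ _ _) => x y z.
  clear; lra.
have lim0 := @seval_los _ _ UU (fun n => matalg R n.+1 : cstarAlgType R) (factor_sentence v r).
rewrite -EE in pos.
have := filter_ex (filterI (cvgr_gt _ lim0 _ pos) (nonprincipal_ge UU U_nonprincipal (4 * d))).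
move=> [n [/= n1 n2]].
have := @no_factorization R k n d v r k0 (leqW n2) v1.
by rewrite leNgt n1.
Qed.
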